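(* Let $\Gamma$ be a closed set in $\mathbb{C}^n$ of zero area such that $\widehat{D\cup\Gamma}\setminus\Gamma$ is bounded for every compact set $D\subset\mathbb{C}^n$. Let $B_1$ be an open ball with center at the origin which contains the closure of $\widehat{\Gamma}\setminus\Gamma$ (that is, the set $B_1\cup\Gamma$ contains the hull $\widehat{K}$ of every compact set $K\subset\Gamma$). Then, given two continuous functions $f,\epsilon\in\mathcal{C}(\Gamma)$ such that $\epsilon$ is real positive and $f$ can be uniformly approximated by polynomials on $\Gamma\cap\overline{B}_1$, there exists an entire function $F$ on $\mathbb{C}^n$ such that $|F(z)-f(z)|<\epsilon(z)$ for all $z\in\Gamma$.
   Context: The area of a subset of $\mathbb{C}^n$ is its Hausdorff $2$-measure. $\mathcal{C}(\Gamma)$ is the set of continuous complex-valued functions on $\Gamma$; polynomials are holomorphic polynomials in $n$ complex variables. For a compact set $K\subset\mathbb{C}^n$, $\widehat{K}=\{z\in\mathbb{C}^n: |p(z)|\le\max_K|p| \text{ for all polynomials } p\}$ is its polynomial hull. For an arbitrary subset $Y\subset\mathbb{C}^n$, the polynomially convex hull is $\widehat{Y}=\bigcup\{\widehat{K}: K\subset Y \text{ compact}\}$. $\overline{B}_1$ is the closure of $B_1$. *)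

(* Defs.v *)
From HB Require Import structures.
From mathcomp Require Import all_boot all_order all_algebra.
From mathcomp Require Import all_classical all_reals all_analysis.
From mathcomp.real_closed Require Import complex.
From mathcomp Require mpoly.

Set Implicit Arguments.
Unset Strict Implicit.
Unset Printing Implicit Defensive.

Import Order.TTheory GRing.Theory Num.Theory.
Import numFieldNormedType.Exports.

Local Open Scope classical_set_scope.
Local Open Scope ring_scope.

(* Packing R[i] as a numClosedFieldType gives it, and row vectors over it, the
   norm and topology that numFieldNormedType attaches to every numFieldType.
   The order on Cplx R is the partial one: 0 < w means that w is real and
   positive. *)
Definition Cplx (R : realType) : numClosedFieldType := R[i].

(* The library norm on row vectors is the sup norm; it induces the usual
   topology and the usual bounded sets.  Balls and diameters, which do depend on
   the metric, are taken with respect to the Euclidean norm enorm below. *)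
Definition Cspace (R : realType) (n : nat) : normedModType (Cplx R) :=
  'rV[Cplx R]_n.

Section SeveralComplexVariables.
Variables (R : realType) (n : nat).
Local Notation C := (Cplx R).
Local Notation Cn := (Cspace R n).

(* Real-valued modulus; the library's `|w| is the same number viewed in C. *)
Definition modulus (w : C) : R := complex.Re `|w|.

Definition enorm (z : Cn) : R := Num.sqrt (\sum_(i < n) modulus (z 0 i) ^+ 2).

Definition open_ball0 (r : R) : set Cn := [set z | enorm z < r].

(* 0 is added so that the diameter of the empty set is 0 and not -oo. *)
Definition diameter (A : set Cn) : \bar R :=
  ereal_sup ([set 0%E] `|` [set (enorm (x - y))%:E | x in A & y in A]).

Definition area_delta (delta : R) (A : set Cn) : \bar R :=
  ereal_inf [set (\sum_(0 <= k <oo) (diameter (U k) * diameter (U k)))%E |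
    U in [set U : (set Cn)^nat | A `<=` \bigcup_k U k /\
            forall k, (diameter (U k) <= delta%:E)%E]].

(* Hausdorff 2-measure, without the factor pi / 4 that makes it agree with
   Lebesgue measure on real planes; the factor does not affect null sets. *)
Definition area (A : set Cn) : \bar R :=
  ereal_sup [set area_delta delta A | delta in [set delta : R | 0 < delta]].

Definition peval (p : mpoly.mpoly n C) (z : Cn) : C :=
  mpoly.meval (fun i => z 0 i) p.

(* For compact nonempty K the supremum is the maximum of |p| on K.  Since
   sup set0 = 0, the polynomial 1 shows that the hull of the empty set is
   empty. *)
Definition polynomial_hull (K : set Cn) : set Cn :=
  [set z | forall p : mpoly.mpoly n C,
     modulus (peval p z) <= sup [set modulus (peval p w) | w in K]].

Definition hull (Y : set Cn) : set Cn :=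
  \bigcup_(K in [set K : set Cn | compact K /\ K `<=` Y]) polynomial_hull K.

Definition uniformly_approximable_by_polynomials (f : Cn -> C) (S : set Cn) :=
  forall e : R, 0 < e -> exists p : mpoly.mpoly n C,
    forall z, S z -> modulus (f z - peval p z) < e.

(* Frechet differentiability of maps between normed spaces over C, that is,
   complex differentiability. *)
Definition entire (F : Cn -> C) := forall z : Cn, differentiable F z.

End SeveralComplexVariables.

(* Main.v *)
Require Import Defs.
From HB Require Import structures.
From mathcomp Require Import finmap.
From mathcomp Require Import all_boot all_order all_algebra.
From mathcomp Require Import all_classical all_reals all_analysis.
From mathcomp.real_closed Require Import complex.
From mathcomp Require Import cyclic separable cyclotomic.
From mathcomp Require mpoly.
Import (canonicals, coercions) mpoly.
From mathcomp Require Import ring lra.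

(** The hull of [Gamma] together with a ball leaves [Gamma] only in a bounded
    set.  So there are balls [B_1], [B_2], ... such that the hull of
    [B_(k-1)] and [Gamma] is contained in the union of [B_k] and [Gamma] (for
    [k = 1], the hull of [Gamma] alone).  Let [p_1] be a polynomial close to [f]
    on the part of [Gamma] in [B_1].  Given [p_k] close to [f] on the part of
    [Gamma] in [B_k], lower the modulus of [f - p_k] by the tolerance: the result
    vanishes on that part.  Extended by 0, it is continuous on the polynomial hull
    [X] of [B_(k-1)] and of the part of [Gamma] in [B_(k+1)], because [X] leaves
    [Gamma] only inside [B_k].  If it can be approximated by polynomials on [X],
    then adding such an approximation to [p_k] gives a polynomial [p_(k+1)] that
    is close to [f] on the part of [Gamma] in [B_(k+1)] and close to [p_k] on
    [B_(k-1)] ([extend_approximation]).  The limit of the [p_k] is the function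
    [F]; it is entire because Cauchy's estimates bound the Taylor remainders
    uniformly ([entire_limit]).

    The heart of the matter is therefore [approximable_vanishing]: if [X] is
    compact and polynomially convex, and the part of [X] outside a ball has zero
    area, then every continuous function on [X] that vanishes on the ball is a
    uniform limit of polynomials.  A partition of unity reduces this to bumps
    around a point [a] outside the ball.  A linear form [l] close to [<z, a>]
    separates [a] from the ball, so there is a bump [phi] in the plane around
    [l a] whose support meets [l @` X] in a set of zero area.  By the
    Hartogs-Rosenthal theorem ([hartogs_rosenthal]), [phi] is on [l @` X] a
    uniform limit of rational functions with poles outside [l @` X].  It is proved
    through a discrete Cauchy-Green formula, with lattice sums in place of
    integrals.

    It remains to see that [1 / (l - w)] is a uniform limit of polynomials on
    [X] when [l] omits the value [w] on [X].  This is Gelfand theory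
    ([approx_inverse_on_hull]): a polynomial that is not invertible in the closure
    of the polynomials is annihilated by a character, and a character is the
    evaluation at a point of the hull of [X], which is [X].  Characters are built
    one coordinate at a time, by passing to smaller and smaller seminorms; each
    passage uses that the spectrum of an element is not empty
    ([spectrum_nonempty]). *)

Set Implicit Arguments.
Unset Strict Implicit.
Unset Printing Implicit Defensive.

Import Order.TTheory GRing.Theory Num.Theory.
Import numFieldNormedType.Exports.

Local Open Scope classical_set_scope.
Local Open Scope ring_scope.

(** * The complex plane and complex space *)

Section Modulus.
Variable R : realType.
Local Notation C := (Cplx R).
Implicit Types (w x y : C) (a b : R).

Definition cplx a b : C := Complex a b.
Definition rcplx a : C := cplx a 0.

Lemma normE w : `|w| = rcplx (modulus w).
Proof. by rewrite /modulus (normc_def w). Qed.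

Lemma modulusE w :
  modulus w = Num.sqrt (complex.Re w ^+ 2 + complex.Im w ^+ 2).
Proof. by rewrite /modulus (normc_def w). Qed.

Lemma rcplx_le a b : (rcplx a <= rcplx b) = (a <= b).
Proof. exact: lecR. Qed.

Lemma rcplx_lt a b : (rcplx a < rcplx b) = (a < b).
Proof. exact: ltcR. Qed.

Lemma rcplxD a b : rcplx (a + b) = rcplx a + rcplx b.
Proof. exact: (raddfD (real_complex R)). Qed.

Lemma rcplxB a b : rcplx (a - b) = rcplx a - rcplx b.
Proof. exact: (raddfB (real_complex R)). Qed.

Lemma rcplxM a b : rcplx (a * b) = rcplx a * rcplx b.
Proof. exact: (rmorphM (real_complex R)). Qed.

Lemma rcplx0 : rcplx 0 = 0. Proof. by []. Qed.
Lemma rcplx1 : rcplx 1 = 1. Proof. by []. Qed.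

Lemma rcplxV a : rcplx a^-1 = (rcplx a)^-1.
Proof. exact: (fmorphV (real_complex R)). Qed.

Lemma modulus_ge0 w : 0 <= modulus w.
Proof. by rewrite modulusE sqrtr_ge0. Qed.

Lemma modulusD x y : modulus (x + y) <= modulus x + modulus y.
Proof. by rewrite -rcplx_le rcplxD -!normE ler_normD. Qed.

Lemma modulusN x : modulus (- x) = modulus x.
Proof. by rewrite /modulus normrN. Qed.

Lemma modulusB x y : modulus (x - y) <= modulus x + modulus y.
Proof. by rewrite -[modulus y]modulusN modulusD. Qed.

Lemma modulusC x y : modulus (x - y) = modulus (y - x).
Proof. by rewrite /modulus distrC. Qed.

Lemma modulusM x y : modulus (x * y) = modulus x * modulus y.
Proof.
by apply: (@complexI R); rewrite rmorphM /=; have := normrM x y; rewrite !normE.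
Qed.

Lemma modulus0 : modulus (0 : C) = 0.
Proof. by rewrite /modulus normr0. Qed.

Lemma modulus1 : modulus (1 : C) = 1.
Proof. by rewrite /modulus normr1. Qed.

Lemma modulusX x k : modulus (x ^+ k) = modulus x ^+ k.
Proof.
by elim: k => [|k IH]; rewrite ?expr0 ?modulus1 // !exprS modulusM IH.
Qed.

Lemma modulus_eq0 w : (modulus w == 0) = (w == 0).
Proof.
by rewrite -[w == 0]normr_eq0 normE -(inj_eq (@complexI R)).
Qed.

Lemma modulus_gt0 w : (0 < modulus w) = (w != 0).
Proof. by rewrite lt_def modulus_eq0 modulus_ge0 andbT. Qed.

Lemma modulusV w : modulus w^-1 = (modulus w)^-1.
Proof.
have [->|w0] := eqVneq w 0; first by rewrite invr0 modulus0 invr0.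
apply: (@mulfI _ (modulus w)); first by rewrite modulus_eq0.
by rewrite -modulusM !divff ?modulus1 // modulus_eq0.
Qed.

Lemma modulus_rcplx a : modulus (rcplx a) = `|a|.
Proof. by rewrite modulusE /= expr0n addr0 sqrtr_sqr. Qed.

Lemma modulus_dist x y : `|modulus x - modulus y| <= modulus (x - y).
Proof.
rewrite ler_norml; apply/andP; split.
  rewrite lerNl opprB lerBlDr modulusC (le_trans _ (modulusD _ _)) //.
  by rewrite subrK.
by rewrite lerBlDr (le_trans _ (modulusD _ _)) // subrK.
Qed.

Lemma modulus_sum I (s : seq I) (P : pred I) (F : I -> C) :
  modulus (\sum_(i <- s | P i) F i) <= \sum_(i <- s | P i) modulus (F i).
Proof.
elim/big_rec2 : _ => [|i x y _ xy]; first by rewrite modulus0.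
by apply: le_trans (modulusD _ _) _; exact: lerD.
Qed.

Lemma Re_le_modulus w : `|complex.Re w| <= modulus w.
Proof. by rewrite modulusE -sqrtr_sqr ler_wsqrtr// lerDl sqr_ge0. Qed.

Lemma Im_le_modulus w : `|complex.Im w| <= modulus w.
Proof. by rewrite modulusE -sqrtr_sqr ler_wsqrtr// lerDr sqr_ge0. Qed.

Lemma modulus_le_ReIm w : modulus w <= `|complex.Re w| + `|complex.Im w|.
Proof.
rewrite modulusE -(@ler_pXn2r _ 2) ?nnegrE ?sqrtr_ge0 ?addr_ge0//.
rewrite sqr_sqrtr ?addr_ge0 ?sqr_ge0//.
rewrite -(real_normK (num_real (complex.Re w))).
rewrite -(real_normK (num_real (complex.Im w))).
by have := normr_ge0 (complex.Re w); have := normr_ge0 (complex.Im w); nra.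
Qed.

Lemma Re_sum I (s : seq I) (P : pred I) (F : I -> C) :
  complex.Re (\sum_(i <- s | P i) F i) = \sum_(i <- s | P i) complex.Re (F i).
Proof. by elim/big_rec2 : _ => // i x [a b] _ <-; case: (F i). Qed.

Lemma norm_lt w a : (`|w| < rcplx a) = (modulus w < a).
Proof. by rewrite normE rcplx_lt. Qed.

Lemma norm_le w a : (`|w| <= rcplx a) = (modulus w <= a).
Proof. by rewrite normE rcplx_le. Qed.

Lemma pos_rcplx w : 0 < w -> w = rcplx (complex.Re w) /\ 0 < complex.Re w.
Proof. by case: w => a b; rewrite ltcE /= => /andP[/eqP -> ->]. Qed.

End Modulus.

Section Topology.
Variable R : realType.
Local Notation C := (Cplx R).

Lemma nbhs_modulus (w : C) (e : R) : 0 < e ->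
  \forall x \near w, modulus (x - w) < e.
Proof.
move=> e0; have e0' : 0 < rcplx e :> C by rewrite -rcplx0 rcplx_lt.
near=> x; rewrite modulusC -norm_lt.
near: x; exact: nbhsx_ballx.
Unshelve. all: by end_near. Qed.

Lemma nbhs_modulusP (w : C) (A : set C) : nbhs w A <->
  exists2 e : R, 0 < e & forall x, modulus (x - w) < e -> A x.
Proof.
split=> [/nbhs_ballP[e /= /pos_rcplx[-> e0] eA]|[e e0 eA]].
  by exists (complex.Re e) => // x xw; apply: eA; rewrite /ball/= norm_lt modulusC.
apply: filterS eA _; exact: nbhs_modulus.
Qed.

Lemma cvg_modulusP (T : Type) (F : set_system T) (FF : Filter F) (f : T -> C) (w : C) :
  f @ F --> w <-> forall e : R, 0 < e -> \forall x \near F, modulus (f x - w) < e.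
Proof.
split=> [fw e e0|fw];
  first exact: (fw [set y | modulus (y - w) < e] (nbhs_modulus w e0)).
move=> A /nbhs_modulusP[e e0 eA]; apply: filterS (fw e e0) => x; exact: eA.
Qed.

Lemma cvg_modulus (T : Type) (F : set_system T) (FF : Filter F) (f : T -> C) (w : C) :
  f @ F --> w -> modulus (f x) @[x --> F] --> modulus w.
Proof.
move=> /cvg_modulusP fw; apply/cvgrPdist_lt => e e0.
near=> x; rewrite distrC; apply: le_lt_trans (modulus_dist _ _) _.
by near: x; exact: fw.
Unshelve. all: by end_near. Qed.

Lemma cvg_rcplx (T : Type) (F : set_system T) (FF : Filter F) (f : T -> R) (a : R) :
  f @ F --> a -> (rcplx (f x) : C) @[x --> F] --> (rcplx a : C).
Proof.
move=> /cvgrPdist_lt fa; apply/cvg_modulusP => e e0; near=> x.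
rewrite -rcplxB modulus_rcplx distrC; near: x; exact: fa.
Unshelve. all: by end_near. Qed.

Lemma cvg_Re (T : Type) (F : set_system T) (FF : Filter F) (f : T -> C) (w : C) :
  f @ F --> w -> complex.Re (f x) @[x --> F] --> complex.Re w.
Proof.
move=> /cvg_modulusP fw; apply/cvgrPdist_lt => e e0; near=> x.
rewrite distrC; apply: (@le_lt_trans _ _ (modulus (f x - w))); last first.
  by near: x; exact: fw.
by apply: le_trans (Re_le_modulus _); case: (f x) (w) => [? ?] [? ?].
Unshelve. all: by end_near. Qed.

Lemma cplx_continuous :
  continuous (fun ab : R * R => cplx ab.1 ab.2 : C).
Proof.
move=> [a b]; apply/cvg_modulusP => e e0; near=> x.
have -> : cplx x.1 x.2 - cplx (a, b).1 (a, b).2 = cplx (x.1 - a) (x.2 - b) by [].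
apply: le_lt_trans (modulus_le_ReIm _) _ => /=.
have h1 : `|x.1 - a| < e / 2.
  near: x; have /cvgrPdist_lt/(_ (e/2) ltac:(lra)) : fst x @[x --> (a, b)] --> a.
    exact: cvg_fst.
  apply: filterS => x; by rewrite distrC.
have h2 : `|x.2 - b| < e / 2.
  near: x; have /cvgrPdist_lt/(_ (e/2) ltac:(lra)) : snd x @[x --> (a, b)] --> b.
    exact: cvg_snd.
  apply: filterS => x; by rewrite distrC.
by lra.
Unshelve. all: by end_near. Qed.

Lemma cvg_bigsum (T I : Type) (F : set_system T) (FF : Filter F) (s : seq I)
    (f : I -> T -> R) (l : I -> R) : (forall i, f i @ F --> l i) ->
  \sum_(i <- s) f i x @[x --> F] --> \sum_(i <- s) l i.
Proof.
move=> fl; elim: s => [|i s IH].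
  by rewrite big_nil; under eq_fun do rewrite big_nil; exact: cvg_cst.
by rewrite big_cons; under eq_fun do rewrite big_cons; exact: cvgD (fl i) IH.
Qed.

Lemma compact_square (a : R) :
  compact [set w : C | `|complex.Re w| <= a /\ `|complex.Im w| <= a].
Proof.
have -> : [set w : C | `|complex.Re w| <= a /\ `|complex.Im w| <= a] =
    (fun ab : R * R => cplx ab.1 ab.2 : C) @` (`[- a, a] `*` `[- a, a]).
  apply/seteqP; split => [[x y] /= [xa ya]|_ [[x y] /= [xa ya] <-]].
    by exists (x, y) => //=; split; rewrite /= in_itv /= -ler_norml.
  by move: xa ya; rewrite /= !in_itv /= -!ler_norml.
apply: continuous_compact.
  exact/continuous_subspaceT/cplx_continuous.
by apply: compact_setX; exact: segment_compact.
Qed.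

Lemma modulus_continuous : continuous (@modulus R).
Proof. by move=> w; apply: (@cvg_modulus _ (nbhs w) _ id); exact: cvg_id. Qed.

Lemma compact_disc (a : R) : compact [set w : C | modulus w <= a].
Proof.
refine (subclosed_compact _ (@compact_square a) _).
  have /continuous_closedP := @modulus_continuous.
  by move=> /(_ [set x | x <= a]); apply; exact: closed_le.
move=> w /= wa.
by split; [apply: le_trans (Re_le_modulus _) wa|
           apply: le_trans (Im_le_modulus _) wa].
Qed.

End Topology.

Section Space.
Variables (R : realType) (n : nat).
Local Notation C := (Cplx R).
Local Notation Cn := (Cspace R n).
Implicit Types z : Cn.

Lemma coord_continuous (i : 'I_n) : continuous (fun z : Cn => z 0 i : C).
Proof. exact: coord_continuous. Qed.

Lemma peval_cst (c : C) z : peval (mpoly.mpolyC n c) z = c.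
Proof. exact: mpoly.mevalC. Qed.
Lemma pevalD (p q : mpoly.mpoly n C) z : peval (p + q) z = peval p z + peval q z.
Proof. exact: mpoly.mevalD. Qed.
Lemma pevalB (p q : mpoly.mpoly n C) z : peval (p - q) z = peval p z - peval q z.
Proof. exact: mpoly.mevalB. Qed.
Lemma pevalM (p q : mpoly.mpoly n C) z : peval (p * q) z = peval p z * peval q z.
Proof. exact: mpoly.mevalM. Qed.
Lemma peval1 z : peval 1 z = 1.
Proof. exact: mpoly.meval1. Qed.
Lemma peval0 z : peval 0 z = 0.
Proof. exact: mpoly.meval0. Qed.
Lemma pevalZ (c : C) (p : mpoly.mpoly n C) z : peval (c *: p) z = c * peval p z.
Proof. exact: mpoly.mevalZ. Qed.
Lemma pevalXU (i : 'I_n) z : peval (mpoly.mpolyX C (mpoly.mnm1 i)) z = z 0 i.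
Proof. exact: mpoly.mevalXU. Qed.
Lemma pevalX (p : mpoly.mpoly n C) k z : peval (p ^+ k) z = peval p z ^+ k.
Proof.
by elim: k => [|k IH]; rewrite ?expr0 ?peval1 // !exprS pevalM IH.
Qed.
Lemma peval_sum I (s : seq I) (P : pred I) (F : I -> mpoly.mpoly n C) z :
  peval (\sum_(i <- s | P i) F i) z = \sum_(i <- s | P i) peval (F i) z.
Proof. exact: raddf_sum. Qed.

(** Evaluation is a ring morphism, so facts about values of polynomials are
    easier to propagate through ring operations than through monomials. *)
Lemma mpoly_ind (P : mpoly.mpoly n C -> Prop) :
  (forall c, P (mpoly.mpolyC n c)) ->
  (forall i, P (mpoly.mpolyX C (mpoly.mnm1 i))) ->
  (forall p q, P p -> P q -> P (p + q)) ->
  (forall p q, P p -> P q -> P (p * q)) -> forall p, P p.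
Proof.
move=> PC PX PD PM p.
rewrite (mpoly.mpolyE p); apply: (big_ind P) => [|//|m _]; first exact: (PC 0).
rewrite -mpoly.mul_mpolyC; apply: (PM) => //.
rewrite mpoly.mpolyXE_id; apply: (big_ind P) => [||i _]; [exact: (PC 1)|exact: PM|].
elim: (mpoly.fun_of_multinom m i) => [|k IH]; first exact: (PC 1).
by rewrite exprS; exact: PM.
Qed.

Lemma peval_continuous (p : mpoly.mpoly n C) : continuous (peval p : Cn -> C).
Proof.
elim/mpoly_ind: p => [c|i|p q cp cq|p q cp cq] z.
- rewrite (_ : peval _ = fun=> c); first exact: cst_continuous.
  by apply/funext => ?; rewrite peval_cst.
- rewrite (_ : peval _ = fun z => z 0 i); first exact: coord_continuous.
  by apply/funext => ?; rewrite pevalXU.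
- rewrite (_ : peval _ = peval p \+ peval q); first exact: continuousD (cp z) (cq z).
  by apply/funext => ?; rewrite pevalD.
- rewrite (_ : peval _ = peval p \* peval q); first exact: continuousM (cp z) (cq z).
  by apply/funext => ?; rewrite pevalM.
Qed.

Lemma enorm_ge0 z : 0 <= enorm z. Proof. exact: sqrtr_ge0. Qed.

Lemma sqr_enorm z : enorm z ^+ 2 = \sum_(i < n) modulus (z 0 i) ^+ 2.
Proof. by rewrite sqr_sqrtr // sumr_ge0 // => i _; rewrite sqr_ge0. Qed.

Lemma coord_le_enorm z i : modulus (z 0 i) <= enorm z.
Proof.
rewrite -(@ler_pXn2r _ 2) ?nnegrE ?modulus_ge0 ?enorm_ge0 // sqr_enorm.
by rewrite (bigD1 i) //= lerDl sumr_ge0 // => j _; rewrite sqr_ge0.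
Qed.

Lemma enorm_le_sum z : enorm z <= \sum_(i < n) modulus (z 0 i).
Proof.
rewrite -(@ler_pXn2r _ 2) ?nnegrE ?enorm_ge0 ?sumr_ge0 //; last first.
  by move=> i _; exact: modulus_ge0.
rewrite sqr_enorm expr2 mulr_suml ler_sum // => i _.
rewrite expr2 ler_wpM2l ?modulus_ge0 // (bigD1 i) //= lerDl sumr_ge0 // => j _.
exact: modulus_ge0.
Qed.

Lemma enorm_continuous : continuous (@enorm R n).
Proof.
move=> z; apply: (@continuous_comp _ _ _ (fun z : Cn =>
  \sum_(i < n) modulus (z 0 i) ^+ 2)
   (@Num.sqrt R)); last exact: sqrt_continuous.
apply: (@cvg_bigsum R _ _ (nbhs z) (nbhs_filter z)) => i; rewrite expr2.
have h : modulus (x 0 i) @[x --> z] --> modulus (z 0 i).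
  by apply: cvg_modulus; exact: coord_continuous.
under eq_fun do rewrite expr2.
exact: cvgM.
Qed.

Lemma open_eball (c : Cn) (rho : R) : open [set x : Cn | enorm (x - c) < rho].
Proof.
have cont : continuous (fun x : Cn => enorm (x - c)).
  move=> x; apply: (@continuous_comp Cn Cn R (fun x => x - c) (@enorm R n)).
    exact: (@continuousB _ _ Cn id (cst c) x (@cvg_id _ _) (@cst_continuous _ _ _ _)).
  exact: enorm_continuous.
have /continuousP := cont.
by move=> /(_ [set t | t < rho]); apply; exact: open_lt.
Qed.

Lemma nbhs_coord (a : Cn) (A : set Cn) : nbhs a A ->
  exists2 e : R, 0 < e & forall x, (forall i, modulus ((x - a) 0 i) < e) -> A x.
Proof.
move=> /nbhs_ballP[e /= /pos_rcplx[-> e0] eA].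
exists (complex.Re e) => // x xa; apply: eA; split.
  by rewrite -rcplx0 rcplx_lt.
move=> i j; rewrite ord1 /ball/= norm_lt modulusC.
by have := xa j; rewrite !mxE.
Qed.

Lemma nbhs_eball (a : Cn) (A : set Cn) : nbhs a A ->
  exists2 e : R, 0 < e & forall x, enorm (x - a) < e -> A x.
Proof.
move=> /nbhs_coord[e e0 eA]; exists e => // x xa; apply: eA => i.
exact: le_lt_trans (coord_le_enorm _ _) xa.
Qed.

Lemma enorm0 : enorm (0 : Cn) = 0.
Proof.
by rewrite /enorm big1 ?sqrtr0 // => i _; rewrite mxE modulus0 expr0n.
Qed.

Definition cball (s : R) : set Cn := [set z | enorm z <= s].

Lemma closed_cball s : closed (cball s).
Proof.
have /continuous_closedP := enorm_continuous.
by move=> /(_ [set x | x <= s]); apply; exact: closed_le.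
Qed.

Lemma compact_cball s : compact (cball s).
Proof.
have cD := @rV_compact _ _ _ (fun i : 'I_n => @compact_disc R s).
refine (subclosed_compact (@closed_cball s) cD _) => z zs i;
  apply: le_trans (coord_le_enorm _ _) zs.
Qed.

Lemma coord_le_norm z i : `|z 0 i| <= `|z|.
Proof.
have : `|z| <= `|z| by [].
rewrite [leLHS]mx_normE [leRHS]mx_normE num_le => /bigmax_leP[_ /(_ (0, i) isT)].
by rewrite -num_le /= -mx_normE.
Qed.

Lemma bounded_enorm (A : set Cn) : bounded_set A -> exists s, A `<=` cball s.
Proof.
move=> [M [Mreal MA]].
pose m := modulus M + 1.
have mM : M < rcplx m.
  rewrite rcplxD rcplx1 -normE; apply: le_lt_trans (real_ler_norm Mreal) _.
  by rewrite ltrDl ltr01.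
exists (\sum_(i < n) m) => z /(MA _ mM) zm.
apply: le_trans (enorm_le_sum _) _; apply: ler_sum => i _.
rewrite -norm_le; apply: le_trans zm.
exact: coord_le_norm.
Qed.

End Space.

(** * Gelfand's theorem on the spectrum *)

Section Gelfand.
Variables (R : realType) (A : comAlgType (Cplx R)).
Local Notation C := (Cplx R).

(** A seminorm of this kind on [A] stands for the norm of the quotient of [A]
    by a proper closed ideal: no quotient algebra and no completion is formed. *)
Record alg_seminorm (nu : A -> R) := AlgSeminorm {
  seminormD : forall x y, nu (x + y) <= nu x + nu y;
  seminormM : forall x y, nu (x * y) <= nu x * nu y;
  seminormZ : forall (c : C) x, nu (c *: x) = modulus c * nu x;
  seminorm1 : nu 1 = 1 }.

Section Seminorm.
Variable nu : A -> R.
Hypothesis nuP : alg_seminorm nu.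

Lemma seminorm0 : nu 0 = 0.
Proof. by rewrite -(scale0r 0) (seminormZ nuP) modulus0 mul0r. Qed.

Lemma seminormN x : nu (- x) = nu x.
Proof. by rewrite -scaleN1r (seminormZ nuP) modulusN modulus1 mul1r. Qed.

Lemma seminormB x y : nu (x - y) <= nu x + nu y.
Proof. by rewrite -[nu y]seminormN (seminormD nuP). Qed.

Lemma seminorm_ge0 x : 0 <= nu x.
Proof.
by have := seminormB x x; rewrite subrr seminorm0 -mulr2n pmulrn_lge0.
Qed.

Lemma seminorm_alg (c : C) : nu (c%:A) = modulus c.
Proof. by rewrite (seminormZ nuP) (seminorm1 nuP) mulr1. Qed.

Lemma seminormX x k : nu (x ^+ k) <= nu x ^+ k.
Proof.
elim: k => [|k IH]; first by rewrite !expr0 (seminorm1 nuP).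
rewrite !exprS; apply: le_trans (seminormM nuP _ _) _.
by rewrite ler_wpM2l ?seminorm_ge0.
Qed.

Lemma seminorm_subl x y : nu x - nu y <= nu (x + y).
Proof. by rewrite lerBlDr; apply: le_trans (seminormB _ _); rewrite addrK. Qed.

End Seminorm.

Section EmptySpectrum.
Variables (nu : A -> R) (g : A).
Hypothesis nuP : alg_seminorm nu.
Hypothesis invertible :
  forall l : C, exists q, nu (1 - q * (g - l%:A)) < 1.

Local Notation s l := (g - (l : C)%:A).

(** If [1 - q s] has seminorm below 1, then its powers are of the form
    [1 - q' s] and tend to 0. *)
Lemma approx_inverse (l : C) (e : R) : 0 < e -> exists q, nu (1 - q * s l) <= e.
Proof.
move=> e0; have [q0 q0lt] := invertible l.
have pw k : exists q, 1 - q * s l = (1 - q0 * s l) ^+ k.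
  elim: k => [|k [q qE]]; first by exists 0; rewrite mul0r subr0.
  by exists (q + q0 - q * q0 * s l); rewrite exprSr -qE; ring.
have th1 : `|nu (1 - q0 * s l)| < 1 by rewrite ger0_norm// (seminorm_ge0 nuP).
have /cvgrPdist_lt/(_ _ e0)[k _ /(_ k (leqnn k))] := cvg_expr th1.
rewrite sub0r normrN => kle; have [q qE] := pw k.
exists q; rewrite qE; apply: le_trans (seminormX nuP _ _) _.
by apply: le_trans (ltW kle); exact: ler_norm.
Qed.

Definition lower_bounds (l : C) :=
  [set c : R | 0 <= c /\ forall p, c * nu p <= nu (s l * p)].
(** [conorm l] is the reciprocal of the norm of the resolvent at [l]; it makes
    sense although the resolvent may exist only in the completion of [A]. *)
Definition conorm (l : C) := sup (lower_bounds l).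

Lemma has_sup_lower (l : C) : has_sup (lower_bounds l).
Proof.
split; first by exists 0; split=> // p; rewrite mul0r (seminorm_ge0 nuP).
exists (nu (s l)) => c [_ /(_ 1)].
by rewrite (seminorm1 nuP) !mulr1.
Qed.

Lemma le_conorm (l : C) c : (forall p, c * nu p <= nu (s l * p)) ->
  c <= conorm l.
Proof.
move=> cP; have [c0|c0] := leP 0 c.
  by apply: ub_le_sup; [exact: (has_sup_lower l).2|split].
apply: le_trans (ltW c0) _; apply: ub_le_sup; first exact: (has_sup_lower l).2.
by split=> // p; rewrite mul0r (seminorm_ge0 nuP).
Qed.

Lemma conormP (l : C) p : conorm l * nu p <= nu (s l * p).
Proof.
have [p0|p0] := leP (nu p) 0.
  have -> : nu p = 0 by apply/eqP; rewrite eq_le p0 (seminorm_ge0 nuP).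
  by rewrite mulr0 (seminorm_ge0 nuP).
rewrite -ler_pdivlMr //; apply: ge_sup; first exact: (has_sup_lower l).1.
by move=> c [_ /(_ p)]; rewrite ler_pdivlMr.
Qed.

Lemma conorm_gt0 (l : C) : 0 < conorm l.
Proof.
have [q qlt] := invertible l; set th := nu _ in qlt.
have key p : (1 - th) * nu p <= nu q * nu (s l * p).
  have : nu p <= nu (q * (s l * p)) + nu ((1 - q * s l) * p).
    by apply: le_trans (seminormD nuP _ _); rewrite le_eqVlt; apply/orP; left;
      apply/eqP; congr nu; ring.
  have := seminormM nuP q (s l * p).
  have := seminormM nuP (1 - q * s l) p.
  by rewrite -/th mulrBl mul1r; lra.
have q0 : 0 < nu q.
  rewrite lt_def (seminorm_ge0 nuP) andbT; apply/eqP => q0.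
  by have := key 1; rewrite q0 mul0r (seminorm1 nuP); lra.
apply: (@lt_le_trans _ _ ((1 - th) / nu q)); first by rewrite divr_gt0 ?subr_gt0.
apply: le_conorm => p; rewrite mulrAC ler_pdivrMr // mulrC [leRHS]mulrC.
by rewrite [leLHS]mulrC.
Qed.

Lemma conorm_lip (l l' : C) : conorm l - modulus (l - l') <= conorm l'.
Proof.
apply: le_conorm => p.
have := seminorm_subl nuP (s l * p) ((l - l') *: p).
have -> : s l * p + (l - l') *: p = s l' * p.
  by rewrite -[(l - l') *: p]mulr_algl scalerBl; ring.
by rewrite (seminormZ nuP); have := conormP l p; lra.
Qed.

Lemma conorm_large (l : C) : modulus l - nu g <= conorm l.
Proof.
apply: le_conorm => p.
have := seminorm_subl nuP (- (l *: p)) (g * p).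
have -> : - (l *: p) + g * p = s l * p by rewrite -[l *: p]mulr_algl; ring.
rewrite (seminormN nuP) (seminormZ nuP); have := seminormM nuP g p; lra.
Qed.

Lemma conorm_continuous : continuous conorm.
Proof.
move=> l; apply/(@cvgrPdist_lt _ _ _ (nbhs l)) => e e0; near=> x.
have xl : modulus (x - l) < e by near: x; exact: nbhs_modulus.
rewrite ltr_norml; have := conorm_lip l x; have := conorm_lip x l.
by rewrite (modulusC l x); lra.
Unshelve. all: by end_near. Qed.

Definition resolvent_norm l := (conorm l)^-1.
Local Notation N := resolvent_norm.

Lemma resolvent_norm_gt0 l : 0 < N l.
Proof. by rewrite invr_gt0 conorm_gt0. Qed.

(** Averaging the resolvent over the four points [l + t i^k] almost reproduces
    it: with [s = g - l], the four inverses sum to [4 s^3 / (s^4 - t^4)].  Hence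
    the norm is below its four-point mean up to an error of order [t^4]. *)
Lemma resolvent_norm_mean (l : C) (t : R) : 0 <= t ->
  4 * N l <= (N (l + rcplx t) + N (l - rcplx t) +
     N (l + cplx 0 t) + N (l - cplx 0 t)) * (1 + 8 * t ^+ 4 * N l ^+ 4).
Proof.
move=> t0; set S := N _ + _ + _ + _.
have S0 : 0 < S by rewrite !addr_gt0 ?resolvent_norm_gt0.
have m0 := conorm_gt0 l; have N0 := resolvent_norm_gt0 l.
have mN : conorm l * N l = 1 by rewrite mulfV // gt_eqF.
pose a : A := (rcplx t : C)%:A; pose b : A := (cplx 0 t : C)%:A.
have ba : b * b = - (a * a).
  rewrite /a /b -!scalerAl !mul1r !scalerA -scaleNr; congr (_ *: _).
  by apply/eqP; rewrite eq_complex /=; apply/andP; split; apply/eqP; ring.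
have sE1 : s (l + rcplx t) = s l - a by rewrite scalerDl /a; ring.
have sE2 : s (l - rcplx t) = s l + a by rewrite scalerBl /a; ring.
have sE3 : s (l + cplx 0 t) = s l - b by rewrite scalerDl /b; ring.
have sE4 : s (l - cplx 0 t) = s l + b by rewrite scalerBl /b; ring.
have na x : nu (a * x) = t * nu x.
  by rewrite mulr_algl (seminormZ nuP) modulus_rcplx ger0_norm.
have le_mul (l' : C) p : nu p <= N l' * nu (s l' * p).
  rewrite mulrC ler_pdivlMr ?conorm_gt0 // mulrC; exact: conormP.
have main p : 4 * nu p <= S * (nu (s l * p) + 8 * t ^+ 4 * N l ^+ 3 * nu p).
  have p0 := seminorm_ge0 nuP p; have sp0 := seminorm_ge0 nuP (s l * p).
  set c := 8 * _ * _ * _.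
  suff H (e : R) : 0 < e -> e <= 1 ->
      4 * nu p * (1 - 7 * e) <= S * ((1 + 7 * e) * nu (s l * p) + c).
    apply/ler_addgt0Pr => d d0.
    pose K := 28 * nu p + 7 * (S * nu (s l * p)).
    have K0 : 0 <= K by rewrite addr_ge0 ?mulr_ge0 ?(ltW S0).
    have e0 : 0 < Num.min 1 (d / (K + 1)).
      by rewrite lt_min ltr01 divr_gt0 // ltr_wpDl.
    have := H _ e0; rewrite ge_min lexx => /(_ isT).
    have : Num.min 1 (d / (K + 1)) * K <= d.
      apply: (@le_trans _ _ (d / (K + 1) * K)).
        by rewrite ler_wpM2r // ge_min lexx orbT.
      rewrite mulrAC ler_pdivrMr ?ltr_wpDl // ler_wpM2l ?(ltW d0) //.
      by rewrite lerDl.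
    by rewrite /K; lra.
  move=> e0 e1; have [q qe] := approx_inverse l e0.
  have qs : nu (q * s l) <= 2.
    have := seminormB nuP 1 (1 - q * s l).
    rewrite (_ : 1 - (1 - _) = q * s l); last by ring.
    by rewrite (seminorm1 nuP); lra.
  have qN : nu q <= 2 * N l.
    have := le_mul l q; rewrite (mulrC _ q) => /le_trans; apply.
    by rewrite [leRHS]mulrC ler_wpM2l // ltW.
  have q0 := seminorm_ge0 nuP q.
  pose w := q * s l; pose x := q ^+ 3 * p.
  have w3 : nu (1 - w ^+ 3) <= 7 * e.
    have -> : 1 - w ^+ 3 = (1 - w) * (1 + w + w * w) by ring.
    have h1 := seminormM nuP (1 - w) (1 + w + w * w).
    have h2 : nu (1 + w + w * w) <= 7.
      have := seminormD nuP (1 + w) (w * w); have := seminormD nuP 1 w.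
      have := seminormM nuP w w; rewrite (seminorm1 nuP).
      have : nu w * nu w <= 4.
        by have := seminorm_ge0 nuP w; move: qs; rewrite -/w; nra.
      by move: qs; rewrite -/w; lra.
    apply: le_trans h1 _; rewrite mulrC.
    have := seminorm_ge0 nuP (1 - w); have := seminorm_ge0 nuP (1 + w + w * w).
    by move: qe; rewrite -/w; nra.
  have s3x : (1 - 7 * e) * nu p <= nu (s l ^+ 3 * x).
    have := seminorm_subl nuP p (- ((1 - w ^+ 3) * p)).
    rewrite (seminormN nuP) (_ : p - _ = s l ^+ 3 * x); last by rewrite /x /w; ring.
    have := seminormM nuP (1 - w ^+ 3) p; nra.
  have s4x : nu ((s l ^+ 4 - a ^+ 4) * x) <= (1 + 7 * e) * nu (s l * p) + c.
    have := seminormB nuP (w ^+ 3 * (s l * p)) (a ^+ 4 * x).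
    rewrite (_ : _ - _ = (s l ^+ 4 - a ^+ 4) * x); last by rewrite /x /w; ring.
    have h1 : nu (w ^+ 3 * (s l * p)) <= (1 + 7 * e) * nu (s l * p).
      have := seminormD nuP (s l * p) (- ((1 - w ^+ 3) * (s l * p))).
      rewrite (seminormN nuP) (_ : _ - _ = w ^+ 3 * (s l * p)); last by ring.
      have := seminormM nuP (1 - w ^+ 3) (s l * p); nra.
    have h2 : nu (a ^+ 4 * x) <= c.
      have -> : a ^+ 4 * x = a * (a * (a * (a * x))) by ring.
      rewrite !na.
      have : nu x <= 8 * N l ^+ 3 * nu p.
        apply: le_trans (seminormM nuP _ _) _; rewrite ler_wpM2r //.
        apply: le_trans (seminormX nuP _ _) _.
        have -> : 8 * N l ^+ 3 = (2 * N l) ^+ 3 by ring.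
        by rewrite lerXn2r ?nnegrE // ltW // mulr_gt0.
      have t4 : 0 <= t ^+ 4 by rewrite exprn_ge0.
      move=> /(ler_wpM2l t4); rewrite /c.
      set y := nu x; set y' := nu p; set z := N l.
      by move=> h; apply: le_trans (le_trans h _); rewrite le_eqVlt; apply/orP; left;
        apply/eqP; ring.
    by lra.
  (* The numerators of the partial fractions of [4 s^3 / (s^4 - a^4)]. *)
  pose y1 := (s l + a) * (s l ^+ 2 + a ^+ 2) * x.
  pose y2 := (s l - a) * (s l ^+ 2 + a ^+ 2) * x.
  pose y3 := (s l + b) * (s l ^+ 2 - a ^+ 2) * x.
  pose y4 := (s l - b) * (s l ^+ 2 - a ^+ 2) * x.
  have sumE : 4%:R *: (s l ^+ 3 * x) = y1 + y2 + y3 + y4.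
    by rewrite scaler_nat /y1 /y2 /y3 /y4; ring.
  have e1' : s (l + rcplx t) * y1 = (s l ^+ 4 - a ^+ 4) * x.
    by rewrite sE1 /y1; ring.
  have e2' : s (l - rcplx t) * y2 = (s l ^+ 4 - a ^+ 4) * x.
    by rewrite sE2 /y2; ring.
  have e3' : s (l + cplx 0 t) * y3 = (s l ^+ 4 - a ^+ 4) * x.
    transitivity ((s l ^+ 2 - b * b) * (s l ^+ 2 - a ^+ 2) * x).
      by rewrite sE3 /y3; ring.
    by rewrite ba; ring.
  have e4' : s (l - cplx 0 t) * y4 = (s l ^+ 4 - a ^+ 4) * x.
    transitivity ((s l ^+ 2 - b * b) * (s l ^+ 2 - a ^+ 2) * x).
      by rewrite sE4 /y4; ring.
    by rewrite ba; ring.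
  have := le_mul (l + rcplx t) y1; have := le_mul (l - rcplx t) y2.
  have := le_mul (l + cplx 0 t) y3; have := le_mul (l - cplx 0 t) y4.
  rewrite e1' e2' e3' e4'; set Y := nu (_ * x) in s4x *.
  have : 4 * nu (s l ^+ 3 * x) <= nu y1 + nu y2 + nu y3 + nu y4.
    have := seminormD nuP (y1 + y2 + y3) y4; have := seminormD nuP (y1 + y2) y3.
    have := seminormD nuP y1 y2; rewrite -sumE (seminormZ nuP).
    have -> : modulus (4%:R : C) = 4.
      rewrite (_ : 4%:R = rcplx 4) ?modulus_rcplx ?ger0_norm //.
      by apply/eqP; rewrite eq_complex /=; apply/andP; split; apply/eqP; rewrite ?addr0.
    lra.
  have := ler_wpM2l (ltW S0) s4x.
  rewrite /S; lra.
have [D0|D0] := leP (4 - S * (8 * t ^+ 4 * N l ^+ 3)) 0.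
  have := ler_wpM2r (ltW N0) D0; rewrite mul0r.
  have : 0 <= S by exact: ltW.
  by move=> ? h; apply: le_trans (_ : S * (8 * t ^+ 4 * N l ^+ 4) <= _); lra.
have : (4 - S * (8 * t ^+ 4 * N l ^+ 3)) / S <= conorm l.
  apply: le_conorm => p; rewrite mulrAC ler_pdivrMr // mulrC.
  by have := main p; lra.
rewrite ler_pdivrMr // => /(ler_wpM2r (ltW N0)).
have -> : conorm l * S * N l = S by rewrite mulrAC mN mul1r.
by lra.
Qed.

(** The norm [N] of the resolvent tends to 0 at infinity.  After adding
    [e |l|^2] with a small [e], it still has an interior maximum [l0] on a large
    disc, where the four values of [N] at distance [t] sum to at most
    [4 N l0 - 4 e t^2].  For small [t] this contradicts the mean inequality,
    whose error is of order [t^4]. *)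
Lemma spectrum_nonempty : False.
Proof.
have N00 := resolvent_norm_gt0 0.
pose R0 := nu g + 2 / N 0.
have g0 := seminorm_ge0 nuP g.
have R0gt : 0 < R0 by rewrite ltr_wpDl // divr_gt0.
have Nfar l : R0 <= modulus l -> N l <= N 0 / 2.
  move=> R0l; have := conorm_large l; rewrite /N.
  have h : 2 / N 0 <= conorm l.
    by have := conorm_large l; move: R0l; rewrite /R0; lra.
  move=> _; rewrite -[N 0 / 2]invrK lef_pV2 ?posrE ?conorm_gt0 //.
    by rewrite invf_div.
  by rewrite invr_gt0 divr_gt0.
have X0 : 0 < (R0 + 1) ^+ 2 by rewrite exprn_gt0 // addr_gt0.
(* So small that the perturbed norm on the annulus between the radii [R0] and
   [R0 + 1] stays below its value at 0. *)
have [e e0 eR] : exists2 e : R, 0 < e & e * (R0 + 1) ^+ 2 = N 0 / 8.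
  exists (N 0 / 8 / (R0 + 1) ^+ 2); first by rewrite !divr_gt0.
  by rewrite mulfVK // gt_eqF.
pose u (l : C) : R := N l + e * (modulus l * modulus l).
have cu : continuous (u : C -> R).
  move=> l; have cm := @modulus_continuous R l.
  have m0 : conorm l != 0 by rewrite gt_eqF ?conorm_gt0.
  have cN : N x @[x --> l] --> N l.
    exact: (@cvgV R C (nbhs l) _ conorm (conorm l) m0 (@conorm_continuous l)).
  have ce := @cvgM R C (nbhs l) _ (cst e) (@modulus R \* @modulus R) e _
    (@cvg_cst R e C (nbhs l) _) (cvgM cm cm).
  exact: (@cvgD R R^o C (nbhs l) _ N _ _ _ cN (ce _ _ _)).
have [|l0 l0D lmax] := compact_EVT_max _ (@compact_disc R (R0 + 1))
  (continuous_subspaceT cu).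
  by exists 0; rewrite /= modulus0 addr_ge0 // ltW.
have l0R : modulus l0 < R0.
  rewrite ltNge; apply/negP => h; have := lmax 0.
  rewrite inE /= modulus0 => /(_ ltac:(lra)).
  rewrite /u modulus0 mulr0 mulr0 addr0 => h2.
  have := Nfar _ h; move: l0D; rewrite inE /= => l0D h3.
  have : e * (modulus l0 * modulus l0) <= e * (R0 + 1) ^+ 2.
    by rewrite ler_wpM2l ?(ltW e0) // expr2 ler_pM ?modulus_ge0.
  by lra.
have Nl0 := resolvent_norm_gt0 l0.
pose t := Num.min 1 (e / (16 * N l0 ^+ 5)).
have t0 : 0 < t by rewrite lt_min ltr01 divr_gt0 // mulr_gt0 // exprn_gt0.
have t1 : t <= 1 by rewrite ge_min lexx.
have tN : 16 * N l0 ^+ 5 * t <= e.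
  rewrite mulrC -ler_pdivlMr ?mulr_gt0 ?exprn_gt0 //.
  by rewrite ge_min lexx orbT.
have := resolvent_norm_mean l0 (ltW t0).
have umax w : modulus w = t -> u (l0 + w) <= u l0.
  move=> wE; apply: lmax; rewrite inE /=; apply: le_trans (modulusD _ _) _.
  by rewrite wE; lra.
have mi : modulus (cplx 0 t) = t.
  by rewrite modulusE /= expr0n add0r sqrtr_sqr ger0_norm // ltW.
have mr : modulus (rcplx t) = t by rewrite modulus_rcplx ger0_norm // ltW.
have := umax _ mr; have := umax (- rcplx t).
rewrite modulusN => /(_ mr) h1 h2.
have := umax _ mi; have := umax (- cplx 0 t).
rewrite modulusN => /(_ mi) + +.
have par : modulus (l0 + rcplx t) * modulus (l0 + rcplx t) +
   modulus (l0 - rcplx t) * modulus (l0 - rcplx t) +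
   modulus (l0 + cplx 0 t) * modulus (l0 + cplx 0 t) +
   modulus (l0 - cplx 0 t) * modulus (l0 - cplx 0 t) =
   4 * (modulus l0 * modulus l0) + 4 * (t * t).
  rewrite -!expr2 !modulusE !sqr_sqrtr ?addr_ge0 ?sqr_ge0 //.
  by case: (l0) => x y /=; ring.
move: h1 h2 par; rewrite /u.
set n1 := N (_ + rcplx t); set n2 := N (_ - rcplx t).
set n3 := N (_ + cplx 0 t); set n4 := N (_ - cplx 0 t).
move: (modulus (l0 + rcplx t) * _) (modulus (l0 - rcplx t) * _)
  (modulus (l0 + cplx 0 t) * _) (modulus (l0 - cplx 0 t) * _) => p1 p2 p3 p4.
move=> h1 h2 par h3 h4.
have par' : e * p1 + e * p2 + e * p3 + e * p4 =
    4 * (e * (modulus l0 * modulus l0)) + 4 * (e * (t * t)).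
  by rewrite -!mulrDr par; ring.
have sumle : n1 + n2 + n3 + n4 <= 4 * N l0 - 4 * (e * (t * t)) by lra.
move=> main.
have et : 0 < e * (t * t) by rewrite !mulr_gt0.
have K0 : 0 <= 8 * t ^+ 4 * N l0 ^+ 4.
  by rewrite !mulr_ge0 ?exprn_ge0 ?(ltW t0) ?(ltW Nl0).
have : (n1 + n2 + n3 + n4) * (8 * t ^+ 4 * N l0 ^+ 4) <=
    4 * N l0 * (8 * t ^+ 4 * N l0 ^+ 4) by rewrite ler_wpM2r //; lra.
have -> : 4 * N l0 * (8 * t ^+ 4 * N l0 ^+ 4) =
  2 * (t * t) * (t * (16 * N l0 ^+ 5 * t)).
  by ring.
have : 2 * (t * t) * (t * (16 * N l0 ^+ 5 * t)) <= 2 * (t * t) * e.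
  rewrite ler_wpM2l ?mulr_ge0 ?(ltW t0) //.
  apply: le_trans (_ : 1 * e <= _); last by rewrite mul1r.
  by rewrite ler_pM ?(ltW t0) // !mulr_ge0 ?exprn_ge0 ?(ltW t0) ?(ltW Nl0).
by lra.
Qed.

End EmptySpectrum.

End Gelfand.

(** * Inverting polynomials on polynomially convex sets *)

Section Quotient.
Variables (R : realType) (A : comAlgType (Cplx R)).
Local Notation C := (Cplx R).

Section OneGenerator.
Variables (nu : A -> R) (g : A).
Hypothesis nuP : alg_seminorm nu.
Hypothesis proper : forall q, 1 <= nu (1 - q * g).

Definition quotient_seminorm (p : A) : R := inf [set nu (p - q * g) | q in setT].
Local Notation nu' := quotient_seminorm.

Lemma quotient_le p q : nu' p <= nu (p - q * g).
Proof.
apply: ge_inf; last by exists q.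
by exists 0 => _ [x _ <-]; exact: seminorm_ge0 nuP _.
Qed.

Lemma le_quotient p c : (forall q, c <= nu (p - q * g)) -> c <= nu' p.
Proof.
move=> H; apply: lb_le_inf; first by exists (nu (p - 0 * g)), 0.
by move=> _ [q _ <-].
Qed.

Lemma quotient_le_seminorm p : nu' p <= nu p.
Proof. by have := quotient_le p 0; rewrite mul0r subr0. Qed.

Lemma quotient_gen : nu' g = 0.
Proof.
apply/eqP; rewrite eq_le; apply/andP; split.
  by have := quotient_le g 1; rewrite mul1r subrr (seminorm0 nuP).
by apply: le_quotient => q; exact: seminorm_ge0 nuP _.
Qed.

Lemma quotientP : alg_seminorm nu'.
Proof.
have nu'0 p : 0 <= nu' p by apply: le_quotient => q; exact: seminorm_ge0 nuP _.
split.
- move=> x y; rewrite -lerBlDr; apply: le_quotient => q.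
  rewrite lerBlDr -lerBlDl; apply: le_quotient => q'.
  rewrite lerBlDl; apply: le_trans (quotient_le _ (q + q')) _.
  rewrite (_ : x + y - _ = x - q * g + (y - q' * g)); last by ring.
  exact: seminormD.
- move=> x y.
  have H q : nu' (x * y) <= nu (x - q * g) * nu' y.
    have HH q' : nu' (x * y) <= nu (x - q * g) * nu (y - q' * g).
      apply: le_trans (quotient_le _ (q * y + q' * x - q * q' * g)) _.
      rewrite (_ : x * y - _ = (x - q * g) * (y - q' * g)); last by ring.
      exact: seminormM.
    have [x0|x0] := leP (nu (x - q * g)) 0.
      apply: le_trans (HH 0) _; rewrite (_ : nu (x - q * g) = 0) ?mul0r //.
      by apply/eqP; rewrite eq_le x0 (seminorm_ge0 nuP).
    rewrite [leRHS]mulrC -ler_pdivrMr //; apply: le_quotient => q'.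
    by rewrite ler_pdivrMr // [leRHS]mulrC.
  have [y0|y0] := leP (nu' y) 0.
    have -> : nu' y = 0 by apply/eqP; rewrite eq_le y0 nu'0.
    rewrite mulr0; apply: le_trans (H 0) _.
    by rewrite mulr_ge0_le0 // (seminorm_ge0 nuP).
  rewrite -ler_pdivrMr //; apply: le_quotient => q.
  by rewrite ler_pdivrMr.
- have le1 (c : C) x : nu' (c *: x) <= modulus c * nu' x.
    have [->|c0] := eqVneq c 0.
      rewrite scale0r modulus0 mul0r; apply: le_trans (quotient_le_seminorm _) _.
      by rewrite (seminorm0 nuP).
    have mc : 0 < modulus c by rewrite modulus_gt0.
    rewrite mulrC -ler_pdivrMr //; apply: le_quotient => q.
    rewrite ler_pdivrMr //; apply: le_trans (quotient_le _ (c *: q)) _.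
    by rewrite -scalerAl -scalerBr (seminormZ nuP) mulrC.
  move=> c x; have [->|c0] := eqVneq c 0.
    apply/eqP; rewrite eq_le le1 /= modulus0 mul0r; exact: nu'0.
  apply/eqP; rewrite eq_le le1 /=.
  have := le1 c^-1 (c *: x); rewrite scalerA mulVf // scale1r modulusV.
  by rewrite mulrC ler_pdivlMr ?modulus_gt0 // mulrC.
- apply/eqP; rewrite eq_le -{1}(seminorm1 nuP) quotient_le_seminorm /=.
  by apply: le_quotient => q.
Qed.

End OneGenerator.

(** Every element has a point [l] in its spectrum, and dividing by the ideal
    generated by [g - l] makes [g] a scalar.  Treating finitely many generators
    one after the other avoids the choice of a maximal ideal. *)
Lemma scalar_seminorm (nu : A -> R) (s : seq A) : alg_seminorm nu ->
  exists nu' : A -> R, [/\ alg_seminorm nu', forall p, nu' p <= nu p &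
    forall g, g \in s -> exists l : C, nu' (g - l%:A) = 0].
Proof.
move=> nuP; elim: s => [|g s [nu1 [nu1P nu1le nu1s]]]; first by exists nu.
have [l lP] : exists l : C, forall q, 1 <= nu1 (1 - q * (g - l%:A)).
  apply: contrapT => /forallNP H; apply: (spectrum_nonempty nu1P (g := g)) => l.
  by have /existsNP[q /negP] := H l; rewrite -ltNge; exists q.
have nu2P := quotientP nu1P lP.
exists (quotient_seminorm nu1 (g - l%:A)); split=> // [p|g' ].
  by apply: le_trans (nu1le p); exact: quotient_le_seminorm nu1P _.
rewrite inE => /predU1P[->|/nu1s[l' l'0]].
  by exists l; exact: quotient_gen nu1P.
exists l'; apply/eqP; rewrite eq_le (seminorm_ge0 nu2P) andbT -l'0.
exact: quotient_le_seminorm nu1P _.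
Qed.

End Quotient.

Section PolynomialConvexity.
Variables (R : realType) (n : nat) (X : set (Cspace R n)).
Local Notation C := (Cplx R).
Local Notation Cn := (Cspace R n).
Local Notation P := (mpoly.mpoly n C).
Hypothesis cX : compact X.

Definition sup_norm (p : P) := sup [set modulus (peval p w) | w in X].

Lemma peval_bounded (p : P) : has_ubound [set modulus (peval p w) | w in X].
Proof.
have cp : continuous (fun w : Cn => modulus (peval p w)).
  by move=> w; apply: (@cvg_modulus R Cn (nbhs w) _ (peval p)); exact: peval_continuous.
have [X0|X0] := pselect (X !=set0); last first.
  by exists 0 => _ [w Xw <-]; case: X0; exists w.
have [c _ cmax] := compact_EVT_max X0 cX (continuous_subspaceT cp).
by exists (modulus (peval p c)) => _ [w Xw <-]; apply: cmax; rewrite inE.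
Qed.

Lemma le_sup_norm p w : X w -> modulus (peval p w) <= sup_norm p.
Proof. by move=> Xw; apply: ub_le_sup; [exact: peval_bounded|exists w]. Qed.

Lemma sup_norm_le p c : X !=set0 -> (forall w, X w -> modulus (peval p w) <= c) ->
  sup_norm p <= c.
Proof.
move=> [w0 Xw0] H; apply: ge_sup; first by exists (modulus (peval p w0)), w0.
by move=> _ [w Xw <-]; exact: H.
Qed.

Lemma sup_norm_seminorm : X !=set0 -> alg_seminorm sup_norm.
Proof.
move=> X0.
have ge0 p : 0 <= sup_norm p.
  by have [w Xw] := X0; exact: le_trans (modulus_ge0 _) (le_sup_norm p Xw).
have leZ (c : C) (x : P) : sup_norm (c *: x) <= modulus c * sup_norm x.
  apply: sup_norm_le => // w Xw; rewrite pevalZ modulusM.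
  by rewrite ler_wpM2l ?modulus_ge0 ?le_sup_norm.
split.
- move=> x y; apply: sup_norm_le => // w Xw; rewrite pevalD.
  by apply: le_trans (modulusD _ _) _; rewrite lerD ?le_sup_norm.
- move=> x y; apply: sup_norm_le => // w Xw; rewrite pevalM modulusM.
  by rewrite ler_pM ?le_sup_norm ?modulus_ge0.
- move=> c x; apply/eqP; rewrite eq_le leZ /=.
  have [->|c0] := eqVneq c 0; first by rewrite modulus0 mul0r ge0.
  have := leZ c^-1 (c *: x); rewrite scalerA mulVf // scale1r modulusV.
  by rewrite mulrC ler_pdivlMr ?modulus_gt0 // mulrC.
- apply/eqP; rewrite eq_le; apply/andP; split.
    by apply: sup_norm_le => // w _; rewrite peval1 modulus1.
  by have [w Xw] := X0; have := le_sup_norm 1 Xw; rewrite peval1 modulus1.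
Qed.

Lemma mpolyC_alg (c : C) : mpoly.mpolyC n c = c%:A.
Proof. by rewrite -mpoly.mul_mpolyC mulr1. Qed.

(** Otherwise the multiples of [p] would form a proper ideal for the sup norm.
    Divide by it and make every coordinate a scalar.  The resulting seminorm is
    below the sup norm and is the modulus of the evaluation at a point [z]; so
    [z] lies in the hull of [X], and [p] vanishes at [z]. *)
Lemma approx_inverse_on_hull (p : P) : polynomial_hull X `<=` X ->
  (forall w, X w -> peval p w != 0) ->
  exists q : P, exists2 th : R, th < 1 &
    forall w, X w -> modulus (1 - peval q w * peval p w) <= th.
Proof.
move=> hX p0; have [X0|X0] := pselect (X !=set0); last first.
  by exists 0, 0 => // w Xw; case: X0; exists w.
apply: contrapT => noq.
have supP := sup_norm_seminorm X0.
have proper q : 1 <= sup_norm (1 - q * p).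
  rewrite leNgt; apply/negP => lt1; case: noq; exists q, (sup_norm (1 - q * p)) => //.
  move=> w Xw; have := le_sup_norm (1 - q * p) Xw.
  by rewrite pevalB peval1 pevalM.
have nu1P := quotientP supP proper.
have nu1p := quotient_gen p supP.
have nu1le := quotient_le_seminorm p supP.
have [nu [nuP nule nuX]] :=
  scalar_seminorm [seq mpoly.mpolyX C (mpoly.mnm1 i) | i <- enum 'I_n] nu1P.
have /choice[l lP] (i : 'I_n) : exists l : C,
  nu (mpoly.mpolyX C (mpoly.mnm1 i) - l%:A) = 0.
  by apply: nuX; apply/mapP; exists i => //; rewrite mem_enum.
pose z : Cn := \row_i l i.
have nuz (f : P) : nu (f - (peval f z)%:A) = 0.
  elim/mpoly_ind: f => [c|i|f1 f2 h1 h2|f1 f2 h1 h2].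
  - by rewrite peval_cst mpolyC_alg subrr (seminorm0 nuP).
  - by rewrite pevalXU mxE lP.
  - apply/eqP; rewrite eq_le (seminorm_ge0 nuP) andbT pevalD scalerDl.
    rewrite opprD addrACA.
    move: (f1 - _) (f2 - _) h1 h2 => a b h1 h2.
    by have := seminormD nuP a b; rewrite h1 h2 addr0.
  - apply/eqP; rewrite eq_le (seminorm_ge0 nuP) andbT pevalM.
    rewrite -[X in _ - X *: _]/(peval f1 z * peval f2 z) -scalerA.
    rewrite (_ : _ - _ = (f1 - (peval f1 z)%:A) * f2 +
        peval f1 z *: (f2 - (peval f2 z)%:A)); last first.
      by rewrite mulrBl mulr_algl scalerBr addrA subrK.
    apply: le_trans (seminormD nuP _ _) _; rewrite (seminormZ nuP) h2 mulr0 addr0.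
    by apply: le_trans (seminormM nuP _ _) _; rewrite h1 mul0r.
have nuev (f : P) : modulus (peval f z) <= nu f.
  have := seminormB nuP f (f - (peval f z)%:A); rewrite nuz addr0.
  by rewrite opprB addrC subrK (seminorm_alg nuP).
have Xz : X z.
  apply: hX => f; apply: le_trans (nuev f) _; apply: le_trans (nule f) _.
  exact: nu1le.
have := nuev p; rewrite leNgt => /negP; apply.
apply: (@le_lt_trans _ _ 0); first by rewrite -nu1p; exact: nule.
by rewrite modulus_gt0; exact: p0.
Qed.

End PolynomialConvexity.

Section Approximable.
Variables (R : realType) (n : nat) (X : set (Cspace R n)).
Local Notation C := (Cplx R).
Local Notation Cn := (Cspace R n).
Local Notation P := (mpoly.mpoly n C).
Local Notation approximable f := (uniformly_approximable_by_polynomials f X).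

Lemma approximable_ext (f g : Cn -> C) : (forall x, X x -> f x = g x) ->
  approximable f -> approximable g.
Proof.
move=> fg Uf e /Uf[p pP]; exists p => z Xz; rewrite -fg //; exact: pP.
Qed.

Lemma approximable_peval (p : P) : approximable (peval p).
Proof. by move=> e e0; exists p => z _; rewrite subrr modulus0. Qed.

Lemma approximable_cst (c : C) : approximable (fun=> c).
Proof. by apply: approximable_ext (approximable_peval (mpoly.mpolyC n c)) => x _;
  rewrite peval_cst. Qed.

Lemma approximable_closed (f : Cn -> C) : (forall e : R, 0 < e -> exists2 g : Cn -> C,
  approximable g & forall x, X x -> modulus (f x - g x) <= e) -> approximable f.
Proof.
move=> H e e0; have [g Ug fg] := H (e / 2) ltac:(lra).
have [p pP] := Ug (e / 2) ltac:(lra).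
exists p => z Xz; have := modulusD (f z - g z) (g z - peval p z);
  rewrite addrA subrK => h.
by apply: le_lt_trans h _; have := pP z Xz; have := fg z Xz; lra.
Qed.

Lemma approximable_add (f g : Cn -> C) : approximable f -> approximable g ->
  approximable (fun x => f x + g x).
Proof.
move=> Uf Ug e e0; have [p pP] := Uf (e / 2) ltac:(lra).
have [q qP] := Ug (e / 2) ltac:(lra).
exists (p + q) => z Xz; rewrite pevalD opprD addrACA.
apply: le_lt_trans (modulusD _ _) _.
by rewrite [ltRHS](splitr e) ltrD ?pP ?qP.
Qed.

Hypothesis cX : compact X.

Lemma approximable_bounded (f : Cn -> C) : approximable f ->
  exists2 M : R, 0 < M & forall x, X x -> modulus (f x) <= M.
Proof.
move=> /(_ 1 ltr01)[p pP]; have [M MP] := peval_bounded cX p.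
exists (`|M| + 1); first by rewrite ltr_wpDl.
move=> x Xx; have := pP x Xx; have := modulusD (f x - peval p x) (peval p x).
have : modulus (peval p x) <= M by apply: MP; exists x.
by rewrite subrK; have := ler_norm M; lra.
Qed.

Lemma approximable_mul (f g : Cn -> C) : approximable f -> approximable g ->
  approximable (fun x => f x * g x).
Proof.
move=> Uf Ug; have [M M0 MP] := approximable_bounded Uf;
  have [N N0 NP] := approximable_bounded Ug.
move=> e e0.
have [p pP] := Uf (Num.min 1 (e / (4 * N))) ltac:(by rewrite lt_min ltr01 divr_gt0 //
  mulr_gt0).
have [q qP] := Ug (e / (4 * (M + 1))) ltac:(by rewrite divr_gt0 // mulr_gt0 //
  addr_gt0).
exists (p * q) => z Xz; rewrite pevalM.
have -> : f z * g z - peval p z * peval q z =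
  (f z - peval p z) * g z + peval p z * (g z - peval q z) by ring.
apply: le_lt_trans (modulusD _ _) _; rewrite !modulusM.
have := pP z Xz; rewrite lt_min => /andP[d1 d2]; have d3 := qP z Xz.
have pM : modulus (peval p z) <= M + 1.
  have := modulusB (f z) (f z - peval p z); rewrite opprB addrC subrK.
  move: (modulus (f z - _)) (modulus (f z)) (modulus (peval p z)) d1 (MP z Xz) => a b c.
  by lra.
have h1 : modulus (f z - peval p z) * modulus (g z) <= e / 4.
  rewrite (_ : e / 4 = e / (4 * N) * N); last by field; rewrite gt_eqF.
  by rewrite ler_pM ?modulus_ge0 ?NP // ltW.
have h2 : modulus (peval p z) * modulus (g z - peval q z) <= e / 4.
  rewrite (_ : e / 4 = (M + 1) * (e / (4 * (M + 1)))); last by field;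
    rewrite gt_eqF // addr_gt0.
  by rewrite ler_pM ?modulus_ge0 // ltW.
apply: le_lt_trans (lerD h1 h2) _; lra.
Qed.

Lemma approximable_prod I (s : seq I) (Q : pred I) (F : I -> Cn -> C) :
  (forall i, Q i -> approximable (F i)) ->
    approximable (fun x => \prod_(i <- s | Q i) F i x).
Proof.
move=> UF; elim: s => [|i s IH].
  by apply: approximable_ext (approximable_cst 1) => x _; rewrite big_nil.
have [Qi|Qi] := boolP (Q i); last first.
  by apply: approximable_ext IH => x _; rewrite big_cons (negPf Qi).
by apply: approximable_ext (approximable_mul (UF i Qi) IH) => x _; rewrite big_cons Qi.
Qed.

(** For a polynomial [p] close to [f], the geometric series in
    [1 - q * p], where [q] is an approximate inverse, converges to [1 / p]. *)
Lemma approximable_inv (f : Cn -> C) (c : R) : polynomial_hull X `<=` X -> 0 < c ->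
  approximable f ->
  (forall x, X x -> c <= modulus (f x)) -> approximable (fun x => (f x)^-1).
Proof.
move=> hX c0 Uf fc; apply: approximable_closed => e e0.
pose d := Num.min (c / 2) (e * c ^+ 2 / 2).
have d0 : 0 < d by rewrite lt_min !divr_gt0 // mulr_gt0 // exprn_gt0.
have [p pP] := Uf d d0.
have pc x : X x -> c / 2 <= modulus (peval p x).
  move=> Xx; have := pP x Xx; rewrite lt_min => /andP[h _].
  have := fc x Xx; have := modulusD (f x - peval p x) (peval p x).
  by rewrite subrK; lra.
have p0 x : X x -> peval p x != 0.
  by move=> Xx; rewrite -modulus_gt0; have := pc x Xx; lra.
have f0 x : X x -> f x != 0.
  by move=> Xx; rewrite -modulus_gt0; have := fc x Xx; lra.
exists (fun x => (peval p x)^-1); last first.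
  move=> x Xx; have -> : (f x)^-1 - (peval p x)^-1 =
    - (f x - peval p x) * ((f x)^-1 * (peval p x)^-1).
    by field; rewrite p0 ?f0.
  rewrite !modulusM modulusN !modulusV.
  have := pP x Xx; rewrite lt_min => /andP[_ h].
  rewrite -invfM ler_pdivrMr; last by rewrite mulr_gt0 ?modulus_gt0 ?f0 ?p0.
  apply: le_trans (ltW h) _; rewrite -mulrA ler_wpM2l ?(ltW e0) //.
  rewrite expr2 -mulrA ler_pM ?pc ?fc ?(ltW c0) //; lra.
have [q [th th1 qP]] := approx_inverse_on_hull cX hX p0.
move=> e1 e10.
have th1' : `|Num.max 0 th| < 1.
  by rewrite ger0_norm ?le_max ?lexx // gt_max ltr01 th1.
have ec : 0 < e1 * (c / 2) by rewrite mulr_gt0 // divr_gt0.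
have /cvgrPdist_lt/(_ _ ec)[k _ /(_ k (leqnn k))] := cvg_expr th1'.
rewrite sub0r normrN => kle.
exists (q * \sum_(i < k) (1 - q * p) ^+ i) => x Xx.
have -> : (peval p x)^-1 - peval (q * \sum_(i < k) (1 - q * p) ^+ i) x =
   (1 - peval q x * peval p x) ^+ k / peval p x.
  apply: (mulIf (p0 x Xx)); rewrite mulrBl mulVf ?p0 // mulfVK ?p0 //.
  set w := 1 - peval q x * peval p x.
  have wE : peval (1 - q * p) x = w by rewrite pevalB peval1 pevalM.
  have sE : peval (\sum_(i < k) (1 - q * p) ^+ i) x = \sum_(i < k) w ^+ i.
    by rewrite peval_sum; apply: eq_bigr => i _; rewrite pevalX wE.
  rewrite pevalM sE; have /eqP := subrX1 w k; rewrite subr_eq => /eqP ->.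
  by rewrite (_ : w - 1 = - (peval q x * peval p x)) /w; ring.
rewrite modulusM modulusV modulusX ltr_pdivrMr ?modulus_gt0 ?p0 //.
apply: (@le_lt_trans _ _ (Num.max 0 th ^+ k)).
  by rewrite lerXn2r ?nnegrE ?modulus_ge0 ?le_max ?lexx ?qP ?orbT.
apply: le_lt_trans (ler_norm _) _; apply: lt_le_trans kle _.
by rewrite ler_wpM2l ?(ltW e10) ?pc.
Qed.

End Approximable.

(** * The discrete Cauchy kernel *)

Section LatticeSums.
Variable R : realType.
Local Notation C := (Cplx R).

Definition weight1 (t : R) : R := (Num.sqrt (Num.max 1 `|t|))^-1.
Definition weight (u : C) : R := (Num.max 1 (modulus u))^-1.
Definition lattice_pt (x y : nat) : C := cplx x%:R y%:R.

Lemma max1_ge1 (t : R) : 1 <= Num.max 1 t. Proof. by rewrite le_max lexx. Qed.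
Lemma max1_gt0 (t : R) : 0 < Num.max 1 t.
Proof. exact: lt_le_trans ltr01 (max1_ge1 t). Qed.

Lemma weight_gt0 u : 0 < weight u. Proof. by rewrite invr_gt0 max1_gt0. Qed.
Lemma weight_le1 u : weight u <= 1. Proof. by rewrite invf_le1 ?max1_gt0 ?max1_ge1. Qed.
Lemma weight1_gt0 t : 0 < weight1 t. Proof. by rewrite invr_gt0 sqrtr_gt0 max1_gt0. Qed.

Lemma weight1_le t t' : `|t'| <= `|t| -> weight1 t <= weight1 t'.
Proof.
move=> tt'; rewrite /weight1 lef_pV2 ?posrE ?sqrtr_gt0 ?max1_gt0 //.
by rewrite ler_wsqrtr // ge_max !le_max lexx tt' orbT.
Qed.

Lemma sum_weight1_nat (K : nat) : \sum_(k < K.+1) weight1 k%:R <= 1 + 2 * Num.sqrt K%:R.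
Proof.
elim: K => [|K IH].
  by rewrite big_ord1 /weight1 normr0 (max_idPl ler01) sqrtr1 invr1 sqrtr0 mulr0 addr0.
rewrite big_ord_recr /=; apply: le_trans (lerD IH (lexx _)) _.
have K1 : 1 <= K.+1%:R :> R by rewrite ler1n.
have -> : weight1 K.+1%:R = (Num.sqrt K.+1%:R)^-1.
  by rewrite /weight1 normr_nat (max_idPr K1).
set a := Num.sqrt K%:R; set b := Num.sqrt K.+1%:R.
have b0 : 0 < b by rewrite sqrtr_gt0 ltr0n.
have a0 : 0 <= a by exact: sqrtr_ge0.
have ab : a <= b by rewrite ler_wsqrtr // ler_nat.
have ab1 : b ^+ 2 = a ^+ 2 + 1 by rewrite !sqr_sqrtr ?ler0n // -natr1.
have : b^-1 <= 2 * (b - a).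
  rewrite -(ler_pM2r b0) mulVf ?gt_eqF //; nra.
by lra.
Qed.

(** The points on one side of [xi] are at least as far from [xi] as
    0, 1, 2, and so on, so each side is dominated by a sum over the integers. *)
Lemma sum_weight1 (xi : R) (A : R) (T : nat) : 1 <= A ->
  \sum_(x < T) (if `|xi - x%:R| <= A then weight1 (xi - x%:R) else 0) <= 6 * Num.sqrt A.
Proof.
move=> A1; have A0 : 0 <= A by lra.
pose K := Num.truncn A.
pose G (k : nat) := if k%:R <= A then weight1 k%:R else 0.
have G0 k : 0 <= G k by rewrite /G; case: ifP => // _; exact: ltW (weight1_gt0 _).
have GB M : \sum_(k < M) G k <= 3 * Num.sqrt A.
  have : \sum_(k < M) G k <= \sum_(k < K.+1) weight1 k%:R.
    have -> : \sum_(k < K.+1) weight1 k%:R = \sum_(k < K.+1) G k.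
      apply: eq_bigr => k _; rewrite /G ifT //.
      by rewrite -truncn_ge_nat // -ltnS.
    rewrite -(big_mkord xpredT G) -(big_mkord xpredT G).
    have [MK|KM] := leqP M K.+1.
      by rewrite (big_cat_nat (n := M) _ MK) //= lerDl sumr_ge0.
    rewrite (big_cat_nat (n := K.+1) _ (ltnW KM)) //=.
    rewrite [X in _ + X](_ : _ = 0) ?addr0 // big_nat big1 // => k /andP[Kk _].
    rewrite /G ifF //; apply/negbTE; rewrite -ltNge.
    by apply: lt_le_trans (truncnS_gt A) _; rewrite ler_nat.
  move=> /le_trans; apply; apply: le_trans (sum_weight1_nat K) _.
  have : Num.sqrt K%:R <= Num.sqrt A by rewrite ler_wsqrtr // truncn_le.
  have : 1 <= Num.sqrt A by rewrite -sqrtr1 ler_wsqrtr.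
  by lra.
pose F x := if `|xi - x%:R| <= A then weight1 (xi - x%:R) else 0.
have F0 x : 0 <= F x by rewrite /F; case: ifP => // _; exact: ltW (weight1_gt0 _).
have FG x k : k%:R <= `|xi - x%:R| -> F x <= G k.
  move=> kx; rewrite /F; case: ifP => // xA; rewrite /G ifT ?(le_trans kx) //.
  by apply: weight1_le; rewrite normr_nat.
pose m := Num.truncn xi.
have mlow : m%:R <= Num.max 0 xi.
  have [xi0|xi0] := leP 0 xi; first by rewrite truncn_le.
  by rewrite /m (truncn0Pn _ _) // -ltNge; lra.
have mup : xi < m.+1%:R by exact: truncnS_gt.
have le1 : \sum_(x < T) F x <= \sum_(x < m.+1 + T) F x.
  by rewrite addnC big_split_ord /= lerDl sumr_ge0.
apply: le_trans le1 _; rewrite big_split_ord /=.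
have -> : 6 * Num.sqrt A = 3 * Num.sqrt A + 3 * Num.sqrt A by ring.
apply: lerD.
  apply: le_trans (GB m.+1).
  rewrite [leRHS](reindex_inj rev_ord_inj) /=; apply: ler_sum => x _.
  apply: FG; rewrite subSS natrB -1?ltnS //.
  have [xi0|xi0] := leP 0 xi; last first.
    rewrite (max_idPl (ltW xi0)) in mlow.
    by apply: le_trans (normr_ge0 _); rewrite subr_le0 (le_trans mlow) // ler0n.
  rewrite (max_idPr xi0) in mlow.
  by apply: le_trans (ler_norm _); rewrite lerB.
apply: le_trans (GB T); apply: ler_sum => x _; apply: FG.
rewrite natrD distrC; apply: le_trans (ler_norm _).
by move: mup; rewrite lerBrDl; set q := m.+1%:R; set p := x%:R; lra.
Qed.

(** This bound has the form of a product, which reduces sums over the lattice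
    to sums over the line. *)
Lemma weight_le_prod u : weight u <= weight1 (complex.Re u) * weight1 (complex.Im u).
Proof.
rewrite /weight /weight1 -invfM -sqrtrM ?(ltW (max1_gt0 _)) //.
rewrite lef_pV2 ?posrE ?sqrtr_gt0 ?mulr_gt0 ?max1_gt0 //.
have m0 := max1_gt0 (modulus u).
have -> : Num.max 1 (modulus u) = Num.sqrt (Num.max 1 (modulus u) ^+ 2).
  by rewrite sqrtr_sqr ger0_norm // ltW.
rewrite ler_wsqrtr // expr2.
rewrite ler_pM ?(ltW (max1_gt0 _)) //.
  by rewrite ge_max !le_max lexx Re_le_modulus orbT.
by rewrite ge_max !le_max lexx Im_le_modulus orbT.
Qed.

Lemma sum_weight (v : C) (A : R) (T : nat) : 1 <= A ->
  \sum_(x < T) \sum_(y < T)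
    (if modulus (v - lattice_pt x y) <= A then weight (v - lattice_pt x y) else 0) <=
      36 * A.
Proof.
move=> A1; have A0 : 0 <= A by lra.
pose f t (x : nat) := if `|t - x%:R| <= A then weight1 (t - x%:R) else 0.
have f0 t x : 0 <= f t x by rewrite /f; case: ifP => // _; exact: ltW (weight1_gt0 _).
have s0 t : 0 <= \sum_(x < T) f t x by apply: sumr_ge0.
apply: (@le_trans _ _ ((\sum_(x < T) f (complex.Re v) x) * (\sum_(y < T) f
  (complex.Im v) y))).
  rewrite mulr_suml; apply: ler_sum => x _; rewrite mulr_sumr; apply: ler_sum => y _.
  case: ifP => [uA|_]; last by rewrite mulr_ge0.
  have ReE : complex.Re (v - lattice_pt x y) = complex.Re v - x%:R by case: (v).
  have ImE : complex.Im (v - lattice_pt x y) = complex.Im v - y%:R by case: (v).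
  have := weight_le_prod (v - lattice_pt x y); rewrite /f -ReE -ImE !ifT //.
    by apply: le_trans uA; exact: Im_le_modulus.
  by apply: le_trans uA; exact: Re_le_modulus.
apply: le_trans (ler_pM (s0 _) (s0 _) (sum_weight1 _ _ A1) (sum_weight1 _ _ A1)) _.
by rewrite mulrACA -[Num.sqrt A * _]expr2 sqr_sqrtr // ler_wpM2r //; lra.
Qed.

Lemma count_lattice_pt (v : C) (A : R) (T : nat) : 1 <= A ->
  \sum_(x < T) \sum_(y < T) (if modulus (v - lattice_pt x y) <= A then 1 else 0) <=
    36 * A ^+ 2.
Proof.
move=> A1; have A0 : 0 <= A by lra.
have := ler_wpM2l A0 (sum_weight v T A1); rewrite (_ : A * (36 * A) = 36 * A ^+ 2);
  last by ring.
apply: le_trans; rewrite mulr_sumr; apply: ler_sum => x _.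
rewrite mulr_sumr; apply: ler_sum => y _.
case: ifP => [uA|_]; last by rewrite mulr0.
rewrite /weight -ler_pdivrMr ?invr_gt0 ?max1_gt0 // invrK mul1r.
by rewrite ge_max A1.
Qed.

End LatticeSums.

Section DiscreteKernel.
Variable R : realType.
Local Notation C := (Cplx R).
Local Notation ic := (cplx 0 1 : C).

(** The Cauchy kernel, with its singularity cut out. *)
Definition psi (u : C) : C := if modulus u < 1 then 0 else u^-1.
(** A discrete [dbar] derivative of the Cauchy kernel, which behaves like an
    approximate identity. *)
Definition kappa (u : C) : C := psi (u + 1) - psi u + ic * (psi (u + ic) - psi u).

Lemma modulus_ic : modulus ic = 1.
Proof. by rewrite modulusE /= expr0n expr1n add0r sqrtr1. Qed.

Lemma ic_sqr : ic * ic = -1.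
Proof. by apply/eqP; rewrite eq_complex /=; apply/andP; split; apply/eqP; ring. Qed.

Lemma psiE u : 1 <= modulus u -> psi u = u^-1.
Proof. by rewrite /psi ltNge => ->. Qed.

Lemma modulus_psi u : modulus (psi u) <= weight u.
Proof.
rewrite /psi; case: ltP => u1; first by rewrite modulus0 ltW ?weight_gt0.
by rewrite /weight (max_idPr u1) modulusV.
Qed.

(** Far from 0 the two differences of [1 / u] cancel to leading order:
    [kappa u = (1 - i) / (u (u + 1) (u + i))]. *)
Lemma modulus_kappa u : modulus u * modulus (kappa u) <= 108 * weight u ^+ 2.
Proof.
have [u3|u3] := leP 3 (modulus u).
  have u0 : 0 < modulus u by lra.
  have wE : weight u = (modulus u)^-1 by rewrite /weight (max_idPr _) //; lra.
  have b1 : 2 / 3 * modulus u <= modulus (u + 1).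
    by have := modulusB (u + 1) 1; rewrite addrK modulus1; lra.
  have bi : 2 / 3 * modulus u <= modulus (u + ic).
    by have := modulusB (u + ic) ic; rewrite addrK modulus_ic; lra.
  have nz (w : C) : 0 < modulus w -> w != 0 by rewrite modulus_gt0.
  have nu := nz _ u0.
  have nu1 : u + 1 != 0 by apply: nz; lra.
  have nui : u + ic != 0 by apply: nz; lra.
  have kE : kappa u = (1 - ic) / (u * (u + 1) * (u + ic)).
    have e1 : (u + 1)^-1 - u^-1 = - (u * (u + 1))^-1 by field; rewrite nu nu1.
    have e2 : ic * ((u + ic)^-1 - u^-1) = (u * (u + ic))^-1.
      transitivity (- (ic * ic) / (u * (u + ic))); last by rewrite ic_sqr opprK mul1r.
      by field; rewrite nu nui.
    have [q1 q2 q3] : [/\ 1 <= modulus u, 1 <= modulus (u + 1) & 1 <= modulus (u + ic)].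
      by split; lra.
    rewrite /kappa !psiE // e1 e2; field; by rewrite nu nu1 nui.
  rewrite kE modulusM modulusV !modulusM wE.
  have hi : modulus (1 - ic) <= 2.
    by apply: le_trans (modulusB _ _) _; rewrite modulus1 modulus_ic; lra.
  have -> : modulus u * (modulus (1 - ic) / (modulus u * modulus (u + 1) * modulus (u
    + ic))) =
     modulus (1 - ic) / (modulus (u + 1) * modulus (u + ic)).
    by field; rewrite !gt_eqF //; lra.
  rewrite ler_pdivrMr; last by rewrite mulr_gt0 //; lra.
  have h : 4 / 9 * (modulus u) ^+ 2 <= modulus (u + 1) * modulus (u + ic).
    rewrite (_ : 4 / 9 * modulus u ^+ 2 = (2 / 3 * modulus u) * (2 / 3 * modulus u)).
      by rewrite ler_pM //; lra.
    by field.
  have h2 := ler_wpM2l (_ : 0 <= 108 * (modulus u)^-1 ^+ 2) h.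
  apply: le_trans hi _; apply: le_trans (h2 _); last first.
    by rewrite mulr_ge0 // exprn_ge0 // invr_ge0 ltW.
  have -> : 108 * (modulus u)^-1 ^+ 2 * (4 / 9 * modulus u ^+ 2) = 48.
    by field; rewrite gt_eqF.
  by lra.
have p1 w : modulus (psi w) <= 1 by apply: le_trans (modulus_psi w) (weight_le1 w).
have k4 : modulus (kappa u) <= 4.
  apply: le_trans (modulusD _ _) _; rewrite modulusM modulus_ic mul1r.
  have := modulusB (psi (u + 1)) (psi u); have := modulusB (psi (u + ic)) (psi u).
  by have := p1 u; have := p1 (u + 1); have := p1 (u + ic); lra.
have w3 : 3^-1 <= weight u.
  by rewrite /weight lef_pV2 ?posrE ?max1_gt0 // ge_max; apply/andP; split; lra.
have : 9^-1 <= weight u ^+ 2.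
  rewrite (_ : 9^-1 = 3^-1 ^+ 2 :> R); last by field.
  by rewrite lerXn2r ?nnegrE // ltW // weight_gt0.
have : modulus u * modulus (kappa u) <= 3 * 4 by rewrite ler_pM ?modulus_ge0 // ltW.
by lra.
Qed.

Lemma abel_sum (V : comPzRingType) (f F F' : nat -> V) (T : nat) :
  (forall x, F' x.+1 = F x) ->
  \sum_(x < T) f x * (F' x - F x) =
  \sum_(x < T) (f x.+1 - f x) * F x + f 0%N * F' 0%N - f T * F' T.
Proof.
move=> FF'; elim: T => [|T IH]; first by rewrite !big_ord0; ring.
by rewrite !big_ord_recr /= IH FF'; ring.
Qed.

Lemma shifted_telescope (V : zmodType) (F F' : nat -> V) (T : nat) :
  (forall x, F' x.+1 = F x) -> \sum_(x < T) (F' x - F x) = F' 0%N - F' T.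
Proof.
move=> FF'; elim: T => [|T IH]; first by rewrite big_ord0 subrr.
by rewrite big_ord_recr /= IH FF' addrA subrK.
Qed.

Lemma lattice_pt_Sx (v : C) x y : v - lattice_pt R x.+1 y + 1 = v - lattice_pt R x y.
Proof.
by case: v => a b; rewrite /lattice_pt /cplx -natr1; apply/eqP; rewrite eq_complex /=;
   apply/andP; split; apply/eqP; ring.
Qed.

Lemma lattice_pt_Sy (v : C) x y : v - lattice_pt R x y.+1 + ic = v - lattice_pt R x y.
Proof.
by case: v => a b; rewrite /lattice_pt /cplx -natr1; apply/eqP; rewrite eq_complex /=;
   apply/andP; split; apply/eqP; ring.
Qed.

(** Summation by parts moves the differences from the kernel to [phi], and so
    turns the smoothing of [phi] into a sum of simple fractions. *)
Lemma kappa_sum_by_parts (phi : nat -> nat -> C) (v : C) (T : nat) :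
  (forall y, phi 0%N y = 0) -> (forall y, phi T y = 0) ->
  (forall x, phi x 0%N = 0) -> (forall x, phi x T = 0) ->
  \sum_(x < T) \sum_(y < T) phi x y * kappa (v - lattice_pt R x y) =
  \sum_(x < T) \sum_(y < T)
    (phi x.+1 y - phi x y + ic * (phi x y.+1 - phi x y)) * psi (v - lattice_pt R x y).
Proof.
move=> p0 pT q0 qT.
have E1 : \sum_(x < T) \sum_(y < T) phi x y * (psi (v - lattice_pt R x y + 1) - psi
  (v - lattice_pt R x y)) =
   \sum_(x < T) \sum_(y < T) (phi x.+1 y - phi x y) * psi (v - lattice_pt R x y).
  rewrite exchange_big [RHS]exchange_big /=; apply: eq_bigr => y _.
  rewrite (abel_sum (fun x => phi x y) (F := fun x => psi (v - lattice_pt R x y))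
     (F' := fun x => psi (v - lattice_pt R x y + 1))); last by move=> x;
       rewrite lattice_pt_Sx.
  by rewrite p0 pT !mul0r subr0 addr0.
have E2 : \sum_(x < T) \sum_(y < T) phi x y * (psi (v - lattice_pt R x y + ic) - psi
  (v - lattice_pt R x y)) =
   \sum_(x < T) \sum_(y < T) (phi x y.+1 - phi x y) * psi (v - lattice_pt R x y).
  apply: eq_bigr => x _.
  rewrite (abel_sum (fun y => phi x y) (F := fun y => psi (v - lattice_pt R x y))
     (F' := fun y => psi (v - lattice_pt R x y + ic))); last by move=> y;
       rewrite lattice_pt_Sy.
  by rewrite q0 qT !mul0r subr0 addr0.
transitivity (\sum_(x < T) \sum_(y < T) phi x y * (psi (v - lattice_pt R x y + 1) -
  psi (v - lattice_pt R x y)) +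
  ic * \sum_(x < T) \sum_(y < T) phi x y * (psi (v - lattice_pt R x y + ic) - psi (v
    - lattice_pt R x y))).
  rewrite mulr_sumr -big_split /=; apply: eq_bigr => x _.
  rewrite mulr_sumr -big_split /=; apply: eq_bigr => y _.
  by rewrite /kappa; ring.
rewrite E1 E2 mulr_sumr -big_split /=; apply: eq_bigr => x _.
rewrite mulr_sumr -big_split /=; apply: eq_bigr => y _.
by ring.
Qed.

(** The sum of [kappa] over a square telescopes to this sum over the boundary,
    the discrete analogue of the integral of [dz / z]. *)
Definition flux (T : nat) (v : C) : C :=
  \sum_(y < T) ((v - lattice_pt R 0 y + 1)^-1 - (v - lattice_pt R T y + 1)^-1) +
  ic * \sum_(x < T) ((v - lattice_pt R x 0 + ic)^-1 - (v - lattice_pt R x T + ic)^-1).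

Section Flux.
Variables (T : nat) (v : C).
Hypothesis T8 : (8 <= T)%N.
Hypothesis vRe : T%:R / 4 <= complex.Re v <= 3 * T%:R / 4.
Hypothesis vIm : T%:R / 4 <= complex.Im v <= 3 * T%:R / 4.

Let T8' : 8 <= T%:R :> R. Proof. by rewrite ler_nat. Qed.

Lemma flux_pole (x : nat) : (x <= T)%N ->
  [/\ 1 <= modulus (v - lattice_pt R 0 x + 1), 1 <= modulus (v - lattice_pt R T x + 1),
      1 <= modulus (v - lattice_pt R x 0 + ic) & 1 <=
        modulus (v - lattice_pt R x T + ic)].
Proof.
move=> xT.
case: v vRe vIm => a b /= /andP[a1 a2] /andP[b1 b2]; rewrite /lattice_pt /cplx.
have := T8'; set t := T%:R in a1 a2 b1 b2 * => t8.
split.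
- apply: le_trans (Re_le_modulus _) => /=; apply: le_trans (ler_norm _); lra.
- apply: le_trans (Re_le_modulus _) => /=; rewrite -normrN;
  apply: le_trans (ler_norm _) => /=; lra.
- apply: le_trans (Im_le_modulus _) => /=; apply: le_trans (ler_norm _); lra.
- apply: le_trans (Im_le_modulus _) => /=; rewrite -normrN;
  apply: le_trans (ler_norm _) => /=; lra.
Qed.

Lemma fluxE : \sum_(x < T) \sum_(y < T) kappa (v - lattice_pt R x y) = flux T v.
Proof.
transitivity (\sum_(x < T) \sum_(y < T) (psi (v - lattice_pt R x y + 1) - psi (v -
  lattice_pt R x y)) +
  ic * \sum_(x < T) \sum_(y < T) (psi (v - lattice_pt R x y + ic) - psi (v -
    lattice_pt R x y))).
  rewrite mulr_sumr -big_split /=; apply: eq_bigr => x _.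
  by rewrite mulr_sumr -big_split /=; apply: eq_bigr => y _.
congr (_ + _ * _).
  rewrite exchange_big /=; apply: eq_bigr => y _.
  rewrite (shifted_telescope (F := fun x =>
    psi (v - lattice_pt R x y)) (F' := fun x => psi (v - lattice_pt R x y + 1))).
    by have [h1 h2 _ _] := flux_pole (ltnW (ltn_ord y)); rewrite !psiE.
  by move=> x; rewrite lattice_pt_Sx.
apply: eq_bigr => x _.
rewrite (shifted_telescope (F := fun y => psi (v - lattice_pt R x y)) (F' := fun y =>
  psi (v - lattice_pt R x y + ic))).
  by have [_ _ h1 h2] := flux_pole (ltnW (ltn_ord x)); rewrite !psiE.
by move=> y; rewrite lattice_pt_Sy.
Qed.

(** All the boundary terms have a nonnegative real part, as they do for the
    integral of [dz / z] around a square with [v] inside. *)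
Lemma flux_lower : 8^-1 <= modulus (flux T v).
Proof.
apply: le_trans (Re_le_modulus _); apply: le_trans (ler_norm _).
have ReD (a b : C) : complex.Re (a + b) = complex.Re a + complex.Re b.
  by case: a b => [? ?] [? ?].
have ReB (a b : C) : complex.Re (a - b) = complex.Re a - complex.Re b.
  by case: a b => [? ?] [? ?].
have ReI (a : C) : complex.Re (ic * a) = - complex.Im a.
  by case: a => a b /=; ring.
have ImB (a b : C) : complex.Im (a - b) = complex.Im a - complex.Im b.
  by case: a b => [? ?] [? ?].
have ReV (a : C) : complex.Re a^-1 =
  complex.Re a / (complex.Re a ^+ 2 + complex.Im a ^+ 2).
  by case: a.
have ImV (a : C) : complex.Im a^-1 =
  - complex.Im a / (complex.Re a ^+ 2 + complex.Im a ^+ 2).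
  by case: a => a b; rewrite mulNr.
rewrite /flux ReD mulr_sumr !Re_sum.
rewrite -[8^-1]addr0; apply: lerD; last first.
  apply: sumr_ge0 => x _; rewrite ReI ImB opprB !ImV.
  rewrite [X in _ - X]mulNr opprK addr_ge0 // divr_ge0 ?addr_ge0 ?sqr_ge0 //.
    by move: T8' vIm; case: (v) => a b /= ? /andP[? ?]; lra.
  by move: T8' vIm; case: (v) => a b /= ? /andP[? ?]; lra.
apply: (@le_trans _ _ (\sum_(y < T) (8 * T%:R)^-1)).
  have T0 : T%:R != 0 :> R by rewrite gt_eqF //; apply: lt_le_trans T8'.
  by rewrite sumr_const card_ord -[leRHS]mulr_natr invfM mulfVK ?lexx.
apply: ler_sum => y _; rewrite ReB !ReV.
rewrite -[(8 * _)^-1]addr0; apply: lerD; last first.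
  rewrite -mulNr divr_ge0 ?addr_ge0 ?sqr_ge0 //.
  by move: T8' vRe; case: (v) => a b /= ? /andP[? ?]; lra.
have [y0 yT] : 0 <= y%:R :> R /\ y%:R <= T%:R :> R.
  by rewrite ler0n ler_nat ltnW.
move: vRe vIm; case: (v) => a b /= /andP[a1 a2] /andP[b1 b2].
have := T8'; set t := T%:R in a1 a2 b1 b2 yT * => t8.
set p := a - 0 + 1; set q := b - y%:R + 0.
have p1 : t / 4 <= p by rewrite /p; lra.
have p2 : p <= t by rewrite /p; lra.
have q1 : - t <= q by rewrite /q; lra.
have q2 : q <= t by rewrite /q; lra.
have pq : 0 < p ^+ 2 + q ^+ 2 by rewrite ltr_pwDl ?sqr_ge0 // exprn_gt0 //; lra.
rewrite ler_pdivlMr // mulrC ler_pdivrMr; last by lra.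
have : p ^+ 2 <= t ^+ 2 by nra.
have : q ^+ 2 <= t ^+ 2 by nra.
have : t ^+ 2 / 4 <= p * t by nra.
by lra.
Qed.

End Flux.
End DiscreteKernel.

(** * The Hartogs-Rosenthal theorem *)

Section HartogsRosenthal.
Variable R : realType.
Local Notation C := (Cplx R).
Local Notation ic := (cplx 0 1 : C).
Local Notation lattice_pt := (lattice_pt R).

(** The square of a weight below [al] is dominated by [al] times the weight, and
    the number of the other lattice points does not depend on [T]. *)
Lemma sum_weight_sqr (v : C) (T : nat) (al : R) : (0 < T)%N -> 0 < al -> al <= 1 ->
  (forall x y, (x < T)%N -> (y < T)%N -> modulus (v - lattice_pt x y) <= 2 * T%:R) ->
  \sum_(x < T) \sum_(y < T) weight (v - lattice_pt x y) ^+ 2 <=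
    72 * al * T%:R + 36 / al ^+ 2.
Proof.
move=> T0 al0 al1 vT.
have T1 : 1 <= T%:R :> R by rewrite ler1n.
have h1 : 1 <= 2 * T%:R :> R by lra.
have h2 : 1 <= al^-1 by rewrite invf_ge1.
have s1 := ler_wpM2l (ltW al0) (sum_weight v T h1).
have s2 := count_lattice_pt v T h2.
rewrite (_ : 72 * al * T%:R + 36 / al ^+ 2 =
  al * (36 * (2 * T%:R)) + 36 * al^-1 ^+ 2); last first.
  by rewrite exprVn; ring.
apply: le_trans (lerD s1 s2).
rewrite mulr_sumr -big_split /=; apply: ler_sum => x _.
rewrite mulr_sumr -big_split /=; apply: ler_sum => y _.
rewrite ifT ?vT //; have w0 := weight_gt0 (v - lattice_pt x y);
  have w1 := weight_le1 (v - lattice_pt x y).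
case: ifP => [_|/negbT]; first by nra.
rewrite -ltNge addr0 => h; rewrite expr2 ler_wpM2r ?(ltW w0) //.
rewrite /weight -[al]invrK lef_pV2 ?posrE ?invr_gt0 ?max1_gt0 //.
by rewrite le_max (ltW h) orbT.
Qed.

Lemma sum_weight_bad (v : C) (T : nat) (B : nat -> nat -> bool) (be : R) :
  0 < be -> be <= 1 ->
  \sum_(x < T) \sum_(y < T) (if B x y then weight (v - lattice_pt x y) else 0) <=
  be * \sum_(x < T) \sum_(y < T) (if B x y then 1 else 0) + 36 / be.
Proof.
move=> be0 be1; have h2 : 1 <= be^-1 by rewrite invf_ge1.
apply: le_trans (lerD (lexx _) (sum_weight v T h2)).
rewrite mulr_sumr -big_split /=; apply: ler_sum => x _.
rewrite mulr_sumr -big_split /=; apply: ler_sum => y _.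
have w0 := weight_gt0 (v - lattice_pt x y).
case: (B x y); last by rewrite mulr0 add0r; case: ifP => // _; exact: ltW.
rewrite mulr1; case: ifP => [_|/negbT]; first by rewrite lerDr ltW.
rewrite -ltNge addr0 => h.
rewrite /weight -[be]invrK lef_pV2 ?posrE ?invr_gt0 ?max1_gt0 //.
by rewrite le_max (ltW h) orbT.
Qed.

(** The class of functions is left abstract; it will consist of the functions
    of one variable that become approximable after composition with a
    polynomial. *)
Record division_closed (Y : set C) (cls : (C -> C) -> Prop) := DivisionClosed {
  dc_cst : forall c, cls (fun=> c);
  dc_id : cls id;
  dc_add : forall f g, cls f -> cls g -> cls (fun z => f z + g z);
  dc_mul : forall f g, cls f -> cls g -> cls (fun z => f z * g z);
  dc_inv : forall f (c : R), 0 < c -> (forall z, Y z -> c <= modulus (f z)) ->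
    cls f -> cls (fun z => (f z)^-1) }.

Lemma dc_sum Y cls (I : Type) (s : seq I) (P : pred I) (F : I -> C -> C) :
  division_closed Y cls -> (forall i, P i -> cls (F i)) ->
  cls (fun z => \sum_(i <- s | P i) F i z).
Proof.
move=> dc clsF; elim: s => [|i s IH].
  by under eq_fun do rewrite big_nil; exact: dc_cst dc 0.
under eq_fun do rewrite big_cons.
by case: (boolP (P i)) => Pi //; apply: (dc_add dc) => //; exact: clsF.
Qed.

Section GridDefs.
Variables (phi : C -> C) (D : R) (Y : set C) (T : nat).

(** The nodes form a square lattice of side [4 D] centred at 0, of mesh
    [4 D / T]. *)
Definition mesh : R := 4 * D / T%:R.
Definition corner : C := cplx (- (2 * D)) (- (2 * D)).
Definition node (x y : nat) : C := corner + rcplx mesh * lattice_pt x y.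
Definition grid_coord (z : C) : C := (z - corner) / rcplx mesh.
Definition grid_dbar (x y : nat) : C :=
  phi (node x.+1 y) - phi (node x y) + ic * (phi (node x y.+1) - phi (node x y)).
Definition smoothing (z : C) : C :=
  \sum_(x < T) \sum_(y < T) phi (node x y) * kappa (grid_coord z - lattice_pt x y).
Definition isolated x y : bool :=
  `[< forall z, Y z -> mesh <= modulus (z - node x y) >].
Definition isolated_sum (z : C) : C :=
  \sum_(x < T) \sum_(y < T) (if isolated x y
     then grid_dbar x y * (grid_coord z - lattice_pt x y)^-1 else 0).
(** The nodes that cannot serve as poles, because [Y] comes too close to
    them, although their coefficient does not vanish. *)
Definition crowded x y : bool := ~~ isolated x y && (grid_dbar x y != 0).

End GridDefs.

Section Grid.
Variables (phi : C -> C) (La D : R) (Y : set C) (T : nat).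
Hypotheses (La0 : 0 < La) (D0 : 0 < D).
Hypothesis phi_lip : forall z w, modulus (phi z - phi w) <= La * modulus (z - w).
Hypothesis phi_supp : forall z, 2 * D <= modulus z -> phi z = 0.
Hypothesis YD : forall z, Y z -> modulus z <= D.
Hypothesis T8 : (8 <= T)%N.

Let T8' : 8 <= T%:R :> R. Proof. by rewrite ler_nat. Qed.

Local Notation h := (mesh D T).
Local Notation a := (node D T).
Local Notation a0 := (corner D).
Local Notation v := (grid_coord D T).
Local Notation d := (grid_dbar phi D T).
Local Notation S := (smoothing phi D T).
Local Notation good := (isolated D Y T).
Local Notation Sg := (isolated_sum phi D Y T).
Local Notation bad := (crowded phi D Y T).

Let T0 : 0 < T%:R :> R. Proof. exact: lt_le_trans T8'. Qed.
Let h0 : 0 < h. Proof. by rewrite !divr_gt0 ?mulr_gt0. Qed.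
Let hC : rcplx h != 0 :> C.
Proof. by rewrite -modulus_eq0 modulus_rcplx normr_eq0 gt_eqF. Qed.

Let hT : h * T%:R = 4 * D. Proof. by rewrite /mesh mulfVK // gt_eqF. Qed.

Lemma grid_dist z x y : z - a x y = rcplx h * (v z - lattice_pt x y).
Proof.
rewrite /node /grid_coord mulrBr mulrCA divff ?mulr1 //.
by rewrite opprD addrA.
Qed.

Lemma grid_modulus z x y : modulus (z - a x y) = h * modulus (v z - lattice_pt x y).
Proof. by rewrite grid_dist modulusM modulus_rcplx ger0_norm // ltW. Qed.

Lemma grid_v z : Y z -> T%:R / 4 <= complex.Re (v z) <= 3 * T%:R / 4 /\
  T%:R / 4 <= complex.Im (v z) <= 3 * T%:R / 4.
Proof.
move=> Yz; have zD := YD Yz.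
have := Re_le_modulus z; have := Im_le_modulus z.
rewrite !ler_norml => /andP[i1 i2] /andP[r1 r2].
have -> : v z = cplx ((complex.Re z + 2 * D) / h) ((complex.Im z + 2 * D) / h).
  rewrite /grid_coord -rcplxV; case: (z) => p q; rewrite /corner /rcplx /cplx.
  by apply/eqP; rewrite eq_complex /=; apply/andP; split; apply/eqP; ring.
have hD : D / h = T%:R / 4.
  have hne : h != 0 by rewrite gt_eqF.
  by apply: (mulIf hne); rewrite mulfVK //; have := hT; lra.
have K t : - D <= t -> t <= D -> T%:R / 4 <= (t + 2 * D) / h <= 3 * T%:R / 4.
  move=> t1 t2; rewrite (_ : 3 * T%:R / 4 = 3 * (D / h)); last by rewrite hD; ring.
  rewrite -hD mulrA !ler_pM2r ?invr_gt0 //; apply/andP; split; lra.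
by split; apply: K; lra.
Qed.

Lemma grid_far z x y : Y z -> (x < T)%N -> (y < T)%N ->
  modulus (v z - lattice_pt x y) <= 2 * T%:R.
Proof.
move=> Yz xT yT; have [/andP[r1 r2] /andP[i1 i2]] := grid_v Yz.
apply: le_trans (modulus_le_ReIm _) _.
have {}xT : x%:R <= T%:R :> R by rewrite ler_nat ltnW.
have {}yT : y%:R <= T%:R :> R by rewrite ler_nat ltnW.
have x0 : 0 <= x%:R :> R by rewrite ler0n.
have y0 : 0 <= y%:R :> R by rewrite ler0n.
have : `|complex.Re (v z - lattice_pt x y)| <= T%:R.
  by move: r1 r2; rewrite ler_norml; case: (v z) => p q /= r1 r2; apply/andP; split;
    lra.
have : `|complex.Im (v z - lattice_pt x y)| <= T%:R.
  by move: i1 i2; rewrite ler_norml; case: (v z) => p q /= i1 i2; apply/andP; split;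
    lra.
by lra.
Qed.

(** The difference [phi (node x y) - phi z] is at most the Lipschitz constant
    times the distance, and [kappa] decays so fast that the sum of its products
    with the distance grows more slowly than [T]. *)
Lemma grid_smoothing z (al : R) : Y z -> 0 < al -> al <= 1 ->
  modulus (S z - phi z * flux T (v z)) <=
  108 * La * (288 * D * al + 144 * D / al ^+ 2 / T%:R).
Proof.
move=> Yz al0 al1; have [vR vI] := grid_v Yz.
rewrite -fluxE // /smoothing mulr_sumr -sumrB.
apply: (@le_trans _ _ (\sum_(x < T) \sum_(y < T) 108 * La * h * weight (v z -
  lattice_pt x y) ^+ 2)).
  apply: le_trans (modulus_sum _ _ _) _; apply: ler_sum => x _.
  rewrite mulr_sumr -sumrB.
  apply: le_trans (modulus_sum _ _ _) _; apply: ler_sum => y _.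
  rewrite -mulrBl modulusM.
  have := phi_lip (a x y) z; rewrite (modulusC (a x y)) grid_modulus => hl.
  apply: le_trans (ler_wpM2r (modulus_ge0 _) hl) _.
  have := modulus_kappa (v z - lattice_pt x y).
  have : 0 <= La * h by rewrite mulr_ge0 // ltW.
  move=> Lh /(ler_wpM2l Lh).
  by rewrite !mulrA; move=> /le_trans; apply; rewrite le_eqVlt; apply/orP; left;
    apply/eqP; ring.
have := sum_weight_sqr (ltac:(exact: leq_trans T8) : (0 < T)%N) al0 al1
  (fun x y => @grid_far z x y Yz).
have Lh : 0 <= 108 * La * h by rewrite !mulr_ge0 // ltW.
move=> /(ler_wpM2l Lh); rewrite mulr_sumr.
rewrite (eq_bigr (fun x : 'I_T =>
  \sum_(y < T) 108 * La * h * weight (v z - lattice_pt x y) ^+ 2)); last first.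
  by move=> x _; rewrite mulr_sumr.
move=> /le_trans; apply; rewrite le_eqVlt; apply/orP; left; apply/eqP.
rewrite (_ : 108 * La * h * _ =
  108 * La * (72 * al * (h * T%:R) + 36 * h / al ^+ 2)); last by ring.
by rewrite hT /mesh; field; rewrite !gt_eqF.
Qed.

Lemma grid_by_parts z :
  S z = \sum_(x < T) \sum_(y < T) d x y * psi (v z - lattice_pt x y).
Proof.
have bd w : 2 * D <= `|complex.Re w| \/ 2 * D <= `|complex.Im w| -> phi w = 0.
  move=> [H|H]; apply: phi_supp; apply: le_trans H _.
    exact: Re_le_modulus.
  exact: Im_le_modulus.
have low : 2 * D <= `|- (2 * D) + h * 0|.
  by rewrite mulr0 addr0 normrN ger0_norm // mulr_ge0 // ltW.
have up : 2 * D <= `|- (2 * D) + h * T%:R|.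
  by rewrite hT; apply: le_trans (ler_norm _); lra.
have ReE x y : complex.Re (a x y) = - (2 * D) + h * x%:R.
  by rewrite /node /corner /lattice_pt /rcplx /cplx /=; ring.
have ImE x y : complex.Im (a x y) = - (2 * D) + h * y%:R.
  by rewrite /node /corner /lattice_pt /rcplx /cplx /=; ring.
rewrite /smoothing (kappa_sum_by_parts (phi := fun x y => phi (a x y))) //.
- by move=> y; apply: bd; left; rewrite ReE.
- by move=> y; apply: bd; left; rewrite ReE.
- by move=> x; apply: bd; right; rewrite ImE.
- by move=> x; apply: bd; right; rewrite ImE.
Qed.

Lemma a_Sx x y : a x.+1 y - a x y = rcplx h.
Proof.
rewrite /node opprD addrACA subrr add0r -mulrBr (_ : lattice_pt _ _ - _ = 1) ?mulr1 //.
by rewrite /lattice_pt /cplx -natr1; apply/eqP; rewrite eq_complex /=; apply/andP;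
  split; apply/eqP; ring.
Qed.

Lemma a_Sy x y : a x y.+1 - a x y = rcplx h * ic.
Proof.
rewrite /node opprD addrACA subrr add0r -mulrBr (_ : lattice_pt _ _ - _ = ic) //.
by rewrite /lattice_pt /cplx -natr1; apply/eqP; rewrite eq_complex /=; apply/andP;
  split; apply/eqP; ring.
Qed.

Lemma modulus_d x y : modulus (d x y) <= 2 * La * h.
Proof.
apply: le_trans (modulusD _ _) _; rewrite modulusM modulus_ic mul1r.
have := phi_lip (a x.+1 y) (a x y); have := phi_lip (a x y.+1) (a x y).
by rewrite a_Sx a_Sy modulusM modulus_ic mulr1 modulus_rcplx ger0_norm ?(ltW h0) //;
  lra.
Qed.

(** Each dropped term is bounded by a multiple of [mesh * weight]; the number
    of crowded nodes controls the far ones, a lattice sum the near ones. *)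
Lemma grid_discard z (be : R) : Y z -> 0 < be -> be <= 1 ->
  modulus (S z - Sg z) <=
  2 * La * h * (be * \sum_(x < T) \sum_(y < T) (if bad x y then 1 else 0) + 36 / be).
Proof.
move=> Yz be0 be1; rewrite grid_by_parts /isolated_sum -sumrB.
have Lh : 0 <= 2 * La * h by rewrite !mulr_ge0 // ltW.
apply: le_trans (ler_wpM2l Lh (sum_weight_bad (v z) T bad be0 be1)).
rewrite mulr_sumr; apply: le_trans (modulus_sum _ _ _) _; apply: ler_sum => x _.
rewrite -sumrB mulr_sumr; apply: le_trans (modulus_sum _ _ _) _; apply: ler_sum => y _.
rewrite /crowded; case: (boolP (good x y)) => [|_] /=.
  move=> /asboolP/(_ _ Yz); rewrite grid_modulus -{1}[h]mulr1 ler_pM2l // => u1.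
  by rewrite psiE // subrr modulus0 mulr0.
rewrite subr0 modulusM; case: (eqVneq (d x y) 0) => [->|_] /=.
  by rewrite modulus0 mul0r mulr0.
by rewrite ler_pM ?modulus_ge0 ?modulus_d ?modulus_psi.
Qed.

(** The divisor [flux] need not be constant: its poles lie near the boundary
    of the grid, away from [Y], so it belongs to the class together with its
    inverse. *)
Lemma grid_class cls : division_closed Y cls ->
  cls (fun z => Sg z / flux T (v z)).
Proof.
move=> dc.
have clsv (c : C) : cls (fun z => v z + c).
  apply: (dc_add dc); last exact: dc_cst dc c.
  apply: (dc_mul dc); last exact: dc_cst dc _.
  by apply: (dc_add dc); [exact: dc_id dc|exact: dc_cst dc _].
have clsN f : cls f -> cls (fun z => - f z).
  move=> cf; rewrite (_ : (fun z => - f z) = fun z => -1 * f z); last first.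
    by apply/funext => z; rewrite mulN1r.
  by apply: (dc_mul dc) => //; exact: dc_cst dc _.
have clsVv (c : C) : (forall z, Y z -> 1 <= modulus (v z + c)) ->
  cls (fun z => (v z + c)^-1).
  by move=> H; apply: (dc_inv dc ltr01) => //.
apply: (dc_mul dc).
  rewrite /isolated_sum.
  apply: (dc_sum _ dc) => x _; apply: (dc_sum _ dc) => y _.
  case: (boolP (good x y)) => [/asboolP gd|_]; last exact: dc_cst dc 0.
  apply: (dc_mul dc); first exact: dc_cst dc _.
  apply: clsVv => z Yz; have := gd z Yz.
  by rewrite grid_modulus -{1}[h]mulr1 ler_pM2l.
apply: (@dc_inv _ _ dc _ 8^-1) => // [z Yz|].
  by have [vR vI] := grid_v Yz; exact: flux_lower.
have pole x z : (x <= T)%N -> Y z -> [/\ 1 <= modulus (v z - lattice_pt 0 x + 1),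
   1 <= modulus (v z - lattice_pt T x + 1), 1 <= modulus (v z - lattice_pt x 0 + ic) &
   1 <= modulus (v z - lattice_pt x T + ic)].
  by move=> xT Yz; have [vR vI] := grid_v Yz; exact: flux_pole.
rewrite /flux; apply: (dc_add dc).
  apply: (dc_sum _ dc) => y _; apply: (dc_add dc).
    under eq_fun do rewrite -addrA.
    by apply: clsVv => z /(pole _ _ (ltnW (ltn_ord y)))[]; rewrite addrA.
  apply: clsN; under eq_fun do rewrite -addrA.
  by apply: clsVv => z /(pole _ _ (ltnW (ltn_ord y)))[]; rewrite addrA.
apply: (dc_mul dc); first exact: dc_cst dc _.
apply: (dc_sum _ dc) => y _; apply: (dc_add dc).
  under eq_fun do rewrite -addrA.
  by apply: clsVv => z /(pole _ _ (ltnW (ltn_ord y)))[]; rewrite addrA.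
apply: clsN; under eq_fun do rewrite -addrA.
by apply: clsVv => z /(pole _ _ (ltnW (ltn_ord y)))[]; rewrite addrA.
Qed.

(** A crowded node lies within [mesh] of [Y] and of the support of [phi], hence
    in one of the covering discs with its radius doubled. *)
Lemma grid_count_crowded (r0 : R) (s : seq (C * R)) : 3 * h <= r0 ->
  (forall q, q \in s -> h <= q.2) ->
  (forall z, Y z -> (exists2 w, phi w != 0 & modulus (z - w) < r0) ->
     exists2 q, q \in s & modulus (z - q.1) <= q.2) ->
  \sum_(x < T) \sum_(y < T) (if bad x y then 1 else 0) <=
  144 / h ^+ 2 * \sum_(q <- s) q.2 ^+ 2.
Proof.
move=> hr hq cov.
pose B (q : C * R) x y : R := if modulus (v q.1 - lattice_pt x y) <=
  2 * q.2 / h then 1 else 0.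
have B0 q x y : 0 <= B q x y by rewrite /B; case: ifP.
have key x y : bad x y -> exists2 q, q \in s & B q x y = 1.
  move=> /andP[/asboolPn/existsNP[z /not_implyP[Yz /negP]]]; rewrite -ltNge => za dn0.
  have [w pw aw] : exists2 w, phi w != 0 & modulus (a x y - w) <= h.
    have [p0|] := eqVneq (phi (a x y)) 0; last first.
      by exists (a x y) => //; rewrite subrr modulus0 ltW.
    have [p1|] := eqVneq (phi (a x.+1 y)) 0; last first.
      by exists (a x.+1 y) => //; rewrite modulusC a_Sx modulus_rcplx ger0_norm // ltW.
    have [p2|] := eqVneq (phi (a x y.+1)) 0; last first.
      by exists (a x y.+1) => //;
        rewrite modulusC a_Sy modulusM modulus_ic mulr1 modulus_rcplx ger0_norm // ltW.
    by move: dn0; rewrite /grid_dbar p0 p1 p2 subrr mulr0 addr0 eqxx.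
  have [|q qs zq] := cov z Yz.
    exists w => //; have := modulusD (z - a x y) (a x y - w).
    by rewrite addrA subrK; have := h0; lra.
  exists q => //; rewrite /B ifT // ler_pdivlMr // mulrC -grid_modulus.
  have := modulusD (q.1 - z) (z - a x y); rewrite addrA subrK (modulusC q.1).
  by have := hq q qs; lra.
apply: (@le_trans _ _ (\sum_(x < T) \sum_(y < T) \sum_(q <- s) B q x y)).
  apply: ler_sum => x _; apply: ler_sum => y _.
  case: ifP => [/key[q qs <-]|_]; last by apply: sumr_ge0 => q _.
  by rewrite (big_rem q) //= lerDl sumr_ge0.
under eq_bigr do rewrite exchange_big /=.
rewrite exchange_big /= mulr_sumr big_seq [leRHS]big_seq; apply: ler_sum => q qs.
apply: le_trans (count_lattice_pt (v q.1) T _) _.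
  by rewrite ler_pdivlMr // mul1r; have := hq q qs; have := h0; lra.
by rewrite le_eqVlt; apply/orP; left; apply/eqP; field; rewrite gt_eqF.
Qed.

End Grid.

(** The Hartogs-Rosenthal theorem, localized to the part of [Y] near the
    support of [phi], which is assumed to have zero two-dimensional content.
    A discrete Cauchy-Green formula writes [phi] as a sum of simple fractions
    with poles at the nodes of a fine lattice.  The poles that are too close to
    [Y] are few and their fractions contribute little, so they can be dropped. *)
Theorem hartogs_rosenthal (Y : set C) (cls : (C -> C) -> Prop) (phi : C -> C)
    (La D r0 : R) :
  division_closed Y cls -> 0 < La -> 0 < D -> 0 < r0 ->
  (forall z w, modulus (phi z - phi w) <= La * modulus (z - w)) ->
  (forall z, 2 * D <= modulus z -> phi z = 0) ->
  (forall z, Y z -> modulus z <= D) ->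
  (forall eta : R, 0 < eta -> exists s : seq (C * R),
    [/\ forall q, q \in s -> 0 < q.2, \sum_(q <- s) q.2 ^+ 2 <= eta &
     forall z, Y z -> (exists2 w, phi w != 0 & modulus (z - w) < r0) ->
       exists2 q, q \in s & modulus (z - q.1) <= q.2]) ->
  forall e : R, 0 < e ->
  exists2 g, cls g & forall z, Y z -> modulus (phi z - g z) <= e.
Proof.
move=> dc La0 D0 r00 lip supp YD cover e e0.
have P k : 0 < k.+1%:R :> R by exact: ltr0Sn.
have K1 : 0 < 32 * (108 * La * (288 * D)).
  exact: mulr_gt0 (P _) (mulr_gt0 (mulr_gt0 (P _) La0) (mulr_gt0 (P _) D0)).
have K2 : 0 < 32 * (72 * La) by exact: mulr_gt0 (P _) (mulr_gt0 (P _) La0).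
have K3 : 0 < 32 * (288 * La) by exact: mulr_gt0 (P _) (mulr_gt0 (P _) La0).
pose al := Num.min 1 (e / (32 * (108 * La * (288 * D)))).
have al0 : 0 < al by rewrite lt_min ltr01 /=; exact: divr_gt0 e0 K1.
have al1 : al <= 1 by rewrite ge_min lexx.
pose tau := e / (32 * (72 * La)).
have tau0 : 0 < tau by exact: divr_gt0 e0 K2.
pose eta := e * tau / (32 * (288 * La)).
have eta0 : 0 < eta by exact: divr_gt0 (mulr_gt0 e0 tau0) K3.
have [s [s0 seta scov]] := cover eta eta0.
have [h1 h10 h1s] : exists2 h1 : R, 0 < h1 & forall q, q \in s -> h1 <= q.2.
  elim: (s) s0 => [|q s' IH] s0; first by exists 1; rewrite ?ltr01.
  have [|h1 h10 h1s] := IH; first by move=> q' q's; apply: s0; rewrite inE q's orbT.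
  exists (Num.min h1 q.2); first by rewrite lt_min h10 s0 // inE eqxx.
  move=> q'; rewrite inE => /predU1P[->|/h1s q'h]; first by rewrite ge_min lexx orbT.
  by rewrite ge_min q'h.
pose h2 := Num.min h1 (Num.min tau (r0 / 3)).
have h20 : 0 < h2 by rewrite !lt_min h10 tau0; exact: divr_gt0 r00 (P _).
(* The first summand makes the mesh at most [h2], the second makes the part of
   the smoothing error that decays with [T] small. *)
pose M := 4 * D / h2 + 32 * (108 * La * (144 * D / al ^+ 2)) / e.
pose T := (8 + Num.truncn M)%N.
have T8 : (8 <= T)%N by rewrite leq_addr.
have TM : M <= T%:R.
  apply: le_trans (ltW (truncnS_gt M)) _; rewrite ler_nat /T.
  by rewrite -[X in (X <= _)%N]add1n leq_add2r.
have T0 : 0 < T%:R :> R by rewrite ltr0n; exact: leq_trans T8.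
have [M1 M2] : 0 <= 4 * D / h2 /\ 0 <= 32 * (108 * La * (144 * D / al ^+ 2)) / e.
  have D4 k : 0 < k.+1%:R * D by exact: mulr_gt0 (P _) D0.
  split; first exact: ltW (divr_gt0 (D4 _) h20).
  apply: ltW (divr_gt0 (mulr_gt0 (P _) (mulr_gt0 (mulr_gt0 (P _) La0) (divr_gt0 (D4
    _) _))) e0).
  exact: exprn_gt0.
have mesh0 : 0 < mesh D T by exact: divr_gt0 (mulr_gt0 (P _) D0) T0.
have meshle : mesh D T <= h2.
  rewrite /mesh ler_pdivrMr // [leRHS]mulrC -ler_pdivrMr //.
  by apply: le_trans TM; rewrite lerDl.
move: (meshle); rewrite !le_min => /and3P[hh1 htau hr0].
exists (fun z => isolated_sum phi D Y T z / flux T (grid_coord D T z)).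
  exact: grid_class.
move=> z Yz.
have E1 := grid_smoothing La0 D0 lip YD T8 Yz al0 al1.
set S := smoothing _ _ _ _ in E1; set L := flux _ _ in E1 *.
have L8 : 8^-1 <= modulus L.
  by have [vR vI] := grid_v D0 YD T8 Yz; exact: flux_lower.
pose be := mesh D T / tau.
have be0 : 0 < be by rewrite divr_gt0.
have be1 : be <= 1 by rewrite ler_pdivrMr // mul1r.
have E2 := grid_discard La0 D0 lip supp T8 Yz be0 be1.
rewrite -/S in E2; set G := isolated_sum _ _ _ _ _ in E2 *.
have cnt := grid_count_crowded (T := T) D0 T8 (s := s) (phi := phi) (Y := Y) (r0 := r0).
have {}cnt : \sum_(x < T) \sum_(y < T) (if crowded phi D Y T x y then 1 else 0) <=
    144 / mesh D T ^+ 2 * \sum_(q <- s) q.2 ^+ 2.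
  apply: cnt => //; first by rewrite -ler_pdivlMl // mulrC.
  by move=> q qs; apply: le_trans hh1 _; exact: h1s.
set N := \sum_(x < T) _ in E2 cnt.
have hN : mesh D T * (be * N) <= 144 * eta / tau.
  have c0 : 0 <= mesh D T * be by rewrite mulr_ge0 // ltW.
  rewrite mulrA; apply: le_trans (ler_wpM2l c0 cnt) _.
  have -> : mesh D T * be * (144 / mesh D T ^+ 2 * \sum_(q <- s) q.2 ^+ 2) =
     144 / tau * \sum_(q <- s) q.2 ^+ 2.
    by rewrite /be; field; rewrite !gt_eqF.
  rewrite [leRHS]mulrAC; apply: ler_wpM2l seta.
  exact: ltW (divr_gt0 (P _) tau0).
have hbe : mesh D T * (36 / be) = 36 * tau.
  by rewrite /be; field; rewrite !gt_eqF.
have b1 : 2 * La * (144 * eta / tau) = e / 32.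
  by rewrite /eta; field; rewrite !gt_eqF.
have b2 : 2 * La * (36 * tau) = e / 32.
  by rewrite /tau; field; rewrite !gt_eqF.
have E2' : modulus (S - G) <= e / 16.
  apply: le_trans E2 _; rewrite -mulrA mulrDr hbe.
  have L2 : 0 <= 2 * La by exact: ltW (mulr_gt0 (P _) La0).
  have := ler_wpM2l L2 hN; rewrite b1 mulrDr b2; lra.
have a1 : 108 * La * (288 * D * al) <= e / 32.
  have : al <= e / (32 * (108 * La * (288 * D))) by rewrite ge_min lexx orbT.
  rewrite ler_pdivlMr //; set x := La * D; lra.
have a2 : 108 * La * (144 * D / al ^+ 2 / T%:R) <= e / 32.
  have : 32 * (108 * La * (144 * D / al ^+ 2)) / e <= T%:R.
    by apply: le_trans TM; rewrite lerDr.
  rewrite ler_pdivrMr // => h32; rewrite mulrA ler_pdivrMr //; lra.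
have E1' : modulus (S - phi z * L) <= e / 16.
  by apply: le_trans E1 _; rewrite mulrDr; lra.
have L0 : 0 < modulus L by apply: lt_le_trans L8.
have Ln : L != 0 by rewrite -modulus_gt0.
have -> : phi z - G / L = (- (S - phi z * L) + (S - G)) / L by field.
rewrite modulusM modulusV ler_pdivrMr //.
apply: le_trans (modulusD _ _) _; rewrite modulusN.
by have := ler_wpM2l (ltW e0) L8; lra.
Qed.

End HartogsRosenthal.

(** * From sets of zero area to plane functions *)

Section AreaCover.
Variables (R : realType) (n : nat).
Local Notation C := (Cplx R).
Local Notation Cn := (Cspace R n).

Lemma half_sum (N : nat) : \sum_(k < N) (2^-1 : R) ^+ k.+1 <= 1.
Proof.
suff -> : \sum_(k < N) (2^-1 : R) ^+ k.+1 = 1 - 2^-1 ^+ N.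
  by rewrite gerBl exprn_ge0 // invr_ge0.
elim: N => [|N IH]; first by rewrite big_ord0 expr0 subrr.
by rewrite big_ord_recr /= IH exprS; field.
Qed.

Lemma compact_finite_nat (K : set Cn) (O : nat -> set Cn) : compact K ->
  (forall k, open (O k)) -> K `<=` \bigcup_k O k ->
  exists N : nat, forall x, K x -> exists2 k, (k < N)%N & O k x.
Proof.
rewrite compact_cover => cK oO KO.
have [|D _ KD] := cK nat setT O (fun i _ => oO i).
  by move=> x /KO[k _ Okx]; exists k.
exists (\max_(k <- enum_fset D) k).+1 => x /KD[k kD Okx]; exists k => //.
by rewrite ltnS; apply: (@leq_bigmax_seq _ _ xpredT id).
Qed.

(** Enlarging the diameters by a summable amount replaces the sets of a
    countable cover by open balls, of which finitely many suffice. *)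
Lemma area0_cover (Gamma K : set Cn) (eta : R) : area Gamma = 0%E ->
  compact K -> K `<=` Gamma -> 0 < eta ->
  exists s : seq (Cn * R), [/\ forall q, q \in s -> 0 < q.2,
    \sum_(q <- s) q.2 ^+ 2 <= eta &
    forall x, K x -> exists2 q, q \in s & enorm (x - q.1) <= q.2].
Proof.
move=> A0 cK KG eta0; have e2 : 0 < eta / 2 by rewrite divr_gt0.
have : (area_delta 1 Gamma < (eta / 2)%:E)%E.
  apply: (@le_lt_trans _ _ 0%E); last by rewrite lte_fin.
  by rewrite -A0; apply: ereal_sup_ubound; exists 1 => //=; rewrite ltr01.
move=> /ereal_inf_lt[_ [U [GU Ud] <-]] Ulim.
have dge0 k : (0 <= diameter (U k))%E.
  by apply: ereal_sup_ubound; left.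
pose d k := fine (diameter (U k)).
have dE k : diameter (U k) = (d k)%:E.
  rewrite /d fineK // ge0_fin_numE //.
  by apply: le_lt_trans (Ud k) _; rewrite ltry.
have d0 k : 0 <= d k by rewrite -lee_fin -dE.
have dsum N : \sum_(k < N) d k ^+ 2 <= eta / 2.
  rewrite -lee_fin; apply: le_trans (ltW Ulim).
  apply: le_trans (nneseries_lim_ge N (P := xpredT) _); last first.
    by move=> k _ _; rewrite mule_ge0.
  rewrite big_mkord -sumEFin; apply: lee_sum => k _.
  by rewrite dE -EFinM expr2.
pose rho k := Num.sqrt (d k ^+ 2 + eta / 2 * 2^-1 ^+ k.+1).
have pk k : 0 < eta / 2 * 2^-1 ^+ k.+1 by rewrite mulr_gt0 // exprn_gt0 // invr_gt0.
have rho0 k : 0 < rho k by rewrite sqrtr_gt0 ltr_wpDl ?sqr_ge0.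
have drho k : d k < rho k.
  rewrite -[d k]ger0_norm // -sqrtr_sqr ltr_sqrt ?ltrDl //.
  by rewrite ltr_wpDl ?sqr_ge0.
have /choice[c cP] (k : nat) : exists c : Cn, forall x, U k x -> enorm (x - c) <= d k.
  have [[c Uc]|Un] := pselect (U k !=set0); last first.
    by exists 0 => x Ux; case: Un; exists x.
  exists c => x Ux; rewrite -lee_fin -dE; apply: ereal_sup_ubound.
  right; exists x => //; by exists c.
pose O k := [set x | enorm (x - c k) < rho k].
have oO k : open (O k) by exact: open_eball.
have [|N NP] := compact_finite_nat cK oO.
  move=> x /KG/GU[k _ Ux]; exists k => //; rewrite /O /=.
  by apply: le_lt_trans (drho k); exact: cP.
exists [seq (c k, rho k) | k <- iota 0 N]; split.
- by move=> _ /mapP[k _ ->] /=; exact: rho0.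
- rewrite big_map -[N in iota 0 N]subn0 big_mkord /=.
  rewrite (eq_bigr (fun k : 'I_N => d k ^+ 2 + eta / 2 * 2^-1 ^+ k.+1)); last first.
    by move=> k _; rewrite sqr_sqrtr // ltW // ltr_wpDl ?sqr_ge0.
  rewrite big_split /= -mulr_sumr.
  have := ler_wpM2l (ltW e2) (half_sum N); have := dsum N; lra.
- move=> x /NP[k kN Ok]; exists (c k, rho k); last exact: ltW.
  by apply/mapP; exists k => //; rewrite mem_iota.
Qed.

End AreaCover.

Section PolynomialBumps.
Variables (R : realType) (n : nat) (X Gamma : set (Cspace R n)) (s : R).
Local Notation C := (Cplx R).
Local Notation Cn := (Cspace R n).
Local Notation P := (mpoly.mpoly n C).
Local Notation approximable f := (uniformly_approximable_by_polynomials f X).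
Hypothesis cX : compact X.
Hypothesis hX : polynomial_hull X `<=` X.
Hypothesis clG : closed Gamma.
Hypothesis area0 : area Gamma = 0%E.
Hypothesis XG : forall x, X x -> s < enorm x -> Gamma x.

(** The Hartogs-Rosenthal theorem on [p @` X]: near the support of [phi] this
    set is the image of a part of [Gamma], and the Lipschitz map [p] preserves
    zero area.  A pole outside [p @` X] gives a fraction that is approximable
    on [X], because [X] is polynomially convex. *)
Lemma approximable_comp (p : P) (phi : C -> C) (La Lp r0 : R) :
  0 < La -> 0 < Lp -> 0 < r0 ->
  (forall z w, modulus (phi z - phi w) <= La * modulus (z - w)) ->
  (forall x y, modulus (peval p x - peval p y) <= Lp * enorm (x - y)) ->
  (exists M : R, forall w, phi w != 0 -> modulus w <= M) ->
  (forall w x, phi w != 0 -> X x -> enorm x <= s -> r0 <= modulus (peval p x - w)) ->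
  approximable (fun x => phi (peval p x)).
Proof.
move=> La0 Lp0 r00 lip plip [M phiM] sep.
pose Y : set C := [set peval p x | x in X].
pose cls (g : C -> C) := approximable (fun x => g (peval p x)).
have dc : division_closed Y cls.
  split.
  - by move=> c; exact: approximable_cst.
  - exact: approximable_peval.
  - by move=> f g; exact: approximable_add.
  - by move=> f g; exact: approximable_mul.
  - move=> f c c0 fc cf; apply: (@approximable_inv _ _ _ cX _ c hX c0 cf) => x Xx.
    by apply: fc; exists x.
have [N NP] := peval_bounded cX p.
pose D := 1 + `|N| + `|M|.
have D0 : 0 < D by rewrite ltr_wpDr // ltr_wpDr.
have supp w : 2 * D <= modulus w -> phi w = 0.
  move=> Dw; apply: contrapT => /eqP/phiM; have := ler_norm M; have := normr_ge0 N;
    have := normr_ge0 M.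
  by move: Dw; rewrite /D; lra.
have YD z : Y z -> modulus z <= D.
  move=> [x Xx <-].
  have : modulus (peval p x) <= N by apply: NP; exists x.
  by have := ler_norm N; have := normr_ge0 M; rewrite /D; lra.
have cover (eta : R) : 0 < eta -> exists q : seq (C * R),
    [/\ forall r, r \in q -> 0 < r.2, \sum_(r <- q) r.2 ^+ 2 <= eta &
     forall z, Y z -> (exists2 w, phi w != 0 & modulus (z - w) < r0) ->
       exists2 r, r \in q & modulus (z - r.1) <= r.2].
  move=> eta0.
  have cK : compact (X `&` Gamma) by apply: compact_closedI.
  have [|q [q0 qs qK]] := area0_cover area0 cK (@subIsetr _ _ _) (eta := eta / Lp ^+ 2).
    by rewrite divr_gt0 // exprn_gt0.
  exists [seq (peval p xr.1, Lp * xr.2) | xr <- q]; split.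
  + by move=> _ /mapP[xr /q0 xr0 ->] /=; rewrite mulr_gt0.
  + rewrite big_map; under eq_bigr do rewrite exprMn.
    by rewrite -mulr_sumr mulrC -ler_pdivlMr // exprn_gt0.
  + move=> _ [x Xx <-] [w pw xw].
    have [xs|xs] := leP (enorm x) s.
      by have := sep w x pw Xx xs; rewrite leNgt xw.
    have [|xr xrq xd] := qK x; first by split=> //; exact: XG.
    exists (peval p xr.1, Lp * xr.2); first by apply/mapP; exists xr.
    by apply: le_trans (plip _ _) _; rewrite ler_wpM2l // ltW.
have H := hartogs_rosenthal dc La0 D0 r00 lip supp YD cover.
apply: approximable_closed => e e0; have [g cg ge] := H e e0.
by exists (fun x => g (peval p x)) => // x Xx; apply: ge; exists x.
Qed.

End PolynomialBumps.

(** * Functions that vanish on a ball *)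

Section Tent.
Variable R : realType.
Local Notation C := (Cplx R).

Definition tent (b : C) (de : R) (w : C) : R :=
  Num.max 0 (Num.min 1 (2 - 2 * modulus (w - b) / de)).

Lemma tent_ge0 b de w : 0 <= tent b de w.
Proof. by rewrite le_max lexx. Qed.

Lemma tent_le1 b de w : tent b de w <= 1.
Proof. by rewrite ge_max ler01 ge_min lexx. Qed.

Lemma tent_one b de w : 0 < de -> modulus (w - b) <= de / 2 -> tent b de w = 1.
Proof.
move=> de0 wb; rewrite /tent (min_idPl _) ?(max_idPr ler01) //.
have : 2 * modulus (w - b) / de <= 1 by rewrite ler_pdivrMr //; lra.
by lra.
Qed.

Lemma tent_supp b de w : 0 < de -> tent b de w != 0 -> modulus (w - b) < de.
Proof.
move=> de0; apply: contraNT; rewrite -leNgt => wb.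
have : 2 <= 2 * modulus (w - b) / de by rewrite ler_pdivlMr //; lra.
move=> h; apply/eqP; rewrite /tent (max_idPl _) // ge_min; apply/orP; right; lra.
Qed.

Lemma tent_lip b de z w : 0 < de ->
  modulus (rcplx (tent b de z) - rcplx (tent b de w) : C) <= 2 / de * modulus (z - w).
Proof.
move=> de0; rewrite -rcplxB modulus_rcplx.
have clamp (x y : R) : `|Num.max 0 (Num.min 1 x) - Num.max 0 (Num.min 1 y)| <= `|x - y|.
  rewrite ler_norml !/Num.max !/Num.min.
  have := ler_norm (x - y); have := ler_norm (- (x - y)); rewrite normrN.
  by case: (ltP 1 x); case: (ltP 1 y) => ? ?; repeat case: ifP; rewrite ?ltNge => *;
    apply/andP; split; lra.
apply: le_trans (clamp _ _) _.
have -> : 2 - 2 * modulus (z - b) / de - (2 - 2 * modulus (w - b) / de) =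
  2 / de * - (modulus (z - b) - modulus (w - b)) by ring.
rewrite normrM normrN ger0_norm ?divr_ge0 ?(ltW de0) //.
apply: ler_wpM2l; first by rewrite divr_ge0 // ltW.
by apply: le_trans (modulus_dist _ _) _; rewrite opprB addrA subrK.
Qed.

End Tent.

Section LinearForms.
Variables (R : realType) (n : nat).
Local Notation C := (Cplx R).
Local Notation Cn := (Cspace R n).
Local Notation P := (mpoly.mpoly n C).

Definition cconj (w : C) : C := cplx (complex.Re w) (- complex.Im w).

Lemma modulus_cconj w : modulus (cconj w) = modulus w.
Proof. by rewrite !modulusE /= sqrrN. Qed.

Lemma cconj_mul w : cconj w * w = rcplx (modulus w ^+ 2).
Proof.
rewrite modulusE sqr_sqrtr ?addr_ge0 ?sqr_ge0 //.
by case: w => x y; apply/eqP; rewrite eq_complex /=; apply/andP; split; apply/eqP; ring.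
Qed.

(** The form [<z, a> + t z_j]: the first summand separates [a] from smaller
    balls, the second sees the [j]-th coordinate. *)
Definition tilted (a : Cn) (t : R) (j : 'I_n) : P :=
  \sum_(i < n) cconj (a 0 i) *: mpoly.mpolyX C (mpoly.mnm1 i) +
  (rcplx t : C) *: mpoly.mpolyX C (mpoly.mnm1 j).

Lemma peval_tilted a t j z :
  peval (tilted a t j) z = \sum_(i < n) cconj (a 0 i) * z 0 i + rcplx t * z 0 j.
Proof.
rewrite pevalD pevalZ pevalXU peval_sum; congr (_ + _).
by apply: eq_bigr => i _; rewrite pevalZ pevalXU.
Qed.

Lemma peval_tiltedB a t j z w :
  peval (tilted a t j) z - peval (tilted a t j) w = peval (tilted a t j) (z - w).
Proof.
rewrite !peval_tilted !mxE mulrBr opprD addrACA -sumrB; congr (_ + _).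
by apply: eq_bigr => i _; rewrite !mxE mulrBr.
Qed.

Lemma tilted_sub a t j k z :
  peval (tilted a t j) z - peval (tilted a 0 k) z = rcplx t * z 0 j.
Proof.
apply: (etrans (congr2 (fun x y : C =>
  x - y) (peval_tilted a t j z) (peval_tilted a 0 k z))).
move: (\sum_(i < n) _) => S.
have -> : rcplx 0 * z 0 k = 0 by exact: mul0r.
by rewrite addr0 addrAC subrr add0r.
Qed.

Lemma enorm_cauchy_schwarz (a z : Cn) :
  modulus (\sum_(i < n) cconj (a 0 i) * z 0 i) <= enorm a * enorm z.
Proof.
apply: (@le_trans _ _ (\sum_(i < n) modulus (a 0 i) * modulus (z 0 i))).
  apply: le_trans (modulus_sum _ _ _) _; apply: ler_sum => i _.
  by rewrite modulusM modulus_cconj.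
have [a0|a0] := leP (enorm a) 0.
  rewrite (_ : enorm a = 0); last by apply/eqP; rewrite eq_le a0 enorm_ge0.
  rewrite mul0r big1 // => i _.
  rewrite (_ : modulus (a 0 i) = 0) ?mul0r //; apply/eqP.
  by rewrite eq_le modulus_ge0 andbT (le_trans (coord_le_enorm _ _)).
have [z0|z0] := leP (enorm z) 0.
  rewrite (_ : enorm z = 0); last by apply/eqP; rewrite eq_le z0 enorm_ge0.
  rewrite mulr0 big1 // => i _.
  rewrite (_ : modulus (z 0 i) = 0) ?mulr0 //; apply/eqP.
  by rewrite eq_le modulus_ge0 andbT (le_trans (coord_le_enorm _ _)).
have K0 : 0 < 2 * (enorm a * enorm z) by rewrite !mulr_gt0.
rewrite -(ler_pM2l K0) mulr_sumr.
apply: (@le_trans _ _ (\sum_(i < n) (enorm z ^+ 2 * modulus (a 0 i) ^+ 2 +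
    enorm a ^+ 2 * modulus (z 0 i) ^+ 2))).
  apply: ler_sum => i _.
  have := sqr_ge0 (enorm z * modulus (a 0 i) - enorm a * modulus (z 0 i)).
  by rewrite sqrrB !exprMn; lra.
rewrite big_split /= -!mulr_sumr -!sqr_enorm; lra.
Qed.

Lemma tilted_le a t j z : 0 <= t ->
  modulus (peval (tilted a t j) z) <= (enorm a + t) * enorm z.
Proof.
move=> t0; rewrite peval_tilted mulrDl; apply: le_trans (modulusD _ _) _.
rewrite lerD ?enorm_cauchy_schwarz // modulusM modulus_rcplx ger0_norm //.
by rewrite ler_wpM2l // coord_le_enorm.
Qed.

Lemma tilted_ge a t j : 0 <= t ->
  enorm a ^+ 2 - t * enorm a <= modulus (peval (tilted a t j) a).
Proof.
move=> t0; rewrite peval_tilted.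
have -> : \sum_(i < n) cconj (a 0 i) * a 0 i = rcplx (enorm a ^+ 2).
  rewrite sqr_enorm (eq_bigr (fun i => rcplx (modulus (a 0 i) ^+ 2) : C)); last first.
    by move=> i _; rewrite cconj_mul.
  by rewrite /rcplx /cplx; elim/big_rec2 : _ => // i x y _ ->; rewrite -rcplxD.
have := modulusB (rcplx (enorm a ^+ 2) + rcplx t * a 0 j) (rcplx t * a 0 j).
rewrite addrK modulus_rcplx ger0_norm ?sqr_ge0 // modulusM modulus_rcplx ger0_norm //.
have := ler_wpM2l t0 (coord_le_enorm a j); lra.
Qed.

End LinearForms.

Section LocalBump.
Variables (R : realType) (n : nat) (X Gamma : set (Cspace R n)) (s : R).
Local Notation C := (Cplx R).
Local Notation Cn := (Cspace R n).
Local Notation approximable f := (uniformly_approximable_by_polynomials f X).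
Hypothesis cX : compact X.
Hypothesis hX : polynomial_hull X `<=` X.
Hypothesis clG : closed Gamma.
Hypothesis area0 : area Gamma = 0%E.
Hypothesis XG : forall x, X x -> s < enorm x -> Gamma x.
Hypothesis s0 : 0 <= s.

(** For small [t], the value of the tilted form at [a] still exceeds its
    maximum on the ball by a definite gap, which leaves room for a bump. *)
Lemma approximable_tilted (a : Cn) (t de : R) (j : 'I_n) : s < enorm a -> 0 <= t ->
  0 < de ->
  t * (enorm a + s) <= (enorm a ^+ 2 - s * enorm a) / 4 ->
  de <= (enorm a ^+ 2 - s * enorm a) / 4 ->
  approximable (fun x => rcplx (tent (peval (tilted a t j) a) de
    (peval (tilted a t j) x))).
Proof.
move=> sa t0 de0; set p := tilted a t j; set g := _ - _ => tg dg.
have gE : g = enorm a ^+ 2 - s * enorm a by [].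
have a0 : 0 < enorm a by exact: le_lt_trans sa.
have g0 : 0 < g by rewrite gE expr2 -mulrBl mulr_gt0 // subr_gt0.
clearbody g.
have lo := tilted_ge a j t0; rewrite -/p in lo.
apply: (@approximable_comp _ _ _ _ _ cX hX clG area0 XG p
   (fun w => rcplx (tent (peval p a) de w)) (2 / de) (enorm a + t) (g / 4)).
- by rewrite divr_gt0.
- by rewrite ltr_wpDr.
- by rewrite divr_gt0.
- by move=> z w; exact: tent_lip.
- by move=> x y; rewrite peval_tiltedB; exact: tilted_le.
- exists (modulus (peval p a) + de) => w; rewrite -modulus_eq0 modulus_rcplx normr_eq0.
  move=> /(tent_supp de0); have := modulusD (w - peval p a) (peval p a).
  by rewrite subrK; lra.
- move=> w x; rewrite -modulus_eq0 modulus_rcplx normr_eq0 => /(tent_supp de0) wa Xx xs.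
  have up := tilted_le a j x t0; rewrite -/p in up.
  have xs' : (enorm a + t) * enorm x <= (enorm a + t) * s.
    by rewrite ler_wpM2l // addr_ge0 // ltW.
  have tri : modulus (peval p a) <=
      modulus (w - peval p a) + modulus (peval p x - w) + modulus (peval p x).
    apply: (@le_trans _ _ (modulus (peval p x - (w - peval p a) - (peval p x - w)))).
      by rewrite (_ : _ - _ - _ = peval p a) //; ring.
    apply: le_trans (modulusB _ _) _; rewrite addrAC lerD2r addrC.
    exact: modulusB.
  move: (modulus (peval p a)) (modulus (w - _)) (modulus (peval p x - w))
    (modulus (peval p x)) lo wa up tri => m1 m2 m3 m4 lo wa up tri.
  move: (enorm a) (enorm x) xs' lo up gE tg => A B xs' lo up gE tg.
  by clear -tg dg lo wa up tri xs' gE g0; lra.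
Qed.

(** The bump for [<z, a>] times the bumps for all the tilted forms: where none
    of them vanishes, each coordinate is close to that of [a]. *)
Lemma point_bump (a : Cn) (eps : R) : s < enorm a -> 0 < eps ->
  exists b : Cn -> R, [/\ approximable (fun x => rcplx (b x)), forall x, 0 <= b x <= 1,
    exists2 rho : R, 0 < rho & forall x, enorm (x - a) < rho -> b x = 1 &
    forall x, b x != 0 -> forall i, modulus ((x - a) 0 i) < eps].
Proof.
move=> sa eps0.
have a0 : 0 < enorm a by exact: le_lt_trans sa.
have [i0 _] : exists i0 : 'I_n, True.
  apply: contrapT => no; move: a0; rewrite /enorm big1 ?sqrtr0 ?ltxx //.
  by move=> i _; case: no; exists i.
pose g := enorm a ^+ 2 - s * enorm a.
have g0 : 0 < g by rewrite /g expr2 -mulrBl mulr_gt0 // subr_gt0.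
have as0 : 0 < enorm a + s by rewrite ltr_wpDr.
pose t := g / 4 / (enorm a + s).
have t0 : 0 < t by rewrite !divr_gt0.
have tg : t * (enorm a + s) <= g / 4 by rewrite /t mulfVK // gt_eqF.
pose de := Num.min (g / 4) (t * eps / 2).
have de0 : 0 < de by rewrite lt_min !divr_gt0 // mulr_gt0.
have deg : de <= g / 4 by rewrite ge_min lexx.
have dee : de <= t * eps / 2 by rewrite ge_min lexx orbT.
pose f u j x := tent (peval (tilted a u j) a) de (peval (tilted a u j) x).
have f01 u j x : 0 <= f u j x <= 1 by rewrite tent_ge0 tent_le1.
exists (fun x => f 0 i0 x * \prod_(j < n) f t j x); split.
- have U0 : approximable (fun x => rcplx (f 0 i0 x)).
    by apply: approximable_tilted => //; rewrite mul0r divr_ge0 // ltW.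
  have U1 : approximable (fun x => \prod_(j < n) (rcplx (f t j x) : C)).
    apply: (@approximable_prod _ _ _ cX _ (index_enum 'I_n) xpredT
      (fun j x => rcplx (f t j x))) => j _.
    by apply: approximable_tilted => //; exact: ltW.
  apply: approximable_ext (approximable_mul cX U0 U1) => x _; rewrite rcplxM;
    congr (_ * _).
  by elim/big_rec2 : _ => // j y z _ ->; rewrite rcplxM.
- move=> x; have /andP[p0 p1] := f01 0 i0 x.
  have q0 : 0 <= \prod_(j < n) f t j x.
    by apply: prodr_ge0 => j _; have /andP[] := f01 t j x.
  have q1 : \prod_(j < n) f t j x <= 1.
    by apply: prodr_ile1 => j _; exact: f01.
  by rewrite mulr_ge0 //= mulr_ile1.
- have K0 : 0 < 2 * (enorm a + t) by rewrite mulr_gt0 // addr_gt0.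
  exists (de / (2 * (enorm a + t))); first by rewrite divr_gt0.
  move=> x; rewrite ltr_pdivlMr // => xa.
  have one u j : 0 <= u -> u <= t -> f u j x = 1.
    move=> u0 ut; apply: tent_one => //; rewrite peval_tiltedB.
    apply: le_trans (tilted_le a j (x - a) u0) _.
    have : (enorm a + u) * enorm (x - a) <= (enorm a + t) * enorm (x - a).
      by rewrite ler_wpM2r ?enorm_ge0 // lerD2l.
    by lra.
  by rewrite one ?(ltW t0) // mul1r big1 // => j _; rewrite one // ltW.
- move=> x; rewrite mulf_eq0 negb_or => /andP[/(tent_supp de0) h0 hp] i.
  have /(tent_supp de0) hi : f t i x != 0.
    by apply: contraNneq hp => fi0; rewrite (bigD1 i) //= fi0 mul0r.
  rewrite -(ltr_pM2l t0).
  have -> : t * modulus ((x - a) 0 i) = modulus (peval (tilted a t i) (x - a) -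
      peval (tilted a 0 i0) (x - a)).
    rewrite tilted_sub.
    by rewrite modulusM modulus_rcplx ger0_norm // ltW.
  rewrite peval_tiltedB in h0; rewrite peval_tiltedB in hi.
  apply: le_lt_trans (modulusB _ _) _; apply: lt_le_trans (ltrD hi h0) _.
  by rewrite [leRHS](splitr (t * eps)) lerD.
Qed.

(** The set where [h] is not small is compact and avoids the ball, so finitely
    many bumps [b] cover it.  The recursion [g |-> b * h a + (1 - b) * g] sums
    [h a] against the partition of unity made from these bumps, without any
    division. *)
Lemma approximable_vanishing (h : Cn -> C) : {within X, continuous h} ->
  (forall x, X x -> enorm x <= s -> h x = 0) -> approximable h.
Proof.
move=> ch h0; apply: approximable_closed => e e0.
have e4 : 0 < e / 4 by rewrite divr_gt0.
pose H := X `&` [set x | e / 4 <= modulus (h x)].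
have HX : H `<=` X by move=> x [].
have Hs x : H x -> s < enorm x.
  move=> [Xx /= hx]; rewrite ltNge; apply/negP => /(h0 x Xx) hx0.
  by move: hx; rewrite hx0 modulus0; lra.
have cH : compact H.
  have cm : {within X, continuous (fun x => modulus (h x))}.
    move=> x; apply: (@cvg_modulus R (subspace X) (nbhs x) _ h); exact: ch.
  have clX : closed X by apply: compact_closed => //; exact: norm_hausdorff.
  have clm : closed ([set x | e / 4 <= modulus (h x)] : set (subspace X)).
    have /continuous_closedP cm' := cm.
    exact: (cm' [set t | e / 4 <= t] (@closed_ge _ _)).
  have /closed_subspaceP[V clV VE] := clm.
  apply: (@subclosed_compact _ H X) => //.
  by rewrite /H setIC -VE; exact: closedI.
have /choice[b bP] (a : Cn) : exists b : Cn -> R, H a ->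
   [/\ approximable (fun x => rcplx (b x)), forall x, 0 <= b x <= 1,
    exists2 rho : R, 0 < rho & forall x, enorm (x - a) < rho -> b x = 1 &
    forall x, X x -> b x != 0 -> modulus (h x - h a) <= e / 4].
  have [Ha|nHa] := pselect (H a); last by exists (fun=> 0).
  have Xa := HX a Ha.
  have [eps eps0 epsP] : exists2 eps : R, 0 < eps &
      forall x, (forall i, modulus ((x - a) 0 i) < eps) -> X x ->
        modulus (h x - h a) <= e / 4.
    apply: nbhs_coord; have /subspace_continuousP/(_ a Xa) := ch.
    move=> /cvg_modulusP/(_ _ e4) hnear.
    have nb : nbhs a [set x | X x -> modulus (h x - h a) < e / 4] by exact: hnear.
    by apply: filterS nb => x hx Xx; exact: ltW (hx Xx).
  have [b [b1 b2 b3 b4]] := point_bump (Hs a Ha) eps0.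
  by exists b; split=> // x Xx bx; exact: epsP (b4 x bx) Xx.
have /choice[rho rhoP] (a : Cn) : exists rho : R, H a ->
    0 < rho /\ forall x, enorm (x - a) < rho -> b a x = 1.
  have [Ha|nHa] := pselect (H a); last by exists 0.
  by have [_ _ [rho ? ?] _] := bP a Ha; exists rho.
have := cH; rewrite compact_cover.
move=> /(_ Cn H (fun a => [set x | enorm (x - a) < rho a]) (fun a _ =>
  @open_eball _ _ _ _)).
case=> [x Hx|D DH HD].
  by exists x => //=; rewrite subrr enorm0; have [] := rhoP x Hx.
pose G (l : seq Cn) x : C :=
  foldr (fun a g => rcplx (b a x) * h a + (1 - rcplx (b a x)) * g) 0 l.
pose Q (l : seq Cn) x : R := foldr (fun a q => (1 - b a x) * q) 1 l.
have UG l : (forall a, a \in l -> H a) -> approximable (G l).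
  elim: l => [|a l IH] lH; first exact: approximable_cst.
  have [Ub _ _ _] := bP a (lH a (mem_head _ _)).
  have UGl : approximable (G l) by apply: IH => a' a'l; apply: lH; rewrite inE a'l orbT.
  have U1 : approximable (fun x => 1 - rcplx (b a x)).
    apply: approximable_ext (approximable_add (approximable_cst X 1)
      (approximable_mul cX (approximable_cst X (-1)) Ub)) => x _.
    by rewrite mulN1r.
  exact: approximable_add (approximable_mul cX Ub (approximable_cst X (h a)))
    (approximable_mul cX U1 UGl).
have Q01 l x : (forall a, a \in l -> H a) -> 0 <= Q l x <= 1.
  elim: l => [|a l IH] lH /=; first by rewrite ler01 lexx.
  have /andP[q0 q1] : 0 <= Q l x <= 1.
    by apply: IH => a' a'l; apply: lH; rewrite inE a'l orbT.
  have [_ /(_ x)/andP[b0 b1] _ _] := bP a (lH a (mem_head _ _)).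
  by rewrite mulr_ge0 ?subr_ge0 //= mulr_ile1 ?subr_ge0 // gerBl.
have err l x : (forall a, a \in l -> H a) -> X x ->
    modulus (h x * rcplx (1 - Q l x) - G l x) <= (1 - Q l x) * (e / 4).
  move=> + Xx; elim: l => [|a l IH] lH.
    by rewrite /= subrr rcplx0 mulr0 subr0 modulus0 mul0r.
  have {}IH := IH (fun a' a'l => lH a' (mem_behead (s := a :: l) a'l)).
  have [_ /(_ x)/andP[b0 b1] _ /(_ x Xx) bh] := bP a (lH a (mem_head _ _)).
  have -> : h x * rcplx (1 - Q (a :: l) x) - G (a :: l) x =
     rcplx (b a x) * (h x - h a) + (1 - rcplx (b a x)) * (h x * rcplx (1 - Q l x) - G
       l x).
    by rewrite /= !rcplxB rcplxM rcplxB rcplx1; ring.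
  apply: le_trans (modulusD _ _) _; rewrite !modulusM.
  have -> : 1 - rcplx (b a x) = rcplx (1 - b a x) :> C by rewrite rcplxB rcplx1.
  rewrite !modulus_rcplx !ger0_norm ?subr_ge0 //.
  have h1 : b a x * modulus (h x - h a) <= b a x * (e / 4).
    have [->|bn] := eqVneq (b a x) 0; first by rewrite !mul0r.
    by rewrite ler_wpM2l // bh.
  have h2 : (1 - b a x) * modulus (h x * rcplx (1 - Q l x) - G l x) <=
     (1 - b a x) * ((1 - Q l x) * (e / 4)) by rewrite ler_wpM2l // subr_ge0.
  by apply: le_trans (lerD h1 h2) _; rewrite le_eqVlt; apply/orP; left; apply/eqP;
    rewrite /=; ring.
have DH' a : a \in enum_fset D -> H a by move=> aD; have := DH a aD; rewrite inE.
exists (G (enum_fset D)); first exact: UG.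
move=> x Xx; have errx := err (enum_fset D) x DH' Xx.
have /andP[q0 q1] := Q01 (enum_fset D) x DH'.
have [Hx|nHx] := pselect (H x).
  have Q0 : Q (enum_fset D) x = 0.
    have [a aD xa] := HD x Hx; have [_ /(_ x xa) ba] := rhoP a (DH' a aD).
    have {}aD : a \in enum_fset D by exact: aD.
    move: (enum_fset D) aD ba; elim=> //= a' l IH.
    rewrite inE => /predU1P[<- ->|/IH H1 /H1 ->]; first by rewrite subrr mul0r.
    by rewrite mulr0.
  by move: errx; rewrite Q0 subr0 rcplx1 mulr1 mul1r; lra.
have hx : modulus (h x) < e / 4 by rewrite ltNge; apply/negP => hx; apply: nHx.
have -> : h x - G (enum_fset D) x =
  (h x * rcplx (1 - Q (enum_fset D) x) - G (enum_fset D) x) + h x * rcplx (Q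
    (enum_fset D) x).
  by rewrite rcplxB rcplx1; ring.
apply: le_trans (modulusD _ _) _; rewrite modulusM modulus_rcplx ger0_norm //.
move: (Q _ _) (modulus (h x)) (modulus _) q0 q1 hx errx (modulus_ge0 (h x)) =>
  q m m' q0 q1 hx errx m0.
nra.
Qed.

End LocalBump.

(** * Polynomial hulls and extension of an approximation *)

Section Hulls.
Variables (R : realType) (n : nat).
Local Notation C := (Cplx R).
Local Notation Cn := (Cspace R n).
Local Notation P := (mpoly.mpoly n C).
Implicit Types K : set Cn.

Lemma sub_polynomial_hull K : compact K -> K `<=` polynomial_hull K.
Proof. by move=> cK z Kz p; exact: le_sup_norm. Qed.

Lemma polynomial_hull_neq0 K z : polynomial_hull K z -> K !=set0.
Proof.
move=> Kz; apply/set0P/eqP => K0; have := Kz 1.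
by rewrite K0 image_set0 sup0 peval1 modulus1 ler10.
Qed.

Lemma polynomial_hull_idem K : compact K ->
  polynomial_hull (polynomial_hull K) `<=` polynomial_hull K.
Proof.
move=> cK z hz p; apply: le_trans (hz p) _.
have [w hw] := polynomial_hull_neq0 hz.
apply: ge_sup; first by exists (modulus (peval p w)), w.
by move=> _ [y hy <-]; exact: hy.
Qed.

Lemma compact_polynomial_hull K : compact K -> compact (polynomial_hull K).
Proof.
move=> cK.
pose c (p : P) := sup [set modulus (peval p w) | w in K].
have -> : polynomial_hull K = \bigcap_(p in [set: P]) [set z | modulus (peval p z) <=
  c p].
  by apply/seteqP; split => [z hz p _|z hz p]; [exact: hz|exact: (hz p Logic.I)].
pose s := \sum_(i < n) c (mpoly.mpolyX C (mpoly.mnm1 i)).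
refine (subclosed_compact _ (@compact_cball R n s) _).
  apply: closed_bigI => p _.
  have cm : continuous (fun z : Cn => modulus (peval p z)).
    by move=> w; apply: (@cvg_modulus R Cn (nbhs w) _ (peval p));
      exact: peval_continuous.
  have /continuous_closedP cl := cm.
  exact: (cl [set t | t <= c p] (@closed_le _ _)).
move=> z hz; apply: le_trans (enorm_le_sum z) _; apply: ler_sum => i _.
by have := hz (mpoly.mpolyX C (mpoly.mnm1 i)) Logic.I; rewrite /= pevalXU.
Qed.

End Hulls.

Section Step.
Variables (R : realType) (n : nat) (Gamma : set (Cspace R n)).
Local Notation C := (Cplx R).
Local Notation Cn := (Cspace R n).
Local Notation P := (mpoly.mpoly n C).
Hypothesis clG : closed Gamma.
Hypothesis area0 : area Gamma = 0%E.
Variables (f : Cn -> C) (tol : Cn -> R).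
Hypothesis f_cont : {within Gamma, continuous f}.
Hypothesis tol_cont : {within Gamma, continuous tol}.
Hypothesis tol_gt0 : forall z, Gamma z -> 0 < tol z.

Lemma compact_Gamma_ball s : compact (Gamma `&` @cball R n s).
Proof. by rewrite setIC; apply: compact_closedI => //; exact: compact_cball. Qed.

Lemma tol_lower s : exists2 mu : R, 0 < mu &
  forall z, Gamma z -> enorm z <= s -> mu <= tol z.
Proof.
have [K0|K0] := pselect ((Gamma `&` @cball R n s) !=set0); last first.
  by exists 1 => // z Gz zs; case: K0; exists z.
have [|z zK zmin] := compact_EVT_min K0 (@compact_Gamma_ball s) (f := tol).
  by apply: continuous_subspaceW tol_cont => z [].
move: zK; rewrite inE => -[Gz _]; exists (tol z); first exact: tol_gt0.
by move=> w Gw ws; apply: zmin; rewrite inE.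
Qed.

(** Soft thresholding: the modulus of [w] is lowered by [t], down to 0.  The
    maximum in the denominator makes continuity at [w = 0] evident. *)
Definition shrink (w : C) (t : R) : C := w * rcplx (1 - t / Num.max (modulus w) t).

Lemma shrink_dist w t : 0 < t -> modulus (w - shrink w t) <= t.
Proof.
move=> t0; set d := Num.max (modulus w) t.
have d0 : 0 < d by rewrite lt_max t0 orbT.
have -> : w - shrink w t = w * rcplx (t / d).
  by rewrite /shrink -/d rcplxB rcplx1; ring.
have td0 : 0 <= t / d by rewrite divr_ge0 // ltW.
rewrite modulusM modulus_rcplx ger0_norm // mulrA ler_pdivrMr //.
by rewrite [leRHS]mulrC ler_wpM2r ?(ltW t0) // le_max lexx.
Qed.

Lemma shrink_small w t : 0 < t -> modulus w <= t -> shrink w t = 0.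
Proof.
move=> t0 weight; rewrite /shrink (max_idPr weight) divff ?gt_eqF // subrr.
exact: mulr0.
Qed.

Lemma shrink_continuous (w : Cn -> C) (t : Cn -> R) :
  {within Gamma, continuous w} -> {within Gamma, continuous t} ->
  (forall z, Gamma z -> 0 < t z) ->
  forall x, Gamma x -> shrink (w z) (t z) @[z --> within Gamma (nbhs x)] --> shrink
    (w x) (t x).
Proof.
move=> /subspace_continuousP wc /subspace_continuousP tc t0 x Gx.
have FF : Filter (within Gamma (nbhs x)) by exact: within_filter.
have cw := wc x Gx; have ct := tc x Gx.
have cm := cvg_modulus FF cw.
have cd : Num.max (modulus (w z)) (t z) @[z --> within Gamma (nbhs x)] -->
    Num.max (modulus (w x)) (t x).
  rewrite maxr_absE; under eq_fun do rewrite maxr_absE.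
  apply: cvgMl; apply: cvgD; first exact: cvgD.
  by apply: cvg_norm; exact: cvgB.
have d0 : Num.max (modulus (w x)) (t x) != 0 by rewrite gt_eqF // lt_max t0 ?orbT.
have cr : 1 - t z / Num.max (modulus (w z)) (t z) @[z --> within Gamma (nbhs x)] -->
    1 - t x / Num.max (modulus (w x)) (t x).
  apply: cvgB; first exact: cvg_cst.
  exact: cvgM ct (cvgV d0 cd).
exact: cvgM cw (cvg_rcplx FF cr).
Qed.

(** One step of the induction.  The error [f - p] is below the tolerance on
    the ball of radius [s], so its thresholded version vanishes there.  Extended
    by 0, it is continuous on the hull of [E] and a larger part of [Gamma],
    because this hull leaves [Gamma] only inside that ball; hence it can be
    approximated there. *)
Lemma extend_approximation (E : set Cn) (s s' c c' eta : R) (p : P) :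
  compact E -> 0 <= s ->
  (forall z, hull (E `|` Gamma) z -> ~ Gamma z -> enorm z < s) ->
  0 < c -> c < c' -> 0 < eta ->
  (forall z, Gamma z -> enorm z <= s -> modulus (f z - peval p z) <= c * tol z) ->
  exists q : P,
    (forall z, E z -> enorm z <= s -> modulus (peval q z - peval p z) <= eta) /\
    (forall z, Gamma z -> enorm z <= s' -> modulus (f z - peval q z) <= c' * tol z).
Proof.
move=> cE s0 hullE c0 cc' eta0 fp.
pose K := E `|` (Gamma `&` @cball R n s').
have cK : compact K by exact: compactU cE (@compact_Gamma_ball s').
pose X := polynomial_hull K.
have cX : compact X by exact: compact_polynomial_hull.
have KX : K `<=` X by exact: sub_polynomial_hull.
have XG z : X z -> s < enorm z -> Gamma z.
  move=> Xz; apply: contraPP => nGz; apply/negP; rewrite -leNgt ltW //.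
  apply: hullE => //; exists K => //; split=> // w [Ew|[Gw _]]; first by left.
  by right.
pose w z := f z - peval p z.
pose t z := c * tol z.
have t0 z : Gamma z -> 0 < t z by move=> /tol_gt0; exact: mulr_gt0.
pose h z := if pselect (Gamma z) then shrink (w z) (t z) else 0.
have h0 z : enorm z <= s -> h z = 0.
  move=> zs; rewrite /h; case: pselect => // Gz.
  by rewrite shrink_small ?t0 // fp.
have hG z : Gamma z -> h z = shrink (w z) (t z) by rewrite /h; case: pselect.
have wc : {within Gamma, continuous w}.
  move=> x; apply: (@cvgB _ C (subspace Gamma) (nbhs x) _ f (peval p)).
    exact: f_cont.
  exact: (continuous_subspaceT (@peval_continuous R n p)).
have tc : {within Gamma, continuous t}.
  by move=> x; apply: (@cvgMr R (subspace Gamma) (nbhs x)); exact: tol_cont.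
have hc : {within X, continuous h}.
  apply/subspace_continuousP => x Xx; apply/cvg_modulusP => e e0.
  suff nbh : nbhs x [set y | X y -> modulus (h y - h x) < e] by exact: nbh.
  have [xs|xs] := ltP (enorm x) s.
    have nb : nbhs x [set y : Cn | enorm y < s].
      apply: (@open_nbhs_nbhs _ x); split=> //.
      have /continuousP op := @enorm_continuous R n.
      exact: (op [set v | v < s] (@open_lt _ _)).
    rewrite (h0 x (ltW xs)); apply: filterS nb => y ys _.
    by rewrite (h0 y (ltW ys)) subrr modulus0.
  have Gx : Gamma x.
    apply: contrapT => nGx; have := hullE x; rewrite ltNge xs => H.
    have : false by apply: H => //; exists K => //; split=> // y [Ey|[Gy _]];
      [left|right].
    by [].
  have := shrink_continuous wc tc t0 Gx; move=> /cvg_modulusP/(_ e e0) hnear.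
  have nbG : nbhs x [set y | Gamma y ->
      modulus (shrink (w y) (t y) - shrink (w x) (t x)) < e] by exact: hnear.
  have [xs'|xs'] := leP (enorm x) s.
    apply: filterS nbG => y hy Xy; have [Gy|nGy] := pselect (Gamma y).
      by rewrite (hG y Gy) (hG x Gx); exact: hy.
    have hy0 : h y = 0 by rewrite /h; case: pselect.
    by rewrite (h0 x xs') hy0 subrr modulus0.
  have nb : nbhs x [set y : Cn | s < enorm y].
    apply: (@open_nbhs_nbhs _ x); split=> //.
    have /continuousP op := @enorm_continuous R n.
    exact: (op [set v | s < v] (@open_gt _ _)).
  apply: filterS2 nb nbG => y ys hy Xy.
  have Gy := XG y Xy ys.
  by rewrite (hG y Gy) (hG x Gx); exact: hy.
have Uh := approximable_vanishing cX (polynomial_hull_idem cK) clG area0 XG s0 hc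
  (fun x _ => h0 x).
have [mu mu0 muP] := tol_lower s'.
pose e := Num.min eta ((c' - c) * mu).
have e0 : 0 < e by rewrite lt_min eta0 mulr_gt0 // subr_gt0.
have [q qP] := Uh e e0.
exists (p + q); split=> z.
  move=> Ez zs; rewrite pevalD addrAC subrr add0r.
  have := qP z (KX z (or_introl Ez)); rewrite (h0 z zs) sub0r modulusN.
  by rewrite lt_min => /andP[/ltW].
move=> Gz zs'.
have := qP z (KX z (or_intror (conj Gz zs'))); rewrite (hG z Gz) lt_min => /andP[_ h2].
have := shrink_dist (w z) (t0 z Gz) => h1.
have h3 := ler_wpM2l (_ : 0 <= c' - c) (muP z Gz zs').
rewrite pevalD (_ : f z - _ =
  (w z - shrink (w z) (t z)) + (shrink (w z) (t z) - peval q z)); last first.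
  by rewrite /w; ring.
apply: le_trans (modulusD _ _) _; apply: le_trans (lerD h1 (ltW h2)) _.
by have := h3 (ltac:(rewrite subr_ge0; exact: ltW)); rewrite /t; lra.
Qed.

End Step.

(** * Cauchy estimates and Taylor bounds *)

Section CauchyEstimate.
Variable R : realType.
Local Notation C := (Cplx R).

Lemma prim_root_exists (K : numClosedFieldType) (N : nat) : (0 < N)%N ->
  exists w : K, N.-primitive_root w.
Proof.
pose p : {poly K} := 'X^N - 1; have [s Dp] := closed_field_poly_normal p.
move=> N0; rewrite (monicP _) ?monicXnsubC // scale1r in Dp.
have sN1 : all N.-unity_root s by apply/allP => z; rewrite -root_prod_XsubC -Dp.
have sizes : (N < (size s).+1)%N.
  by rewrite -(size_prod_XsubC s id) -Dp size_XnsubC.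
have [|z] := hasP (has_prim_root N0 sN1 _ sizes); last by exists z.
by rewrite -separable_prod_XsubC -Dp separable_Xn_sub_1 // pnatr_eq0 -lt0n.
Qed.

(** Averaging over roots of unity recovers a coefficient from values on the
    unit circle. *)
Lemma poly_coef_bound (q : {poly C}) (B : R) (k : nat) :
  (forall t : C, modulus t <= 1 -> modulus q.[t] <= B) -> modulus q`_k <= B.
Proof.
move=> qB; pose N := (size q + k).+1.
have N0 : N%:R != 0 :> C by rewrite pnatr_eq0.
have [w wN] := prim_root_exists C (ltn0Sn (size q + k)); rewrite -/N in wN.
have w1 : modulus w = 1.
  have h : modulus w ^+ N = 1 by rewrite -modulusX (prim_expr_order wN) modulus1.
  by apply/eqP; rewrite -(@pexpr_eq1 _ _ N) ?modulus_ge0 // h.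
have w0 : w != 0 by rewrite -modulus_eq0 w1 oner_eq0.
have orth j : (j < N)%N -> \sum_(l < N) (w ^+ j / w ^+ k) ^+ l = (j == k)%:R * N%:R.
  move=> jN; have kN : (k < N)%N by rewrite /N ltnS leq_addl.
  have [->|jk] := eqVneq j k.
    rewrite divff ?expf_neq0 // (eq_bigr (fun=> 1)); last by move=> l _; rewrite expr1n.
    by rewrite sumr_const card_ord mul1r.
  have x1 : w ^+ j / w ^+ k != 1.
    rewrite -(inj_eq (mulIf (expf_neq0 k w0))) mulfVK ?expf_neq0 // mul1r.
    by rewrite (eq_prim_root_expr wN) !modn_small.
  rewrite mul0r; apply: (@mulfI _ (w ^+ j / w ^+ k - 1)); first by rewrite subr_eq0.
  rewrite mulr0 -subrX1 expr_div_n -!exprM ![(_ * N)%N]mulnC !exprM.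
  by rewrite (prim_expr_order wN) !expr1n divr1 subrr.
have coefE : q`_k * N%:R = \sum_(l < N) q.[w ^+ l] / w ^+ k ^+ l.
  have qE t : q.[t] = \sum_(j < N) q`_j * t ^+ j.
    by apply: horner_coef_wide; rewrite /N ltnW // ltnS leq_addr.
  transitivity (\sum_(l < N) \sum_(j < N) q`_j * (w ^+ j / w ^+ k) ^+ l).
    have kN : (k < N)%N by rewrite /N ltnS leq_addl.
    rewrite exchange_big /= (bigD1 (Ordinal kN)) //= -mulr_sumr orth // eqxx mul1r.
    rewrite big1 ?addr0 // => j; rewrite -val_eqE /= => jk.
    by rewrite -mulr_sumr orth // (negPf jk) mul0r mulr0.
  apply: eq_bigr => l _; rewrite qE mulr_suml; apply: eq_bigr => j _.
  by rewrite expr_div_n -!exprM [(l * j)%N]mulnC mulrA.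
have : modulus (q`_k * N%:R) <= B * N%:R.
  rewrite coefE; apply: le_trans (modulus_sum _ _ _) _.
  apply: (@le_trans _ _ (\sum_(l < N) B));
    last by rewrite sumr_const card_ord mulr_natr.
  apply: ler_sum => l _; rewrite modulusM modulusV !modulusX w1 !expr1n invr1 mulr1.
  by apply: qB; rewrite modulusX w1 expr1n.
rewrite modulusM (_ : modulus (N%:R : C) = N%:R) ?ler_pM2r ?ltr0n //.
have -> : N%:R = rcplx N%:R :> C by rewrite /rcplx /cplx -[LHS](rmorph_nat
  (real_complex R)).
by rewrite modulus_rcplx normr_nat.
Qed.

Lemma poly_remainder_bound (q : {poly C}) (B m : R) :
  (forall t : C, modulus t <= 1 -> modulus q.[t] <= B) -> 0 <= m -> m <= 2^-1 ->
  modulus (q.[rcplx m] - q`_0 - q`_1 * rcplx m) <= 2 * B * m ^+ 2.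
Proof.
move=> qB m0 m1.
have B0 : 0 <= B by apply: le_trans (modulus_ge0 _) (qB 0 _); rewrite modulus0.
rewrite (horner_coef_wide _ (leq_addl 2 (size q))) big_split_ord /=.
rewrite !big_ord_recl big_ord0 /= expr0 expr1 mulr1 addr0.
rewrite (_ : _ - _ - _ = \sum_(i < size q) q`_(2 + i) * rcplx m ^+ (2 + i));
  last by ring.
apply: le_trans (modulus_sum _ _ _) _.
have geo (N : nat) : \sum_(i < N) (2^-1 : R) ^+ i <= 2.
  suff -> : \sum_(i < N) (2^-1 : R) ^+ i = 2 - 2 * 2^-1 ^+ N.
    by rewrite gerBl mulr_ge0 // exprn_ge0 // invr_ge0.
  elim: N => [|N IH]; first by rewrite big_ord0 expr0; ring.
  by rewrite big_ord_recr /= IH exprS; field.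
apply: (@le_trans _ _ (\sum_(i < size q) B * m ^+ 2 * 2^-1 ^+ i)).
  apply: ler_sum => i _;
    rewrite modulusM modulusX modulus_rcplx ger0_norm // exprD mulrA.
  rewrite ler_pM ?mulr_ge0 ?modulus_ge0 ?exprn_ge0 //.
    by rewrite ler_wpM2r ?exprn_ge0 // poly_coef_bound.
  by rewrite lerXn2r ?nnegrE ?invr_ge0.
rewrite -mulr_sumr.
have c0 : 0 <= B * m ^+ 2 by rewrite mulr_ge0 // exprn_ge0.
have := ler_wpM2l c0 (geo (size q)); lra.
Qed.

End CauchyEstimate.

Section Taylor.
Variables (R : realType) (n : nat).
Local Notation C := (Cplx R).
Local Notation Cn := (Cspace R n).
Local Notation P := (mpoly.mpoly n C).

Definition grad (p : P) (z : Cn) (i : 'I_n) : C := peval (mpoly.mderiv i p) z.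

(** Restriction to complex lines reduces estimates to one variable. *)
Lemma line_restriction (p : P) (z v : Cn) : exists q : {poly C},
  [/\ forall t, q.[t] = peval p (z + t *: v), q`_0 = peval p z &
      q`_1 = \sum_(i < n) grad p z i * v 0 i].
Proof.
elim/mpoly_ind: p => [c|j|p p' [q [q1 q2 q3]] [q' [q1' q2' q3']]|p p' [q [q1 q2 q3]]
  [q' [q1' q2' q3']]].
- exists c%:P; split.
  + by move=> t; rewrite hornerC peval_cst.
  + by rewrite coefC eqxx peval_cst.
  + rewrite coefC /= big1 // => i _.
    by rewrite /grad mpoly.mderivC peval0 mul0r.
- exists ((z 0 j)%:P + (v 0 j)%:P * 'X); split.
  + by move=> t; rewrite !hornerE pevalXU !mxE mulrC.
  + by rewrite coefD coefC coefMX /= addr0 pevalXU.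
  + rewrite coefD coefC coefMX coefC /= add0r (bigD1 j) //= big1 ?addr0.
      rewrite /grad mpoly.mderivX mpoly.mnm1E eqxx scale1r.
      have -> : mpoly.mnm_sub (mpoly.mnm1 j) (mpoly.mnm1 j) = mpoly.mnm0.
        by apply/mpoly.mnmP => k; rewrite mpoly.mnmBE mpoly.mnm0E subnn.
      by rewrite mpoly.mpolyX0 peval1 mul1r.
    move=> i ij; rewrite /grad mpoly.mderivX mpoly.mnm1E eq_sym (negPf ij) scale0r.
    by rewrite peval0 mul0r.
- exists (q + q'); split.
  + by move=> t; rewrite hornerD q1 q1' pevalD.
  + by rewrite coefD q2 q2' pevalD.
  + rewrite coefD q3 q3' -big_split /=; apply: eq_bigr => i _.
    by rewrite /grad mpoly.mderivD pevalD mulrDl.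
- exists (q * q'); split.
  + by move=> t; rewrite hornerM q1 q1' pevalM.
  + by rewrite coefM big_ord1 /= q2 q2' pevalM.
  + rewrite coefM !big_ord_recl big_ord0 /= /bump /= addr0 subn0 q2 q2' q3 q3'.
    rewrite mulr_sumr mulr_suml -big_split /=; apply: eq_bigr => i _.
    by rewrite /grad mpoly.mderivM pevalD !pevalM; ring.
Qed.

Section Bounds.
Variables (p : P) (z : Cn) (B : R).
Hypothesis pB : forall x : Cn, (forall i, modulus ((x - z) 0 i) <= 1) ->
  modulus (peval p x) <= B.

Lemma grad_bound i : modulus (grad p z i) <= B.
Proof.
pose v : Cn := \row_j (i == j)%:R.
have [q [q1 _ q3]] := line_restriction p z v.
have -> : grad p z i = q`_1.
  rewrite q3 (bigD1 i) //= mxE eqxx mulr1 big1 ?addr0 // => j ij.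
  by rewrite mxE eq_sym (negPf ij) mulr0.
apply: poly_coef_bound => t t1; rewrite q1; apply: pB => j.
rewrite addrC addKr !mxE modulusM.
by case: (i == j); rewrite ?modulus1 ?mulr1 ?modulus0 ?mulr0.
Qed.

Lemma taylor_bound (v : Cn) (m : R) : 0 < m -> m <= 2^-1 ->
  (forall i, modulus (v 0 i) <= m) ->
  modulus (peval p (z + v) - peval p z - \sum_(i < n) grad p z i * v 0 i) <=
    2 * B * m ^+ 2.
Proof.
move=> m0 m1 vm.
have mn : (rcplx m : C) != 0 by rewrite -modulus_eq0 modulus_rcplx normr_eq0 gt_eqF.
pose u : Cn := (rcplx m : C)^-1 *: v.
have [q [q1 q2 q3]] := line_restriction p z u.
have -> : peval p (z + v) = q.[rcplx m].
  by rewrite q1 /u scalerA divff // scale1r.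
have -> : \sum_(i < n) grad p z i * v 0 i = q`_1 * rcplx m.
  rewrite q3 mulr_suml; apply: eq_bigr => i _.
  by rewrite /u mxE -mulrA mulrAC mulVf // mul1r.
rewrite -q2; apply: poly_remainder_bound => //; last exact: ltW.
move=> t t1; rewrite q1; apply: pB => j.
rewrite addrC addKr !mxE !modulusM modulusV modulus_rcplx ger0_norm ?(ltW m0) //.
rewrite mulr_ile1 ?modulus_ge0 ?mulr_ge0 ?modulus_ge0 ?invr_ge0 ?(ltW m0) //.
by rewrite mulrC ler_pdivrMr // mul1r.
Qed.

End Bounds.

Definition linear_form (lam : 'I_n -> C) (v : Cn) : C := \sum_(i < n) lam i * v 0 i.

Lemma linear_form_is_linear lam : linear (linear_form lam).
Proof.
move=> c u v; rewrite /linear_form /= scaler_sumr -big_split /=; apply: eq_bigr => i _.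
by rewrite !mxE mulrDr mulrCA.
Qed.

HB.instance Definition _ lam := GRing.isLinear.Build C Cn C _ (linear_form lam)
  (linear_form_is_linear lam).

Lemma linear_form_continuous lam : continuous (linear_form lam).
Proof.
have -> : linear_form lam = peval (\sum_(i < n) lam i *: mpoly.mpolyX C (mpoly.mnm1 i)).
  apply/funext => v; rewrite peval_sum; apply: eq_bigr => i _.
  by rewrite pevalZ pevalXU.
exact: peval_continuous.
Qed.

Lemma differentiable_quadratic (F : Cn -> C) (z : Cn) (lam : 'I_n -> C) (K : R) :
  (forall (v : Cn) (m : R), 0 < m -> m <= 2^-1 -> (forall i, modulus (v 0 i) <= m) ->
     modulus (F (z + v) - F z - linear_form lam v) <= K * m ^+ 2) ->
  differentiable F z.
Proof.
move=> FK.
have FE : F \o shift z = cst (F z) + linear_form lam +o_ 0 id.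
  apply/eqaddoP => eps eps0.
  have [e [epsE e0]] : exists e : R, eps = rcplx e /\ 0 < e.
    by exists (complex.Re eps); exact: pos_rcplx.
  subst eps.
  pose d := Num.min 2^-1 (e / (`|K| + 1)).
  have K1 : 0 < `|K| + 1 by rewrite ltr_wpDl.
  have d0 : 0 < d by rewrite lt_min invr_gt0 ltr0n /= divr_gt0.
  have d0' : 0 < rcplx d :> C by rewrite -rcplx0 rcplx_lt.
  have nb : \forall v \near (0 : Cn), `|v| < rcplx d by exact: (@nbhs0_lt _ Cn _ d0').
  apply: (filterS _ nb) => v vd.
  have vE : `|v| = rcplx (modulus `|v|) by rewrite -normE normr_id.
  set m := modulus _ in vE; have m0 : 0 <= m by exact: modulus_ge0.
  rewrite vE rcplx_lt in vd.
  rewrite /= [leLHS]normE vE -rcplxM rcplx_le.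
  have -> : (F \o shift z - (cst (F z) + linear_form lam)) v =
      F (z + v) - F z - linear_form lam v.
    by rewrite /= -[LHS]/(F (v + z) - (F z + linear_form lam v)) opprD addrA [v +
      z]addrC.
  have [m00|mpos] := leP m 0.
    have v0 : v = 0.
      by apply/eqP; rewrite -normr_eq0 vE (_ : m = 0) //; apply/eqP; rewrite eq_le m00.
    rewrite v0 addr0 subrr linear0 subr0 modulus0 mulr_ge0 // ltW //.
  have md : m <= 2^-1 by apply: le_trans (ltW vd) _; rewrite ge_min lexx.
  have mK : m * (`|K| + 1) <= e.
    by rewrite -ler_pdivlMr //; apply: le_trans (ltW vd) _; rewrite ge_min lexx orbT.
  have vm i : modulus (v 0 i) <= m by rewrite -norm_le -vE; exact: coord_le_norm.
  apply: le_trans (FK v m mpos md vm) _.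
  rewrite expr2 mulrA ler_wpM2r //.
  apply: le_trans mK; rewrite mulrC ler_wpM2l //.
  by apply: le_trans (ler_norm K) _; rewrite lerDl.
have dE := diff_unique (@linear_form_continuous lam) FE.
apply/diff_locallyP; rewrite dE; split=> //; exact: linear_form_continuous.
Qed.

End Taylor.

(** * Limits of polynomials are entire *)

Section DyadicLimits.
Variable R : realType.
Local Notation C := (Cplx R).
Local Notation half_pow k := ((2^-1 : R) ^+ k).

Lemma half_pow_ge0 k : 0 <= half_pow k. Proof. by rewrite exprn_ge0 // invr_ge0. Qed.

Lemma half_pow_le1 k : half_pow k <= 1.
Proof. by rewrite exprn_ile1 // ?invr_ge0 // invf_le1 // ler1n. Qed.

Lemma half_pow_small (d : R) (k0 : nat) : 0 < d ->
  exists2 k, (k0 <= k)%N & half_pow k <= d.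
Proof.
move=> d0; pose k := (k0 + (Num.truncn d^-1).+1)%N.
exists k; first exact: leq_addr.
rewrite exprVn -[d]invrK lef_pV2 ?posrE ?invr_gt0 ?exprn_gt0 //.
apply: le_trans (ltW (truncnS_gt _)) _; rewrite -natrX ler_nat.
apply: leq_trans (_ : (k <= _)%N); first exact: leq_addl.
exact/ltnW/ltn_expl.
Qed.

(** The sequences [a k - 2 * 2^-k] and [a k + 2 * 2^-k] are monotone and
    enclose the limit; this gives the rate of convergence at once. *)
Lemma dyadic_limit_real (a : nat -> R) (k0 : nat) :
  (forall k, (k0 <= k)%N -> `|a k.+1 - a k| <= half_pow k) ->
  exists l, forall k, (k0 <= k)%N -> `|a k - l| <= 2 * half_pow k.
Proof.
move=> ha; pose lo k := a k - 2 * half_pow k; pose up k := a k + 2 * half_pow k.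
have step k : (k0 <= k)%N -> lo k <= lo k.+1 /\ up k.+1 <= up k.
  move=> /ha; rewrite ler_norml /lo /up exprS => /andP[h1 h2].
  by split; lra.
have mono k j : (k0 <= k)%N -> lo k <= lo (j + k)%N /\ up (j + k)%N <= up k.
  move=> kk; elim: j => [|j [IH1 IH2]]; first by rewrite add0n.
  have [s1 s2] := step (j + k)%N (leq_trans kk (leq_addl _ _)).
  by rewrite addSn; split; [exact: le_trans IH1 s1|exact: le_trans s2 IH2].
have cross i j : (k0 <= i)%N -> (k0 <= j)%N -> lo i <= up j.
  move=> ii jj; have [h1 _] := mono i j ii; have [_ h2] := mono j i jj.
  apply: le_trans h1 _; rewrite addnC; apply: le_trans h2.
  by rewrite /lo /up; have := half_pow_ge0 (i + j); lra.
pose A := [set lo k | k in [set k | (k0 <= k)%N]].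
have A0 : A !=set0 by exists (lo k0), k0 => /=.
exists (sup A) => k kk.
have h1 : lo k <= sup A.
  apply: ub_le_sup; last by exists k.
  by exists (up k) => _ [i /= ii <-]; exact: cross.
have h2 : sup A <= up k.
  by apply: ge_sup => // _ [i /= ii <-]; exact: cross.
by move: h1 h2; rewrite /lo /up ler_norml => h1 h2; apply/andP; split; lra.
Qed.

Lemma dyadic_limit (u : nat -> C) (k0 : nat) :
  (forall k, (k0 <= k)%N -> modulus (u k.+1 - u k) <= half_pow k) ->
  exists l, forall k, (k0 <= k)%N -> modulus (u k - l) <= 4 * half_pow k.
Proof.
move=> hu.
have ReB (x y : C) : complex.Re (x - y) = complex.Re x - complex.Re y.
  by case: x y => [? ?] [? ?].
have ImB (x y : C) : complex.Im (x - y) = complex.Im x - complex.Im y.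
  by case: x y => [? ?] [? ?].
have [a ha] : exists l, forall k, (k0 <= k)%N ->
  `|complex.Re (u k) - l| <= 2 * half_pow k.
  apply: dyadic_limit_real => k kk; rewrite -ReB.
  exact: le_trans (Re_le_modulus _) (hu k kk).
have [b hb] : exists l, forall k, (k0 <= k)%N ->
  `|complex.Im (u k) - l| <= 2 * half_pow k.
  apply: dyadic_limit_real => k kk; rewrite -ImB.
  exact: le_trans (Im_le_modulus _) (hu k kk).
exists (cplx a b) => k kk; apply: le_trans (modulus_le_ReIm _) _.
by rewrite ReB ImB /=; have := ha k kk; have := hb k kk; lra.
Qed.

End DyadicLimits.

Section EntireLimit.
Variables (R : realType) (n : nat).
Local Notation C := (Cplx R).
Local Notation Cn := (Cspace R n).
Local Notation P := (mpoly.mpoly n C).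
Local Notation half_pow k := ((2^-1 : R) ^+ k).

Lemma gradB (p q : P) z i : grad (p - q) z i = grad p z i - grad q z i.
Proof. by rewrite /grad mpoly.mderivB pevalB. Qed.

(** Weierstrass' theorem for rapidly converging polynomials: their Taylor
    bounds at a point are uniform, so they pass to the limit. *)
Theorem entire_limit (p : nat -> P) (t : nat -> R) :
  (forall k, t k <= t k.+1) -> (forall M : R, exists k, M <= t k) ->
  (forall k z, enorm z <= t k ->
    modulus (peval (p k.+1) z - peval (p k) z) <= half_pow k) ->
  exists F : Cn -> C, entire F /\
    forall k z, enorm z <= t k -> modulus (peval (p k) z - F z) <= 4 * half_pow k.
Proof.
move=> tS tinf pS.
have tmono i j : (i <= j)%N -> t i <= t j.
  by move=> ij; rewrite -(subnK ij); elim: (j - i)%N => [|d IH] //;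
    exact: le_trans IH (tS _).
have /choice[F FP] (z : Cn) : exists l : C, forall k, enorm z <= t k ->
    modulus (peval (p k) z - l) <= 4 * half_pow k.
  have ex : exists k, enorm z <= t k by exact: tinf.
  case: (ex_minnP ex) => k0 zk0 kmin.
  have [k kk|l lP] := @dyadic_limit R (fun k => peval (p k) z) k0.
    by apply: pS; apply: le_trans zk0 _; exact: tmono.
  by exists l => k /kmin; exact: lP.
exists F; split; last by move=> k z; exact: FP.
move=> z.
pose M := \sum_(i < n) (modulus (z 0 i) + 1).
have [k0 Mk0] := tinf M.
have near_ball (x : Cn) : (forall i, modulus ((x - z) 0 i) <= 1) -> enorm x <= t k0.
  move=> xz; apply: le_trans Mk0; apply: le_trans (enorm_le_sum _) _.
  apply: ler_sum => i _; have := modulusD (z 0 i) ((x - z) 0 i).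
  by rewrite !mxE [z 0 i + _]addrC subrK; have := xz i; rewrite !mxE; lra.
have zball : enorm z <= t k0.
  by apply: near_ball => i; rewrite subrr mxE modulus0.
have [B0 B0P] := peval_bounded (@compact_cball R n (t k0)) (p k0).
pose B := `|B0| + 8.
have pB k (x : Cn) : (k0 <= k)%N -> (forall i, modulus ((x - z) 0 i) <= 1) ->
    modulus (peval (p k) x) <= B.
  move=> kk /near_ball xb.
  have h0 := FP x k0 xb; have h1 := FP x k (le_trans xb (tmono _ _ kk)).
  have h2 : modulus (peval (p k0) x) <= B0 by apply: B0P; exists x.
  have w1 := half_pow_le1 R k; have w0 := half_pow_le1 R k0; have nB := ler_norm B0.
  rewrite /B; move: (peval (p k) x) (peval (p k0) x) (F x) h0 h1 h2 => a b c h0 h1 h2.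
  have t1 := modulusB (a - c) (b - c); have t2 := modulusD (a - b) b.
  rewrite opprB addrA subrK in t1; rewrite subrK in t2.
  by lra.
have /choice[lam lamP] (i : 'I_n) : exists l : C, forall k, (k0 <= k)%N ->
    modulus (grad (p k) z i - l) <= 4 * half_pow k.
  apply: (@dyadic_limit R (fun k => grad (p k) z i)) => k kk.
  rewrite -gradB; apply: grad_bound => x xz; rewrite pevalB; apply: pS.
  by apply: le_trans (near_ball x xz) (tmono _ _ kk).
apply: (@differentiable_quadratic _ _ F z lam (2 * B)) => v m m0 m1 vm.
have zvball : enorm (z + v) <= t k0.
  apply: near_ball => i; rewrite addrC addKr; apply: le_trans (vm i) _.
  by apply: le_trans m1 _; rewrite invf_le1 // ler1n.
pose W := 8 + 4 * \sum_(i < n) m.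
have W0 : 0 < W.
  by rewrite /W ltr_wpDr // mulr_ge0 // sumr_ge0 // => i _; exact: ltW.
apply/ler_addgt0Pr => d d0.
have [k kk hk] := half_pow_small k0 (divr_gt0 d0 W0).
have {}hk : half_pow k * W <= d by rewrite -ler_pdivlMr.
have T : modulus (peval (p k) (z + v) - peval (p k) z -
    \sum_(i < n) grad (p k) z i * v 0 i) <= 2 * B * m ^+ 2.
  by apply: taylor_bound => // x xz; exact: pB.
have e1 := FP _ k (le_trans zvball (tmono _ _ kk)).
have e2 := FP _ k (le_trans zball (tmono _ _ kk)).
have e3 : modulus (\sum_(i < n) grad (p k) z i * v 0 i - linear_form lam v) <=
    4 * half_pow k * \sum_(i < n) m.
  rewrite /linear_form -sumrB mulr_sumr; apply: le_trans (modulus_sum _ _ _) _.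
  apply: ler_sum => i _; rewrite -mulrBl modulusM.
  by rewrite ler_pM ?modulus_ge0 ?vm ?lamP.
move: T e1 e2 e3; set L := linear_form lam v; set Lk := \sum_(i < n) _ * _.
set a := peval (p k) (z + v); set b := peval (p k) z.
clearbody L Lk a b => T e1 e2 e3.
have -> : F (z + v) - F z - L = (a - b - Lk) - (a - F (z + v)) + (b - F z) + (Lk - L).
  by ring.
have t1 := modulusD (a - b - Lk - (a - F (z + v)) + (b - F z)) (Lk - L).
have t2 := modulusD (a - b - Lk - (a - F (z + v))) (b - F z).
have t3 := modulusB (a - b - Lk) (a - F (z + v)).
apply: le_trans t1 _; apply: le_trans (lerD t2 (lexx _)) _.
apply: le_trans (lerD (lerD t3 (lexx _)) (lexx _)) _.
apply: le_trans (lerD (lerD (lerD T e1) e2) e3) _.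
by rewrite -!addrA lerD2l; apply: le_trans hk; rewrite /W; lra.
Qed.

End EntireLimit.

(** * Approximation on the closed set *)

Section ClosedBall.
Variables (R : realType) (n : nat).
Local Notation C := (Cplx R).
Local Notation Cn := (Cspace R n).

Lemma enormZ (c : R) (z : Cn) : 0 <= c -> enorm ((rcplx c : C) *: z) = c * enorm z.
Proof.
move=> c0; rewrite /enorm (eq_bigr (fun i => c ^+ 2 * modulus (z 0 i) ^+ 2));
  last first.
  by move=> i _; rewrite mxE modulusM modulus_rcplx ger0_norm // exprMn.
by rewrite -mulr_sumr sqrtrM ?sqr_ge0 // sqrtr_sqr ger0_norm.
Qed.

Lemma cball_sub_closure (r : R) : 0 < r ->
  @cball R n r `<=` closure (@open_ball0 R n r).
Proof.
move=> r0 z zr A /nbhs_eball[e e0 eA].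
pose d := Num.min 1 (e / (2 * r)).
have d0 : 0 < d by rewrite lt_min ltr01 divr_gt0 // mulr_gt0.
have d1 : d <= 1 by rewrite ge_min lexx.
have dr : d * r < e.
  have : d * (2 * r) <= e by rewrite -ler_pdivlMr ?mulr_gt0 // ge_min lexx orbT.
  by lra.
exists ((rcplx (1 - d) : C) *: z); split.
  rewrite /open_ball0 /= enormZ ?subr_ge0 //.
  have : (1 - d) * enorm z <= (1 - d) * r by rewrite ler_wpM2l ?subr_ge0.
  have : 0 < d * r by rewrite mulr_gt0.
  by lra.
apply: eA.
have -> : (rcplx (1 - d) : C) *: z - z = - ((rcplx d : C) *: z).
  by rewrite rcplxB rcplx1 scalerBl scale1r addrAC subrr add0r.
have -> : enorm (- ((rcplx d : C) *: z)) = enorm ((rcplx d : C) *: z).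
  by congr Num.sqrt; apply: eq_bigr => i _; rewrite mxE modulusN.
rewrite enormZ ?(ltW d0) //; apply: le_lt_trans dr.
by rewrite ler_wpM2l // ltW.
Qed.

End ClosedBall.

Theorem proposition5 (R : realType) (n : nat) (Gamma : set (Cspace R n))
  (Gamma_closed : closed Gamma)
  (Gamma_area0 : area Gamma = 0%E)
  (Gamma_hull : forall D : set (Cspace R n), compact D ->
     bounded_set (hull (D `|` Gamma) `\` Gamma))
  (r : R) (r_gt0 : 0 < r)
  (ball_hull : closure (hull Gamma `\` Gamma) `<=` open_ball0 r)
  (f eps : Cspace R n -> Cplx R)
  (f_cont : {within Gamma, continuous f})
  (eps_cont : {within Gamma, continuous eps})
  (eps_gt0 : forall z, Gamma z -> 0 < eps z)
  (f_approx : uniformly_approximable_by_polynomials f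
     (Gamma `&` closure (open_ball0 r))) :
  exists F : Cspace R n -> Cplx R,
    entire F /\ forall z, Gamma z -> `|F z - f z| < eps z.
Proof.
pose half_pow k := (2^-1 : R) ^+ k.
have hfS k : half_pow k.+1 = half_pow k / 2 by rewrite /half_pow exprSr.
have hf0 k : 0 < half_pow k by rewrite exprn_gt0 // invr_gt0.
pose tol z := complex.Re (eps z).
have epsE z : Gamma z -> eps z = rcplx (tol z) /\ 0 < tol z.
  by move=> /eps_gt0/pos_rcplx.
have tol0 z : Gamma z -> 0 < tol z by move=> /epsE[].
have tol_cont : {within Gamma, continuous tol}.
  move=> x; apply: (@cvg_Re R (subspace Gamma) (nbhs x) _ eps); exact: eps_cont.
(* Radii: the hull over one closed ball stays inside the next open ball. *)
have /choice[U UP] (t : R) : exists u : R, forall z,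
    hull (@cball R n t `|` Gamma) z -> ~ Gamma z -> enorm z <= u.
  have /bounded_enorm[u uP] := Gamma_hull (@cball R n t) (@compact_cball R n t).
  by exists u => z hz nGz; exact: uP.
pose s := fix s k := if k is k'.+1 then Num.max (s k') (U (s k')) + 1 else r.
have sS k : s k + 1 <= s k.+1 by rewrite /= lerD2r le_max lexx.
have smono k : s k <= s k.+1 by apply: le_trans (sS k); rewrite lerDl.
have s0 k : 0 <= s k by elim: k => [|k IH]; [exact: ltW|exact: le_trans IH (smono k)].
have sinf (M : R) : exists k, M <= s k.
  have sk k : k%:R <= s k.
    elim: k => [|k IH]; first exact: s0.
    by apply: le_trans (sS k); rewrite -natr1 lerD2r.
  by exists (Num.truncn M).+1; apply: le_trans (ltW (truncnS_gt M)) (sk _).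
pose E k : set (Cspace R n) := if k is k'.+1 then @cball R n (s k') else set0.
have cE k : compact (E k) by case: k => [|k]; [exact: compact0|exact: compact_cball].
have Es k z : E k z -> enorm z <= s k.
  by case: k => [|k] //= zs; apply: le_trans zs (smono k).
have hullE k z : hull (E k `|` Gamma) z -> ~ Gamma z -> enorm z < s k.
  case: k => [|k] /=.
    by rewrite set0U => hz nGz; apply: ball_hull; exact: subset_closure.
  move=> hz nGz; apply: le_lt_trans (UP _ z hz nGz) _.
  by apply: le_lt_trans (_ : Num.max (s k) (U (s k)) < _); rewrite ?le_max ?lexx ?orbT ?ltrDl.
(* Tolerances increase strictly, to leave room for the error of each step. *)
pose c k := 2^-1 - half_pow k.+2.
have c0 k : 0 < c k.
  elim: k => [|k IH]; first by rewrite /c /half_pow !exprS expr0; lra.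
  by apply: lt_trans IH _; rewrite /c (hfS k.+2); have := hf0 k.+2; lra.
have cS k : c k < c k.+1 by rewrite /c (hfS k.+2); have := hf0 k.+2; lra.
pose good k p := forall z, Gamma z -> enorm z <= s k ->
  modulus (f z - peval p z) <= c k * tol z.
have [p0 good0] : exists p, good 0%N p.
  have [mu mu0 muP] := tol_lower Gamma_closed tol_cont tol0 r.
  have [p pP] := f_approx (c 0%N * mu) (mulr_gt0 (c0 0%N) mu0).
  exists p => z Gz zr; apply: ltW; apply: lt_le_trans (pP z _) _.
    by split=> //; exact: cball_sub_closure.
  by rewrite ler_wpM2l ?(ltW (c0 0%N)) // muP.
have /choice[next nextP] (kp : nat * mpoly.mpoly n (Cplx R)) :
    exists q, good kp.1 kp.2 -> good kp.1.+1 q /\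
      forall z, E kp.1 z -> modulus (peval q z - peval kp.2 z) <= half_pow kp.1.
  case: kp => k p /=; have [gp|ngp] := pselect (good k p); last by exists p.
  have [q [q1 q2]] := extend_approximation Gamma_closed Gamma_area0 f_cont
    tol_cont tol0 (s k.+1) (cE k) (s0 k) (hullE k) (c0 k) (cS k) (hf0 k) gp.
  by exists q => _; split=> // z Ez; apply: q1 => //; exact: Es.
pose p := fix p k := if k is k'.+1 then next (k', p k') else p0.
have pgood k : good k (p k).
  by elim: k => [|k IH] //; have [] := nextP (k, p k) IH.
have pstep k z : E k z -> modulus (peval (p k.+1) z - peval (p k) z) <= half_pow k.
  by have [_] := nextP (k, p k) (pgood k); apply.
have [k z zs|F [entF FP]] := entire_limit (p := fun k => p k.+1) smono sinf.
  apply: le_trans (pstep k.+1 z zs) _.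
  by rewrite -/(half_pow k) hfS; have := hf0 k; lra.
exists F; split=> // z Gz; have [-> tz0] := epsE z Gz; rewrite norm_lt.
have [k1 zk1] := sinf (enorm z).
have t16 : 0 < tol z / 16 by rewrite divr_gt0.
have [k kk hk] := half_pow_small k1 t16.
have zk : enorm z <= s k.
  apply: le_trans zk1 _; rewrite -(subnK kk); elim: (k - k1)%N => [|d IH] //.
  exact: le_trans IH (smono _).
have h1 := FP k z zk.
have h2 := pgood k.+1 z Gz (le_trans zk (smono k)).
have h3 : c k.+1 * tol z <= 2^-1 * tol z.
  by rewrite ler_wpM2r ?(ltW tz0) // /c gerBl ltW.
have := modulusB (f z - peval (p k.+1) z) (F z - peval (p k.+1) z).
rewrite opprB addrA subrK (modulusC (f z) (F z)) (modulusC (F z) (peval _ _)).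
by lra.
Qed.
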